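(* Let $J(\theta)=J^*+\frac12(\theta-\theta^* )^TH(\theta-\theta^* )$ with $H\in\mathbb{R}^{n\times n}$ symmetric positive definite, $J^*\in\mathbb{R}$, $\theta^*\in\mathbb{R}^n$, and $h(\theta)=h_0+h_1^T(\theta-\theta^* )$ with $h_0\in\mathbb{R}$, $h_1\in\mathbb{R}^n\setminus\{0\}$. Let the design constants $\omega_{\rm f},\omega_i,\delta,a,k,c$ be positive, where the ratios $\omega_i/\omega_j$ are rational and $\omega_i\ne\omega_j$, $\omega_i+\omega_j\neq\omega_k$ for distinct $i,j,k$, and $\omega_i=\omega\,\omega_i'$ with scaling parameter $\omega>0$. Consider the ASfES algorithm (see context), with $\theta(t)=\hat\theta(t)+S(t)$, $\tilde x=[\hat\theta-\theta^*;G_J;\eta_J;G_h;\eta_h;\gamma]$, and let $x^{\rm a,e}$ be the equilibrium point given in the context. Then there exist positive constants $\rho,\omega^*$ such that if $\|\tilde x(0)-x^{\rm a,e}\|<\rho$, then for all $\omega\in[\omega^*,\infty)$, $$\limsup_{t\to\infty}J(\theta(t))=J_s^*+O(1/\omega+a+\delta),$$ where $J_s^*$ is the minimum of $J(\theta)$ on the safe set $\mathcal{C}=\{\theta\in\mathbb{R}^n:h(\theta)\ge 0\}$.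
   Context: **Algorithm (ASfES).** With states $\hat\theta,G_J,G_h\in\mathbb{R}^n$ and $\eta_J,\eta_h,\gamma\in\mathbb{R}$: $$\dot{\hat\theta}=-kG_J+\gamma\,\text{max}_\delta\{kG_J^TG_h-c\eta_h\}G_h,$$ $$\dot G_J=-\omega_{\rm f}G_J+\omega_{\rm f}(J(\hat\theta+S(t))-\eta_J)M(t),\qquad \dot\eta_J=-\omega_{\rm f}\eta_J+\omega_{\rm f}J(\hat\theta+S(t)),$$ $$\dot G_h=-\omega_{\rm f}G_h+\omega_{\rm f}(h(\hat\theta+S(t))-\eta_h)M(t),\qquad \dot\eta_h=-\omega_{\rm f}\eta_h+\omega_{\rm f}h(\hat\theta+S(t)),$$ $$\dot\gamma=\omega_{\rm f}\gamma(1-\gamma\|G_h\|^2),$$ where $S_i(t)=a\sin(\omega_it)$, $M_i(t)=\frac2a\sin(\omega_it)$ for $i=1,\dots,n$, and $\text{max}_\delta\{x\}=\frac12(x+\sqrt{x^2+\delta})$. The frequencies are $\omega_i=\omega\,\omega_i'$ with the $\omega_i'$ fixed and $\omega$ a common scaling. **Equilibrium.** $x^{\rm a,e}=[\tilde\theta^{\rm a,e};G_J^{\rm a,e};\eta_J^{\rm a,e};G_h^{\rm a,e};\eta_h^{\rm a,e};\gamma^{\rm a,e}]$ (stacked vector), where, with $q=h_1^TH^{-1}h_1$, $d=\frac{c}{k\|h_1\|^2}q$ and $s=\sqrt{h_0^2+\delta d/c^2}$, $$G_J^{\rm a,e}=\frac{-h_0+s}{2q}h_1,\quad \tilde\theta^{\rm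 a,e}=H^{-1}G_J^{\rm a,e},\quad \eta_J^{\rm a,e}=J^*+\frac{a^2}{4}\mathrm{Tr}(H)+\frac{(-h_0+s)^2}{8q},$$ $$G_h^{\rm a,e}=h_1,\quad \eta_h^{\rm a,e}=\frac{h_0+s}{2},\quad \gamma^{\rm a,e}=\frac1{\|h_1\|^2}.$$ **Order notation.** $O(r)$ denotes a quantity bounded in absolute value by $Kr$, with a constant $K>0$ not depending on $t$ or on the asymptotic parameters appearing in $r$ (here $\omega$ large, $a,\delta$ small). The constants $\rho,\omega^*$ may depend on the problem data and the design constants other than $\omega$. *)

(* Defs.v *)
From HB Require Import structures.
From mathcomp Require Import all_boot all_order all_algebra.
From mathcomp Require Import all_classical all_reals all_analysis.

Set Implicit Arguments.
Unset Strict Implicit.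
Unset Printing Implicit Defensive.

Import Order.TTheory GRing.Theory Num.Theory.
Import numFieldNormedType.Exports.

Local Open Scope classical_set_scope.
Local Open Scope ring_scope.

Section Vectors.
Variable R : realType.

Definition dotv (m : nat) (u v : 'cV[R]_m) : R := (u^T *m v) 0 0.

(* The library norm `|v| of a matrix is the max norm; this is the Euclidean
   one. *)
Definition enorm (m : nat) (v : 'cV[R]_m) : R := Num.sqrt (dotv v v).

Definition posdef (m : nat) (H : 'M[R]_m) : Prop :=
  forall v : 'cV[R]_m, v != 0 -> 0 < dotv v (H *m v).

Definition is_minimum (T : Type) (f : T -> R) (C : set T) (m : R) : Prop :=
  (f @` C) m /\ lbound (f @` C) m.

Definition maxd (delta x : R) : R := 2^-1 * (x + Num.sqrt (x ^+ 2 + delta)).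

End Vectors.

Section Problem.
Variables (R : realType) (n : nat).

Definition objective (H : 'M[R]_n) (Jstar : R) (thstar theta : 'cV[R]_n) : R :=
  Jstar + 2^-1 * dotv (theta - thstar) (H *m (theta - thstar)).

Definition constraint (h0 : R) (h1 thstar theta : 'cV[R]_n) : R :=
  h0 + dotv h1 (theta - thstar).

Definition safe_set (h : 'cV[R]_n -> R) : set 'cV[R]_n :=
  [set theta | 0 <= h theta].

(* These conditions are invariant under a common positive rescaling of the
   frequencies. *)
Definition admissible_freq (om : 'I_n -> R) : Prop :=
  [/\ forall i, 0 < om i,
      forall i j, exists q : rat, om i / om j = ratr q,
      forall i j, i != j -> om i != om j
    & forall i j l, i != j -> j != l -> i != l -> om i + om j != om l].

Definition dither (a : R) (om : 'I_n -> R) (t : R) : 'cV[R]_n :=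
  \col_i (a * sin (om i * t)).

Definition demod (a : R) (om : 'I_n -> R) (t : R) : 'cV[R]_n :=
  \col_i (2 / a * sin (om i * t)).

End Problem.

Record state (R : realType) (n : nat) := State {
  st_theta : 'cV[R]_n;
  st_GJ : 'cV[R]_n;
  st_etaJ : R;
  st_Gh : 'cV[R]_n;
  st_etah : R;
  st_gamma : R }.

Section ASfES.
Variables (R : realType) (n : nat).

(* Scalars are turned into 1 x 1 blocks by _%:M. *)
Definition stack (x : state R n) : 'cV[R]_(n + (n + (1 + (n + (1 + 1))))) :=
  col_mx (st_theta x)
 (col_mx (st_GJ x)
 (col_mx (st_etaJ x)%:M
 (col_mx (st_Gh x)
 (col_mx (st_etah x)%:M (st_gamma x)%:M)))).

Definition asfes_field (J h : 'cV[R]_n -> R) (wf k c a delta : R)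
    (om : 'I_n -> R) (t : R) (x : state R n) : state R n :=
  let: State th GJ etaJ Gh etah gam := x in
  let S := dither a om t in
  let M := demod a om t in
  State
    (- (k *: GJ) + (gam * maxd delta (k * dotv GJ Gh - c * etah)) *: Gh)
    (- (wf *: GJ) + (wf * (J (th + S) - etaJ)) *: M)
    (- (wf * etaJ) + wf * J (th + S))
    (- (wf *: Gh) + (wf * (h (th + S) - etah)) *: M)
    (- (wf * etah) + wf * h (th + S))
    (wf * gam * (1 - gam * enorm Gh ^+ 2)).

(* Solution on [0, +oo[: the equation holds at every t > 0 and x is continuous
   up to t = 0; since the field is continuous, the equation then also holds at
   t = 0 with the right derivative. Values at t < 0 are irrelevant. *)
Definition is_solution (F : R -> state R n -> state R n) (x : R -> state R n)
    : Prop :=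
  {within `[0, +oo[, continuous (stack \o x)} /\
  forall t : R, 0 < t -> is_derive t 1 (stack \o x) (stack (F t (x t))).

Definition recenter (thstar : 'cV[R]_n) (x : state R n) : state R n :=
  let: State th GJ etaJ Gh etah gam := x in
  State (th - thstar) GJ etaJ Gh etah gam.

Definition equilibrium (H : 'M[R]_n) (Jstar h0 : R) (h1 : 'cV[R]_n)
    (k c a delta : R) : state R n :=
  let q := dotv h1 (invmx H *m h1) in
  let d := c / (k * enorm h1 ^+ 2) * q in
  let s := Num.sqrt (h0 ^+ 2 + delta * d / c ^+ 2) in
  let GJ := ((- h0 + s) / (2 * q)) *: h1 in
  State
    (invmx H *m GJ)
    GJ
    (Jstar + a ^+ 2 / 4 * \tr H + (- h0 + s) ^+ 2 / (8 * q))
    h1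
    ((h0 + s) / 2)
    (1 / enorm h1 ^+ 2).

End ASfES.

(* Main.v *)
Require Import Defs.
From HB Require Import structures.
From mathcomp Require Import all_boot all_order all_algebra.
From mathcomp Require Import all_classical all_reals all_analysis.
From mathcomp Require Import ring lra.

(** The product of the demodulating sines with the measured quadratic cost has
    the gradient of the cost as its mean.  Replacing every product of sines by its mean turns
    the algorithm into an autonomous averaged field (avg_field), whose
    equilibrium is the point of the theorem.  The proof has four ingredients.

    Stability of the averaged field.  Write u for the linearized derivative of
    theta, P for the orthogonal projector on h1 and p, between 0 and 1, for the
    slope of the smoothed maximum at the equilibrium.  The two filters turn the
    linearized loop into theta'' + wf theta' + wf Q N theta = 0 with
    Q = I - p P and N = k H + c p / (1 - p) P, both symmetric
    positive definite.  Hence |u|^2 in the metric of the inverse of Q, plus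
    wf theta.N theta, plus a small cross term, is a strict Lyapunov function for
    every choice of the gains.  The filter states are driven by theta, while
    the estimate of h1 evolves by itself and drives gamma, so squares of all
    these errors can be added with suitable weights (lyap_weights, lyap_decay).

    Averaging.  Sums and products of up to three of the sines, minus their means,
    have bounded primitives (zero_mean_sin, zero_mean_pair, zero_mean_sin3): a
    sine has mean zero at every frequency, and cosines appear only at the
    frequencies om_i + om_j, and om_i - om_j with i different from j.  So along a
    trajectory of a field run at speed w, an oscillating term is a derivative of
    a quantity of size O(1/w), up to O(1/w) (oscillating_primitive).  Subtracting
    that quantity from the Lyapunov function leaves a Gronwall inequality, which
    keeps the trajectory in a prescribed ball around the equilibrium for all
    time once w is large (trapped_near_equilibrium).

    Existence.  The field truncated outside the ball is bounded and globally
    Lipschitz, so Picard iteration gives a global solution (picard); being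
    trapped in the ball, it solves the original equation
    (practical_stability).

    Cost.  The threshold on w may depend on a, so the radius of the ball is taken
    equal to a.  Then theta(t), dither included, stays within 2 a of the
    equilibrium in the max norm, and the cost there differs from the constrained minimum by O(delta)
    (cost_near_equilibrium). *)

Set Implicit Arguments.
Unset Strict Implicit.
Unset Printing Implicit Defensive.

Import Order.TTheory GRing.Theory Num.Theory.
Import numFieldNormedType.Exports.

Local Open Scope classical_set_scope.
Local Open Scope ring_scope.

(** * Calculus on the line and in column vectors *)

Section Calculus.
Variable R : realType.

Lemma nonincreasing_of_derive (f df : R -> R) (a b : R) : a <= b ->
  {within `[a, b], continuous f} ->
  (forall t, a < t < b -> is_derive t 1 f (df t)) ->
  (forall t, a < t < b -> df t <= 0) -> f b <= f a.
Proof.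
move=> ab cf dfE df0.
apply: (@ler0_derive1_nincr R f a b) => //.
- by move=> x; rewrite in_itv /= => /dfE [].
- move=> x; rewrite in_itv /= => xab.
  by rewrite derive1E; have /= [_ ->] := dfE _ xab; exact: df0.
Qed.

(** Mean value inequality: f is compared with a function g that grows at least
    as fast, which avoids integrating the bound on the derivative. *)
Lemma le_increment (f df g dg : R -> R) (a b : R) : a <= b ->
  {within `[a, b], continuous f} -> {within `[a, b], continuous g} ->
  (forall t, a < t < b -> is_derive t 1 f (df t)) ->
  (forall t, a < t < b -> is_derive t 1 g (dg t)) ->
  (forall t, a < t < b -> `|df t| <= dg t) -> `|f b - f a| <= g b - g a.
Proof.
move=> ab cf cg dfE dgE dfg.
have key (h dh : R -> R) : {within `[a, b], continuous h} ->
    (forall t, a < t < b -> is_derive t 1 h (dh t)) ->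
    (forall t, a < t < b -> dh t <= dg t) -> h b - h a <= g b - g a.
  move=> ch dhE dhg.
  have : h b - g b <= h a - g a.
    apply: (@nonincreasing_of_derive (h \- g) (fun t => dh t - dg t)) => //.
    - by move=> x; apply: cvgB; [exact: ch|exact: cg].
    - by move=> t tab; have := dhE t tab; have := dgE t tab => ? ?; exact: is_deriveB.
    - by move=> t /dhg; rewrite subr_le0.
  lra.
rewrite ler_norml; apply/andP; split; last first.
  by apply: (key _ _ cf dfE) => t /dfg /(le_trans (ler_norm _)).
have := @key (\- f) (fun t => - df t).
have -> : (\- f) b - (\- f) a = - (f b - f a) by rewrite /= opprD.
rewrite lerNl; apply.
- by move=> x; apply: cvgN; exact: cf.
- by move=> t tab; have := dfE t tab => ?; exact: is_deriveN.
- by move=> t /dfg; apply: le_trans; rewrite -normrN ler_norm.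
Qed.

Lemma is_derive_coord m n (x : R -> 'M[R]_(m, n)) (t : R) (v : 'M[R]_(m, n)) :
  is_derive t 1 x v <->
  forall i j, is_derive t 1 (fun s => x s i j) (v i j).
Proof.
split=> [[dx <-] i j|dx].
  have := dx => /derivable_mxP /(_ i j) h.
  by rewrite (derive_mx dx) mxE; exact: DeriveDef.
have d : derivable x t 1 by apply/derivable_mxP => i j; case: (dx i j).
apply: DeriveDef => //; rewrite (derive_mx d); apply/matrixP => i j.
by rewrite mxE; case: (dx i j).
Qed.

Lemma coord_le_norm m n (x : 'M[R]_(m, n)) i j : `|x i j| <= `|x|.
Proof.
rewrite [leRHS]/Num.Def.normr /= mx_normrE.
exact: (@le_bigmax _ _ _ 0 (fun ij => `|x ij.1 ij.2|) (i, j)).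
Qed.

Lemma norm_le_coord m n (x : 'M[R]_(m, n)) (c : R) : 0 <= c ->
  (forall i j, `|x i j| <= c) -> `|x| <= c.
Proof.
move=> c0 h; rewrite [leLHS]/Num.Def.normr /= mx_normrE.
by apply: bigmax_le => // -[i j] _; exact: h.
Qed.

(** The integral starts at -1, so that 0 is an interior point and the primitive
    has a two-sided derivative there. *)
Lemma primitive_exists (g : R -> R) : continuous g ->
  exists G : R -> R, G 0 = 0 /\ forall t : R, 0 <= t -> is_derive t 1 G (g t).
Proof.
move=> cg.
pose G0 (x : R) : R := (\int[lebesgue_measure]_(t in `[(-1)%R, x]) g t)%R.
have dG0 (t : R) : 0 <= t -> is_derive t 1 G0 (g t).
  move=> t0.
  have [dG eG] : derivable G0 t 1 /\ G0^`()%classic t = g t.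
    apply: (@continuous_FTC1_closed R g (-1) t (t + 1)) => //.
    - by rewrite ltrDl.
    - apply: continuous_compact_integrable; first exact: segment_compact.
      by move=> x; apply: continuous_subspaceT; exact: cg.
    - by rewrite (lt_le_trans _ t0)// ltrN10.
    - exact: cg.
  by apply: DeriveDef; [exact: dG|rewrite -derive1E; exact: eG].
exists (fun x => G0 x - G0 0); split; first by rewrite subrr.
move=> t t0; have := dG0 t t0 => h.
rewrite -[g t]subr0; apply: is_deriveB.
Qed.

(** The limit is the supremum of the nondecreasing lower bounds
    u k - 2 D / 2^k, each of which lies below every upper bound
    u k + 2 D / 2^k. *)
Lemma geometric_limit (u : nat -> R) (D : R) : 0 <= D ->
  (forall k, `|u k.+1 - u k| <= D * 2^-1 ^+ k) ->
  exists l, forall k, `|l - u k| <= 2 * D * 2^-1 ^+ k.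
Proof.
move=> D0 hu.
pose a k := u k - 2 * D * 2^-1 ^+ k; pose b k := u k + 2 * D * 2^-1 ^+ k.
have step k : a k <= a k.+1 /\ b k.+1 <= b k.
  have := hu k; rewrite ler_norml /a /b exprS => /andP [].
  by split; lra.
have amono j k : (j <= k)%N -> a j <= a k.
  elim: k => [|k IH]; first by rewrite leqn0 => /eqP ->.
  rewrite leq_eqVlt => /orP [/eqP -> //|/IH h].
  exact: le_trans h (step k).1.
have bmono j k : (j <= k)%N -> b k <= b j.
  elim: k => [|k IH]; first by rewrite leqn0 => /eqP ->.
  rewrite leq_eqVlt => /orP [/eqP -> //|/IH h].
  exact: le_trans (step k).2 h.
have ab j k : a j <= b k.
  apply: le_trans (amono j (maxn j k) (leq_maxl _ _)) _.
  apply: le_trans _ (bmono k (maxn j k) (leq_maxr _ _)).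
  have : 0 <= 2 * D * 2^-1 ^+ maxn j k by rewrite !mulr_ge0 ?exprn_ge0 ?invr_ge0.
  by rewrite /a /b; lra.
exists (sup (range a)) => k.
have h1 : a k <= sup (range a).
  apply: ub_le_sup; last by exists k.
  by exists (b 0%N) => _ [j _ <-]; exact: ab.
have h2 : sup (range a) <= b k.
  apply: ge_sup; first by exists (a 0%N); exists 0%N.
  by move=> _ [j _ <-]; exact: ab.
by rewrite ler_norml; move: h1 h2; rewrite /a /b => ? ?; apply/andP; split; lra.
Qed.

End Calculus.

(** * Global solutions of bounded Lipschitz equations *)

Section Picard.
Variables (R : realType) (N : nat).
Notation V := 'cV[R]_N.

Lemma continuous_coord (x : R -> V) : continuous x <->
  forall i j, continuous (fun t => x t i j).
Proof.
split=> [cx i j t|cx t].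
  apply: (@continuous_comp _ _ _ x (fun M : V => M i j)); first exact: cx.
  exact: coord_continuous.
apply/cvgrPdist_le => e e0.
have h i j : \forall s \near t, `|x t i j - x s i j| <= e.
  by have /cvgrPdist_le := cx i j t; exact.
have : \forall s \near t, forall i j, `|x t i j - x s i j| <= e.
  apply: (@filter_forall R _ (fun i s => forall j, `|x t i j - x s i j| <= e) (nbhs t)).
  move=> i; apply: (@filter_forall R _ (fun j s => `|x t i j - x s i j| <= e) (nbhs t)).
  exact: h.
apply: filterS => s hs; apply: norm_le_coord; first exact: ltW.
by move=> i j; rewrite !mxE; exact: hs.
Qed.

Lemma le_increment_vec (x v : R -> V) (g dg : R -> R) (a b : R) : a <= b ->
  continuous x -> continuous g ->
  (forall t, a < t < b -> is_derive t 1 x (v t)) ->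
  (forall t, a < t < b -> is_derive t 1 g (dg t)) ->
  (forall t, a < t < b -> `|v t| <= dg t) -> 0 <= g b - g a ->
  `|x b - x a| <= g b - g a.
Proof.
move=> ab cx cg dx dgE vdg g0; apply: norm_le_coord => // i j; rewrite !mxE.
apply: (@le_increment _ (fun t => x t i j) (fun t => v t i j) _ dg) => //.
- by apply: continuous_subspaceT; have /continuous_coord := cx; exact.
- by apply: continuous_subspaceT.
- by move=> t /dx /is_derive_coord; exact.
- by move=> t /vdg; apply: le_trans; exact: coord_le_norm.
Qed.

Lemma is_derive_mull (c t : R) : is_derive t 1 (fun r => c * r) c.
Proof.
have := @is_deriveZ _ _ _ id c t 1 1 (is_derive_id _ _).
by rewrite /GRing.scale /= mulr1.
Qed.

Variables (F : R -> V -> V) (L M : R).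
Hypothesis L0 : 0 < L.
Hypothesis M0 : 0 <= M.
Hypothesis cF : forall x, continuous (F^~ x).
Hypothesis lipF : forall t x y, `|F t x - F t y| <= L * `|x - y|.
Hypothesis bndF : forall t x, `|F t x| <= M.

Lemma continuous_along (x : R -> V) : continuous x ->
  continuous (fun t => F t (x t)).
Proof.
move=> cx t; apply/cvgrPdist_le => e e0.
have e20 : 0 < e / 2 by rewrite divr_gt0.
have eL0 : 0 < e / 2 / L by rewrite divr_gt0.
have /cvgrPdist_le /(_ _ e20) h1 := @cF (x t) t.
have /cvgrPdist_le /(_ _ eL0) h2 := cx t.
near=> s.
have -> : F t (x t) - F s (x s) =
  (F t (x t) - F s (x t)) + (F s (x t) - F s (x s)) by rewrite addrA subrK.
apply: (le_trans (ler_normD _ _)).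
have -> : e = e / 2 + L * (e / 2 / L).
  by field; rewrite gt_eqF.
apply: lerD; first by near: s.
apply: (le_trans (lipF _ _ _)); rewrite ler_pM2l//.
by near: s.
Unshelve. all: by end_near. Qed.

Lemma continuous_max0 : continuous (fun t : R => Num.max t 0).
Proof. by move=> t; apply: (@continuous_max _ _ id (cst 0)); [exact: cvg_id|exact: cvg_cst]. Qed.

Variable x0 : V.

(** Curves are extended to negative times by their initial value: they are
    then continuous on the whole line, and the initial time needs no one-sided
    notions. *)
Lemma picard_step_exists (y : R -> V) : continuous y ->
  exists z : R -> V, [/\ forall t : R, t <= 0 -> z t = x0, continuous z &
    forall t : R, 0 < t -> is_derive t 1 z (F t (y t))].
Proof.
move=> cy.
have /continuous_coord cFy := continuous_along cy.
have prim i : exists G : R -> R, G 0 = 0 /\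
    forall t : R, 0 <= t -> is_derive t 1 G (F t (y t) i 0).
  exact: (primitive_exists (cFy i 0)).
have [G hG] := choice prim.
exists (fun t => x0 + \col_i G i (Num.max t 0)); split.
- move=> t t0; apply/matrixP => i j; rewrite !mxE (max_idPr t0).
  by rewrite (hG i).1 addr0.
- apply/continuous_coord => i j t.
  have -> : (fun t => (x0 + \col_i0 G i0 (Num.max t 0)) i j) =
      (fun t => x0 i j + (G i \o (fun t => Num.max t 0)) t).
    by apply/funext => s; rewrite !mxE.
  apply: cvgD; first exact: cvg_cst.
  apply: continuous_comp; first exact: continuous_max0.
  have m0 : 0 <= Num.max t 0 by rewrite le_max lexx orbT.
  have [dG _] := (hG i).2 _ m0.
  by apply: differentiable_continuous; apply/derivable1_diffP.
- move=> t t0; apply/is_derive_coord => i j; rewrite ord1.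
  have h : is_derive t 1 (fun s => x0 i 0 + G i s) (F t (y t) i 0).
    rewrite -[F t (y t) i 0]add0r; have ? := (hG i).2 _ (ltW t0).
    exact: is_deriveD.
  have pos : \forall s \near t, 0 <= s.
    apply: (filterS _ (cvgr_gt t (@cvg_id _ (nbhs t)) 0 t0)).
    by move=> s /= /ltW.
  apply: near_eq_is_derive h.
  near=> s; rewrite !mxE; congr (_ + G i _).
  by apply/esym/max_idPl; near: s;
  exact: pos.
Unshelve. all: by end_near. Qed.

Definition picard_step (y : {y : R -> V | continuous y}) :
    {z : R -> V | continuous z} :=
  let: exist y cy := y in
  let: exist z hz := cid (picard_step_exists cy) in
  let: And3 _ cz _ := hz in exist _ z cz.

Lemma picard_stepP (y : {y : R -> V | continuous y}) :
  [/\ forall t : R, t <= 0 -> sval (picard_step y) t = x0,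
      continuous (sval (picard_step y)) &
      forall t : R, 0 < t -> is_derive t 1 (sval (picard_step y)) (F t (sval y t))].
Proof.
case: y => y cy /=; case: (cid _) => z hz /=.
by case: (hz) => z0 cz dz /=; split.
Qed.

Lemma picard_start_continuous : continuous (fun _ : R => x0).
Proof. by move=> t; exact: cvg_cst. Qed.

Definition picard_start : {y : R -> V | continuous y} :=
  exist _ (fun=> x0) picard_start_continuous.

Definition picard_iter k : {y : R -> V | continuous y} :=
  iter k picard_step picard_start.

Lemma picard_step_lip y (s t : R) : 0 <= s <= t ->
  `|sval (picard_step y) t - sval (picard_step y) s| <= M * (t - s).
Proof.
have [_ cz dz] := picard_stepP y; move=> /andP [s0 st].
rewrite mulrBr; apply: (@le_increment_vec _ (fun r => F r (sval y r)) (fun r => M * r) (fun=> M)) => //.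
- by move=> r; apply: cvgM; [exact: cvg_cst|exact: cvg_id].
- by move=> r /andP [sr _]; apply: dz; exact: le_lt_trans sr.
- by move=> r _; exact: is_derive_mull.
- by rewrite -mulrBr mulr_ge0// subr_ge0.
Qed.

Lemma picard_step_lipT y (s t : R) :
  `|sval (picard_step y) t - sval (picard_step y) s| <= M * `|t - s|.
Proof.
wlog st : s t / s <= t.
  move=> h; case: (leP s t) => [|/ltW]; first exact: h.
  by move=> /h; rewrite distrC [`|s - t|]distrC.
have [z0 _ _] := picard_stepP y.
case: (leP s 0) => s0; last first.
  by rewrite (ger0_norm (_ : 0 <= t - s)) ?subr_ge0// picard_step_lip// ltW.
rewrite (z0 _ s0); case: (leP t 0) => t0.
  by rewrite (z0 _ t0) subrr normr0 mulr_ge0.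
rewrite -(z0 _ (lexx 0)); apply: le_trans (@picard_step_lip y 0 t _) _.
  by rewrite lexx ltW.
by rewrite ler_wpM2l// ger0_norm ?subr_ge0// lerD2l lerN2.
Qed.

(** The exponential weight that makes a Picard step a contraction on the whole
    half-line at once. *)
Definition exp_weight (t : R) := expR (2 * L * t).

Lemma exp_weight_derive (t : R) : is_derive t 1 exp_weight (2 * L * exp_weight t).
Proof.
have h := is_derive_mull (2 * L) t.
by rewrite mulrC; apply: is_derive1_comp.
Qed.

Lemma exp_weight_continuous : continuous exp_weight.
Proof.
move=> t; have [dG _] := exp_weight_derive t.
by apply: differentiable_continuous; apply/derivable1_diffP.
Qed.

(** The Lipschitz bound gives a derivative of size L D exp (2 L t), whose
    primitive is half of D exp (2 L t). *)
Lemma picard_contract (y1 y2 : {y : R -> V | continuous y}) (D : R) : 0 <= D ->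
  (forall t : R, 0 <= t -> `|sval y1 t - sval y2 t| <= D * exp_weight t) ->
  forall t : R, 0 <= t ->
  `|sval (picard_step y1) t - sval (picard_step y2) t| <= D / 2 * exp_weight t.
Proof.
move=> D0 h t t0.
have [z1 c1 d1] := picard_stepP y1; have [z2 c2 d2] := picard_stepP y2.
pose x := (sval (picard_step y1) \- sval (picard_step y2)).
have w0 : 0 <= D / 2 * exp_weight 0 by rewrite mulr_ge0 ?expR_ge0 ?divr_ge0.
suff : `|x t - x 0| <= D / 2 * exp_weight t - D / 2 * exp_weight 0.
  rewrite /x /= (z1 _ (lexx 0)) (z2 _ (lexx 0)) subrr subr0 => /le_trans; apply.
  by rewrite gerBl.
have dw (r : R) : is_derive r 1 (fun r => D / 2 * exp_weight r) (D / 2 * (2 * L * exp_weight r)).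
  by have := exp_weight_derive r => ?; apply: is_deriveZ.
apply: (@le_increment_vec _ (fun r => F r (sval y1 r) - F r (sval y2 r))
   (fun r => D / 2 * exp_weight r) (fun r => D / 2 * (2 * L * exp_weight r))) => //.
- by move=> r; apply: cvgB; [exact: c1|exact: c2].
- by move=> r; apply: cvgM; [exact: cvg_cst|exact: exp_weight_continuous].
- move=> r /andP [r0 _]; have := d1 r r0; have := d2 r r0 => ? ?.
  exact: is_deriveB.
- move=> r /andP [r0 _]; apply: le_trans (lipF _ _ _) _.
  have -> : D / 2 * (2 * L * exp_weight r) = L * (D * exp_weight r) by field.
  by rewrite ler_pM2l// h// ltW.
- rewrite -mulrBr mulr_ge0 ?divr_ge0// subr_ge0 ler_expR.
  by rewrite ler_wpM2l// mulr_ge0// ltW.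
Qed.

Lemma picard_iter_dist k (t : R) : 0 <= t ->
  `|sval (picard_iter k.+1) t - sval (picard_iter k) t| <=
  M / L * 2^-1 ^+ k * exp_weight t.
Proof.
have ML0 : 0 <= M / L by rewrite divr_ge0// ltW.
elim: k t => [|k IH] t t0.
  rewrite expr0 mulr1.
  have [z0 _ _] := picard_stepP picard_start.
  rewrite -[sval (picard_iter 0) t](z0 _ (lexx 0)); apply: le_trans (@picard_step_lip _ 0 t _) _.
    by rewrite lexx.
  rewrite subr0 -mulrA ler_wpM2l// ler_pdivlMl//.
  apply: le_trans (expR_ge1Dx _).
  have : 0 <= L * t by rewrite mulr_ge0// ltW.
  by lra.
have -> : M / L * 2^-1 ^+ k.+1 = M / L * 2^-1 ^+ k / 2 by rewrite exprSr mulrA.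
apply: picard_contract => //.
by rewrite mulr_ge0// exprn_ge0// invr_ge0.
Qed.

(** The iterates converge pointwise at a geometric rate.  They are M-Lipschitz in
    time, so their limit is continuous and can be fed to a Picard step again;
    the contraction estimate identifies the result with the limit. *)
Theorem picard : exists x : R -> V, [/\ x 0 = x0, continuous x &
  forall t : R, 0 < t -> is_derive t 1 x (F t (x t))].
Proof.
have ML0 : 0 <= M / L by rewrite divr_ge0// ltW.
have MLw t : 0 <= M / L * exp_weight t by rewrite mulr_ge0// expR_ge0.
have lim (t : R) : exists l : V, 0 <= t -> forall k,
    `|l - sval (picard_iter k) t| <= 2 * (M / L * exp_weight t) * 2^-1 ^+ k.
  have li (i : 'I_N) : exists l : R, 0 <= t -> forall k,
    `|l - sval (picard_iter k) t i 0| <= 2 * (M / L * exp_weight t) * 2^-1 ^+ k.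
    case: (leP 0 t) => t0; last by exists 0.
    have [k|l hl] := @geometric_limit _ (fun k => sval (picard_iter k) t i 0) _ (MLw t).
      have := picard_iter_dist k t0; rewrite mulrAC; apply: le_trans.
      by have := coord_le_norm (sval (picard_iter k.+1) t - sval (picard_iter k) t) i 0; rewrite !mxE.
    by exists l => _.
  have [l hl] := choice li.
  exists (\col_i l i) => t0 k; apply: norm_le_coord.
    by rewrite !mulr_ge0// ?expR_ge0// ?exprn_ge0 ?invr_ge0// ltW.
  by move=> i j; rewrite ord1 !mxE; exact: hl.
have [l hl] := choice lim.
pose y (t : R) := l (Num.max t 0).
have small (C e : R) : 0 < e -> exists k, C * 2^-1 ^+ k <= e.
  move=> e0; have h2 : `|2^-1 : R| < 1 by rewrite ger0_norm ?invf_lt1// ?ltr1n ?invr_ge0.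
  have /cvgrPdist_le /(_ _ e0) [k _ hk] := @cvg_geometric R C _ h2.
  exists k; have := hk k (leqnn k); rewrite /= sub0r normrN; apply: le_trans.
  exact: ler_norm.
have ylip (s t : R) : `|y t - y s| <= M * `|t - s|.
  apply/ler_addgt0Pr => e e0; rewrite /y.
  set s' := Num.max s 0; set t' := Num.max t 0.
  have s0 : 0 <= s' by rewrite le_max lexx orbT.
  have t0 : 0 <= t' by rewrite le_max lexx orbT.
  have ts : `|t' - s'| <= `|t - s|.
    rewrite /t' /s'; case: (leP s 0) => s1; case: (leP t 0) => t1;
      rewrite ?subrr ?normr0 ?normr_ge0// ?subr0 ?sub0r ?normrN;
      rewrite (gtr0_norm s1) || rewrite (gtr0_norm t1).
      by apply: le_trans (ler_norm _); lra.
    by rewrite distrC; apply: le_trans (ler_norm _); lra.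
  have [k hk] := small (2 * (M / L * exp_weight t') + 2 * (M / L * exp_weight s')) e e0.
  have h3 : `|sval (picard_iter k) t' - sval (picard_iter k) s'| <= M * `|t - s|.
    case: k {hk} => [|k]; first by rewrite /= subrr normr0 mulr_ge0.
    by apply: le_trans (picard_step_lipT _ _ _) _; rewrite ler_wpM2l.
  have h1 := hl t' t0 k; have h2 := hl s' s0 k.
  have -> : l t' - l s' = (l t' - sval (picard_iter k) t') +
     ((sval (picard_iter k) t' - sval (picard_iter k) s') +
      - (l s' - sval (picard_iter k) s')).
    by rewrite opprB !addrA subrK subrK.
  apply: le_trans (ler_normD _ _) _.
  have := ler_normD (sval (picard_iter k) t' - sval (picard_iter k) s')
     (- (l s' - sval (picard_iter k) s')).
  by rewrite normrN; move: hk; rewrite mulrDl; lra.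
have cy : continuous y.
  move=> t; apply/cvgrPdist_le => e e0.
  have M1 : 0 < M + 1 by rewrite ltr_wpDl.
  have e1 : 0 < e / (M + 1) by rewrite divr_gt0.
  have /cvgrPdist_le /(_ _ e1) := @cvg_id _ (nbhs t).
  apply: filterS => s hs; apply: le_trans (ylip _ _) _.
  have -> : e = (M + 1) * (e / (M + 1)) by field; rewrite gt_eqF.
  by apply: ler_pM => //; rewrite lerDl.
pose Y : {y : R -> V | continuous y} := exist _ y cy.
have [z0 cz dz] := picard_stepP Y.
have yz (t : R) : 0 <= t -> sval (picard_step Y) t = y t.
  move=> t0; apply/eqP; rewrite -subr_eq0 -normr_le0.
  apply/ler_addgt0Pr => e e0; rewrite add0r.
  have [k hk] := small (3 * (M / L * exp_weight t)) e e0.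
  have h1 : `|sval (picard_step Y) t - sval (picard_iter k.+1) t| <=
      (2 * (M / L) * 2^-1 ^+ k) / 2 * exp_weight t.
    apply: picard_contract => //.
      by rewrite mulr_ge0 ?exprn_ge0 ?invr_ge0// mulr_ge0.
    move=> r r0; have -> : sval Y r = l r by rewrite /= /y (max_idPl r0).
    rewrite (_ : 2 * (M / L) * _ * _ = 2 * (M / L * exp_weight r) * 2^-1 ^+ k); last by ring.
    exact: hl.
  have h2 : `|y t - sval (picard_iter k.+1) t| <= 2 * (M / L * exp_weight t) * 2^-1 ^+ k.+1.
    by rewrite /y (max_idPl t0); exact: hl.
  have -> : sval (picard_step Y) t - y t = (sval (picard_step Y) t - sval (picard_iter k.+1) t)
     - (y t - sval (picard_iter k.+1) t).
    by rewrite opprB addrA subrK.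
  apply: le_trans (ler_normB _ _) _; apply: le_trans hk.
  apply: le_trans (lerD h1 h2) _; rewrite exprS.
  have : 0 <= M / L * exp_weight t * 2^-1 ^+ k by rewrite mulr_ge0// exprn_ge0// invr_ge0.
  lra.
exists (sval (picard_step Y)); split => //; first exact: z0.
by move=> t t0; rewrite yz ?ltW//; exact: dz.
Qed.

End Picard.

(** * Oscillating functions with bounded primitives *)

Section Oscillation.
Variables (R : realType) (N : nat).
Notation V := 'cV[R]_N.

Definition lip_on_balls (g : V -> R) := forall r, exists L, 0 <= L /\
  forall x y, `|x| <= r -> `|y| <= r -> `|g x - g y| <= L * `|x - y|.

(** What averaging needs of the state-dependent factors: a derivative along
    every curve, bounded on balls in terms of the speed.  Sums, products and
    coordinates have this property by the rules of one-variable calculus. *)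
Definition tame (g : V -> R) := lip_on_balls g /\
  forall r M, exists C, 0 <= C /\
  forall (x : R -> V) t v, `|x t| <= r -> `|v| <= M -> is_derive t 1 x v ->
  exists D, is_derive t 1 (g \o x) D /\ `|D| <= C.

Lemma lip_bounded g r : lip_on_balls g -> exists B, 0 <= B /\
  forall x, `|x| <= r -> `|g x| <= B.
Proof.
move=> /(_ r) [L [L0 hL]].
exists (`|g 0| + L * `|r|); split; first by rewrite addr_ge0// mulr_ge0.
move=> x xr; have r0 : 0 <= r by apply: le_trans xr.
have := hL x 0 xr; rewrite normr0 subr0 => /(_ r0) h.
rewrite -[g x](subrK (g 0)) addrC; apply: le_trans (ler_normD _ _) _.
rewrite lerD2l; apply: le_trans h _; rewrite ler_wpM2l//.
by apply: le_trans xr _; exact: ler_norm.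
Qed.

Lemma lip_cst c : lip_on_balls (fun=> c).
Proof. by move=> r; exists 0; split=> // x y _ _; rewrite subrr normr0 mul0r. Qed.

Lemma lip_add f g : lip_on_balls f -> lip_on_balls g ->
  lip_on_balls (fun x => f x + g x).
Proof.
move=> hf hg r; have [Lf [f0 hf']] := hf r; have [Lg [g0 hg']] := hg r.
exists (Lf + Lg); split; first exact: addr_ge0.
move=> x y xr yr; rewrite opprD addrACA mulrDl.
by apply: le_trans (ler_normD _ _) (lerD _ _); [exact: hf'|exact: hg'].
Qed.

Lemma lip_mul f g : lip_on_balls f -> lip_on_balls g ->
  lip_on_balls (fun x => f x * g x).
Proof.
move=> hf hg r; have [Lf [f0 hf']] := hf r; have [Lg [g0 hg']] := hg r.
have [Bf [bf0 hbf]] := lip_bounded r hf; have [Bg [bg0 hbg]] := lip_bounded r hg.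
exists (Bf * Lg + Bg * Lf); split; first by rewrite addr_ge0// mulr_ge0.
move=> x y xr yr.
have -> : f x * g x - f y * g y = f x * (g x - g y) + g y * (f x - f y) by ring.
apply: le_trans (ler_normD _ _) _; rewrite mulrDl !normrM -!mulrA.
by apply: lerD; apply: ler_pM => //; [exact: hbf|exact: hg'|exact: hbg|exact: hf'].
Qed.

Lemma lip_coord i : lip_on_balls (fun x => x i 0).
Proof.
move=> r; exists 1; split=> // x y _ _; rewrite mul1r.
by have := coord_le_norm (x - y) i 0; rewrite !mxE.
Qed.

Lemma lip_continuous g : lip_on_balls g -> forall x : R -> V, continuous x ->
  continuous (g \o x).
Proof.
move=> hg x cx t; apply/cvgrPdist_le => e e0.
have [L [L0 hL]] := hg (`|x t| + 1).
have L1 : 0 < L + 1 by rewrite ltr_wpDl.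
have d0 : 0 < Num.min 1 (e / (L + 1)) by rewrite lt_min ltr01 divr_gt0.
have /cvgrPdist_le /(_ _ d0) := cx t.
apply: filterS => s; rewrite le_min => /andP [h1 h2] /=.
apply: le_trans (hL _ _ _ _) _; first by rewrite lerDl.
  rewrite -(subrK (x t) (x s)) addrC; apply: le_trans (ler_normD _ _) _.
  by rewrite lerD2l distrC.
have -> : e = (L + 1) * (e / (L + 1)) by field; rewrite gt_eqF.
by apply: ler_pM => //; rewrite lerDl.
Qed.

Lemma tame_lip g : tame g -> lip_on_balls g. Proof. by case. Qed.

Lemma tame_cst c : tame (fun=> c).
Proof.
split; first exact: lip_cst.
move=> r M; exists 0; split=> // x t v _ _ _; exists 0.
by rewrite normr0; split=> //; exact: is_derive_cst.
Qed.

Lemma tame_add f g : tame f -> tame g -> tame (fun x => f x + g x).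
Proof.
move=> [lf df] [lg dg]; split; first exact: lip_add.
move=> r M; have [Cf [cf0 hf]] := df r M; have [Cg [cg0 hg]] := dg r M.
exists (Cf + Cg); split; first exact: addr_ge0.
move=> x t v xr vM dx.
have [Df [dDf hDf]] := hf x t v xr vM dx; have [Dg [dDg hDg]] := hg x t v xr vM dx.
exists (Df + Dg); split; last by apply: le_trans (ler_normD _ _) (lerD _ _).
exact: (is_deriveD dDf dDg).
Qed.

Lemma tame_mul f g : tame f -> tame g -> tame (fun x => f x * g x).
Proof.
move=> [lf df] [lg dg]; split; first exact: lip_mul.
move=> r M; have [Cf [cf0 hf]] := df r M; have [Cg [cg0 hg]] := dg r M.
have [Bf [bf0 hbf]] := lip_bounded r lf; have [Bg [bg0 hbg]] := lip_bounded r lg.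
exists (Bf * Cg + Bg * Cf); split; first by rewrite addr_ge0// mulr_ge0.
move=> x t v xr vM dx.
have [Df [dDf hDf]] := hf x t v xr vM dx; have [Dg [dDg hDg]] := hg x t v xr vM dx.
exists (f (x t) * Dg + g (x t) * Df); split; first exact: (is_deriveM dDf dDg).
apply: le_trans (ler_normD _ _) _; rewrite !normrM.
by apply: lerD; apply: ler_pM => //; [exact: hbf|exact: hbg].
Qed.

Lemma tame_coord i : tame (fun x => x i 0).
Proof.
split; first exact: lip_coord.
move=> r M; exists `|M|; split=> // x t v _ vM /is_derive_coord /(_ i 0) dx.
exists (v i 0); split=> //; apply: le_trans (coord_le_norm _ _ _) _.
by apply: le_trans vM _; exact: ler_norm.
Qed.

Lemma tame_sum (I : Type) (s : seq I) (g : I -> V -> R) :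
  (forall i, tame (g i)) -> tame (fun x => \sum_(i <- s) g i x).
Proof.
move=> hg; elim: s => [|i s IH].
  by rewrite (_ : (fun _ => _) = fun=> 0); [exact: tame_cst|apply/funext => x; rewrite big_nil].
rewrite (_ : (fun _ => _) = fun x => g i x + \sum_(i <- s) g i x).
  exact: tame_add.
by apply/funext => x; rewrite big_cons.
Qed.

Lemma lip_sum (I : Type) (s : seq I) (g : I -> V -> R) :
  (forall i, lip_on_balls (g i)) -> lip_on_balls (fun x => \sum_(i <- s) g i x).
Proof.
move=> hg; elim: s => [|i s IH].
  by rewrite (_ : (fun _ => _) = fun=> 0); [exact: lip_cst|apply/funext => x; rewrite big_nil].
rewrite (_ : (fun _ => _) = fun x => g i x + \sum_(i <- s) g i x).
  exact: lip_add.
by apply/funext => x; rewrite big_cons.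
Qed.

(** A bounded primitive is the quantitative form of having mean zero. *)
Definition zero_mean (phi : R -> R) := [/\ continuous phi,
  exists B, forall tau, `|phi tau| <= B &
  exists (Phi : R -> R) (B : R), forall tau : R, is_derive tau 1 Phi (phi tau) /\ `|Phi tau| <= B].

(** Keeping the time factor and the state factor separate allows the primitive
    to be taken in time only, at a frozen state. *)
Inductive oscillating : (R -> V -> R) -> Prop :=
| osc_term phi g : zero_mean phi -> tame g ->
    oscillating (fun tau x => phi tau * g x)
| osc_add e1 e2 : oscillating e1 -> oscillating e2 ->
    oscillating (fun tau x => e1 tau x + e2 tau x).

Lemma zero_mean0 : zero_mean (fun=> 0).
Proof.
split; first by move=> t; exact: cvg_cst.
  by exists 0 => t; rewrite normr0.
by exists (fun=> 0), 0 => t; rewrite normr0; split=> //; exact: is_derive_cst.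
Qed.

Lemma oscillating0 : oscillating (fun _ _ => 0).
Proof.
have := osc_term zero_mean0 (tame_cst 0).
by congr oscillating; apply/funext => t; apply/funext => x; rewrite mulr0.
Qed.

Lemma oscillating_sum (I : Type) (s : seq I) (e : I -> R -> V -> R) :
  (forall i, oscillating (e i)) ->
  oscillating (fun t x => \sum_(i <- s) e i t x).
Proof.
move=> he; elim: s => [|i s IH].
  have := oscillating0; congr oscillating.
  by apply/funext => t; apply/funext => x; rewrite big_nil.
have := osc_add (he i) IH; congr oscillating.
by apply/funext => t; apply/funext => x; rewrite big_cons.
Qed.

Lemma oscillating_mul g e : tame g -> oscillating e ->
  oscillating (fun t x => g x * e t x).
Proof.
move=> hg; elim=> [phi h hphi hh|e1 e2 _ h1 _ h2].
  have := osc_term hphi (tame_mul hg hh); congr oscillating.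
  by apply/funext => t; apply/funext => x; rewrite mulrCA.
have := osc_add h1 h2; congr oscillating.
by apply/funext => t; apply/funext => x; rewrite mulrDr.
Qed.

Lemma oscillating_continuous e x : oscillating e -> continuous (e^~ x).
Proof.
elim=> [phi h [cphi _ _] hh t|e1 e2 _ h1 _ h2 t].
  by apply: cvgM; [exact: cphi|exact: cvg_cst].
by apply: cvgD; [exact: h1|exact: h2].
Qed.

Lemma oscillating_lip e r : oscillating e -> exists L, 0 <= L /\
  forall t x y, `|x| <= r -> `|y| <= r -> `|e t x - e t y| <= L * `|x - y|.
Proof.
elim=> [phi g [_ [B hB] _] [lg _]|e1 e2 _ [L1 [L10 h1]] _ [L2 [L20 h2]]].
  have [L [L0 hL]] := lg r; have B0 : 0 <= B by apply: le_trans (hB 0).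
  exists (B * L); split; first exact: mulr_ge0.
  move=> t x y xr yr; rewrite -mulrBr normrM -mulrA; apply: ler_pM => //.
  exact: hL.
exists (L1 + L2); split; first exact: addr_ge0.
move=> t x y xr yr; rewrite opprD addrACA mulrDl.
by apply: le_trans (ler_normD _ _) (lerD _ _); [exact: h1|exact: h2].
Qed.

Lemma oscillating_bounded e r : oscillating e -> exists B, 0 <= B /\
  forall t x, `|x| <= r -> `|e t x| <= B.
Proof.
elim=> [phi g [_ [B hB] _] [lg _]|e1 e2 _ [L1 [L10 h1]] _ [L2 [L20 h2]]].
  have [L [L0 hL]] := lip_bounded r lg; have B0 : 0 <= B by apply: le_trans (hB 0).
  exists (B * L); split; first exact: mulr_ge0.
  move=> t x xr; rewrite normrM; apply: ler_pM => //.
  exact: hL.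
exists (L1 + L2); split; first exact: addr_ge0.
move=> t x xr.
by apply: le_trans (ler_normD _ _) (lerD _ _); [exact: h1|exact: h2].
Qed.

Lemma derive_continuous (f : R -> R) (t d : R) : is_derive t 1 f d ->
  {for t, continuous f}.
Proof.
by case=> df _; apply: differentiable_continuous; apply/derivable1_diffP.
Qed.

(** Integration by parts: for phi (w t) g (x t) take Phi (w t) g (x t) / w,
    where Phi is a bounded primitive of phi; the error is
    Phi (w t) (g o x)' (t) / w. *)
Lemma oscillating_primitive e r M : oscillating e -> exists C, 0 <= C /\
  forall w, 0 < w -> forall (x : R -> V) (T : R), continuous x ->
  (forall t, 0 <= t <= T -> `|x t| <= r) ->
  (forall t : R, 0 < t < T -> exists v, `|v| <= M /\ is_derive t 1 x v) ->
  exists U dU : R -> R, [/\ continuous U,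
    forall t, 0 <= t <= T -> `|U t| <= C / w &
    forall t : R, 0 < t < T -> is_derive t 1 U (dU t) /\
       `|dU t - e (w * t) (x t)| <= C / w].
Proof.
elim=> [phi g [_ _ [Phi [B hPhi]]] [lg dg]|e1 e2 _ [C1 [C10 h1]] _ [C2 [C20 h2]]].
  have [Bg [Bg0 hBg]] := lip_bounded r lg.
  have [C [C0 hC]] := dg r M.
  have B0 : 0 <= B by apply: le_trans (hPhi 0).2.
  exists (B * (Bg + C)); split; first by rewrite mulr_ge0// addr_ge0.
  move=> w w0 x T cx xr dx; have wi : 0 <= w^-1 by rewrite invr_ge0 ltW.
  exists (fun t => w^-1 * Phi (w * t) * g (x t)).
  exists (fun t => phi (w * t) * g (x t) +
      w^-1 * Phi (w * t) * 'D_1 (g \o x) t).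
  have dPhi (t : R) : is_derive t 1 (fun t => w^-1 * Phi (w * t)) (phi (w * t)).
    have h : is_derive t 1 (Phi \o (fun t => w * t)) (phi (w * t) * w).
      by apply: is_derive1_comp; [exact: (hPhi _).1|exact: is_derive_mull].
    have -> : phi (w * t) = w^-1 *: (phi (w * t) * w).
      by rewrite /GRing.scale /= mulrCA mulVf ?mulr1// gt_eqF.
    exact: is_deriveZ.
  split.
  - move=> t; apply: cvgM; last exact: (lip_continuous lg cx).
    exact: (derive_continuous (dPhi t)).
  - move=> t /xr /hBg hg; rewrite !normrM (ger0_norm wi) -mulrA mulrC.
    rewrite ler_wpM2r//; apply: ler_pM => //; first exact: (hPhi _).2.
    by apply: le_trans hg _; rewrite lerDl.
  - move=> t tT; have [v [vM dxv]] := dx t tT.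
    have tT' : 0 <= t <= T by case/andP: tT => /ltW -> /ltW ->.
    have [D [dD hD]] := hC x t v (xr t tT') vM dxv.
    have eD : 'D_1 (g \o x) t = D by case: dD.
    rewrite eD; split.
      have := is_deriveM (dPhi t) dD; congr is_derive.
      by rewrite /GRing.scale /= addrC; congr (_ + _); rewrite mulrC.
    rewrite [X in X - _]addrC addrK !normrM (ger0_norm wi) -mulrA mulrC ler_wpM2r//.
    apply: ler_pM => //; first exact: (hPhi _).2.
    by apply: le_trans hD _; rewrite lerDr.
exists (C1 + C2); split; first exact: addr_ge0.
move=> w w0 x T cx xr dx.
have [U1 [dU1 [c1 b1 d1]]] := h1 w w0 x T cx xr dx.
have [U2 [dU2 [c2 b2 d2]]] := h2 w w0 x T cx xr dx.
exists (U1 \+ U2), (dU1 \+ dU2); split.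
- by move=> t; apply: cvgD; [exact: c1|exact: c2].
- move=> t tT; rewrite mulrDl.
  by apply: le_trans (ler_normD _ _) (lerD _ _); [exact: b1|exact: b2].
- move=> t tT; have [d1' e1'] := d1 t tT; have [d2' e2'] := d2 t tT; split.
    exact: is_deriveD.
  rewrite /= opprD addrACA mulrDl.
  by apply: le_trans (ler_normD _ _) (lerD _ _).
Qed.

End Oscillation.

(** * The dot product *)

Section Dotv.
Variables (R : realType).
Implicit Types m n : nat.

Lemma dotvE n (u v : 'cV[R]_n) : dotv u v = \sum_i u i 0 * v i 0.
Proof. by rewrite /dotv mxE; apply: eq_bigr => i _; rewrite mxE. Qed.

Lemma dotvC n (u v : 'cV[R]_n) : dotv u v = dotv v u.
Proof. by rewrite !dotvE; apply: eq_bigr => i _; rewrite mulrC. Qed.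

Lemma dotvDl n (u v w : 'cV[R]_n) : dotv (u + v) w = dotv u w + dotv v w.
Proof. by rewrite /dotv linearD /= mulmxDl mxE. Qed.

Lemma dotvZl n a (u w : 'cV[R]_n) : dotv (a *: u) w = a * dotv u w.
Proof. by rewrite /dotv linearZ /= -scalemxAl mxE. Qed.

Lemma dotvNl n (u w : 'cV[R]_n) : dotv (- u) w = - dotv u w.
Proof. by rewrite -scaleN1r dotvZl mulN1r. Qed.

Lemma dotvDr n (u v w : 'cV[R]_n) : dotv w (u + v) = dotv w u + dotv w v.
Proof. by rewrite dotvC dotvDl !(dotvC w). Qed.

Lemma dotvZr n a (u w : 'cV[R]_n) : dotv w (a *: u) = a * dotv w u.
Proof. by rewrite dotvC dotvZl dotvC. Qed.

Lemma dotvNr n (u w : 'cV[R]_n) : dotv w (- u) = - dotv w u.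
Proof. by rewrite dotvC dotvNl dotvC. Qed.

Lemma dotv0l n (w : 'cV[R]_n) : dotv 0 w = 0.
Proof. by rewrite -(scale0r 0) dotvZl mul0r. Qed.

Lemma dotv0r n (w : 'cV[R]_n) : dotv w 0 = 0.
Proof. by rewrite dotvC dotv0l. Qed.

Lemma dotv_mulmx m n (A : 'M[R]_(m, n)) (u : 'cV[R]_m) (v : 'cV[R]_n) :
  dotv u (A *m v) = dotv (A^T *m u) v.
Proof. by rewrite /dotv trmx_mul trmxK mulmxA. Qed.

Lemma dotv_bound n (u v : 'cV[R]_n) : `|dotv u v| <= n%:R * (`|u| * `|v|).
Proof.
rewrite dotvE; apply: le_trans (ler_norm_sum _ _ _) _.
rewrite -[n in n%:R]card_ord -sum1_card natr_sum mulr_suml.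
apply: ler_sum => i _; rewrite mul1r normrM.
by apply: ler_pM => //; exact: coord_le_norm.
Qed.

Lemma mulmx_bound m n (A : 'M[R]_(m, n)) (v : 'cV[R]_n) :
  `|A *m v| <= n%:R * `|A| * `|v|.
Proof.
apply: norm_le_coord; first by rewrite !mulr_ge0.
move=> i j; rewrite mxE ord1; apply: le_trans (ler_norm_sum _ _ _) _.
rewrite -[n in n%:R]card_ord -sum1_card natr_sum !mulr_suml.
apply: ler_sum => l _; rewrite mul1r normrM.
by apply: ler_pM => //; exact: coord_le_norm.
Qed.

Lemma form_bound m n (A : 'M[R]_(m, n)) : exists C, 0 < C /\
  forall (u : 'cV[R]_m) (v : 'cV[R]_n), `|dotv u (A *m v)| <= C * (`|u| * `|v|).
Proof.
exists (m%:R * (n%:R * `|A|) + 1); split.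
  by rewrite ltr_wpDl// !mulr_ge0.
move=> u v; apply: le_trans (dotv_bound _ _) _.
rewrite mulrDl mul1r; apply: ler_wpDr; first exact: mulr_ge0.
rewrite -mulrA ler_wpM2l// [leRHS]mulrCA ler_wpM2l//; exact: mulmx_bound.
Qed.

Lemma is_derive_dotv n (u v : R -> 'cV[R]_n) (du dv : 'cV[R]_n) (t : R) :
  is_derive t 1 u du -> is_derive t 1 v dv ->
  is_derive t 1 (fun s => dotv (u s) (v s)) (dotv du (v t) + dotv (u t) dv).
Proof.
move=> /is_derive_coord hu /is_derive_coord hv.
have -> : (fun s => dotv (u s) (v s)) =
    \sum_(i < n) ((fun s => u s i 0) * (fun s => v s i 0)).
  by apply/funext => s; rewrite fct_sumE dotvE.
rewrite !dotvE -big_split /=; apply: is_derive_sum => i.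
have := is_deriveM (hu i 0) (hv i 0); congr is_derive.
by rewrite /GRing.scale /= addrC; congr (_ + _); rewrite mulrC.
Qed.

Lemma is_derive_mulmx m n (A : 'M[R]_(m, n)) (u : R -> 'cV[R]_n) du (t : R) :
  is_derive t 1 u du -> is_derive t 1 (fun s => A *m u s) (A *m du).
Proof.
move=> /is_derive_coord hu; apply/is_derive_coord => i j.
have -> : (fun s => (A *m u s) i j) = \sum_(l < n) (A i l *: (fun s => u s l j)).
  by apply/funext => s; rewrite fct_sumE mxE.
by rewrite mxE; apply: is_derive_sum => l; exact: is_deriveZ.
Qed.

Lemma dotv_ge_normsq n (u : 'cV[R]_n) : `|u| ^+ 2 <= dotv u u.
Proof.
have uu0 : 0 <= dotv u u by rewrite dotvE sumr_ge0// => i _; rewrite -expr2 sqr_ge0.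
rewrite -[leRHS]sqr_sqrtr// ler_sqr ?nnegrE ?sqrtr_ge0//.
apply: norm_le_coord; first exact: sqrtr_ge0.
move=> i j; rewrite ord1 -ler_sqr ?nnegrE ?sqrtr_ge0// sqr_sqrtr// dotvE.
rewrite (bigD1 i)//= -normrX ger0_norm ?sqr_ge0// expr2 lerDl sumr_ge0// => l _.
by rewrite -expr2 sqr_ge0.
Qed.
End Dotv.

(** * Practical stability by averaging *)

Section Trapping.
Variables (R : realType) (N : nat).
Notation V := 'cV[R]_N.

(** The infimum of the times at which phi is at least r; if phi were larger
    there, the intermediate value theorem would give an earlier time. *)
Lemma first_exit (phi : R -> R) r t1 : continuous phi -> phi 0 < r -> 0 <= t1 ->
  r <= phi t1 -> exists T, [/\ 0 < T, phi T = r & forall t, 0 <= t < T -> phi t < r].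
Proof.
move=> cphi phi0 t10 rt1.
pose S := [set t | 0 <= t /\ r <= phi t].
have S1 : S t1 by [].
have lbS : lbound S 0 by move=> t [].
have hS : has_inf S by split; [exists t1|exists 0].
have T0 : 0 <= inf S by apply: lb_le_inf; [exists t1|].
have before t : 0 <= t < inf S -> phi t < r.
  move=> /andP [t0 tT]; rewrite ltNge; apply/negP => rt.
  by move: tT; rewrite ltNge => /negP; apply; apply: ge_inf; [exists 0|split].
have ST : r <= phi (inf S).
  rewrite leNgt; apply/negP => hlt.
  have e0 : 0 < r - phi (inf S) by rewrite subr_gt0.
  have hn := cvgr_lt _ (cphi (inf S)) r hlt.
  have [d /= d0 hd] := (nbhs_normP (inf S) (fun t => phi t < r)).1 (hn _).
  have [s [s0 rs] sd] := inf_adherent d0 hS.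
  have : phi s < r.
    apply: hd; rewrite /ball_ /= distrC ger0_norm ?subr_ge0; last by apply: ge_inf; [exists 0|split].
    by rewrite ltrBlDl.
  by rewrite ltNge rs.
have Tpos : 0 < inf S.
  rewrite lt_neqAle T0 andbT; apply/eqP => e.
  by move: ST; rewrite -e leNgt phi0.
exists (inf S); split=> //; apply/eqP; rewrite eq_le ST andbT.
rewrite leNgt; apply/negP => hgt.
have [c] : exists2 c, c \in `[0, inf S]%R & phi c = r.
  apply: IVT => //; first exact: continuous_subspaceT.
  by rewrite minElt maxElt (lt_trans phi0 hgt) (ltW phi0) (ltW hgt).
rewrite in_itv /= => /andP [c0 cT] hc.
have : inf S <= c by apply: ge_inf; [exists 0|split; rewrite ?hc].
move=> Tc; have cE : c = inf S by apply/eqP; rewrite eq_le cT Tc.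
by move: hgt; rewrite -cE hc ltxx.
Qed.

(** exp (kap t) (W t - c) is nonincreasing. *)
Lemma gronwall_decay (W dW : R -> R) (kap c T : R) : 0 < kap -> 0 <= T ->
  continuous W -> (forall t : R, 0 < t < T -> is_derive t 1 W (dW t)) ->
  (forall t, 0 < t < T -> dW t <= - kap * (W t - c)) -> W T <= Num.max (W 0) c.
Proof.
move=> k0 T0 cW dWE dWle.
have dE (t : R) : is_derive t 1 (fun s => expR (kap * s)) (expR (kap * t) * kap).
  apply: (@is_derive1_comp _ expR (fun s => kap * s)).
  exact: is_derive_mull.
have : expR (kap * T) * (W T - c) <= expR (kap * 0) * (W 0 - c).
  apply: (@nonincreasing_of_derive _ (fun t => expR (kap * t) * (W t - c))
    (fun t => expR (kap * t) * (dW t + kap * (W t - c)))) => //.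
  - apply: continuous_subspaceT => t; apply: cvgM; first exact: (derive_continuous (dE t)).
    by apply: cvgB; [exact: cW|exact: cvg_cst].
  - move=> t tT; have h := dWE t tT; have hE := dE t.
    have h' : is_derive t 1 (fun s => W s - c) (dW t).
      by rewrite -[dW t]subr0; exact: is_deriveB.
    have := is_deriveM hE h'; congr is_derive.
    rewrite /GRing.scale /=; ring.
  - move=> t /dWle h; rewrite pmulr_rle0 ?expR_gt0//; move: h; lra.
rewrite mulr0 expR0 mul1r => h.
rewrite le_max; case: (leP (W T) c) => [_|cT]; first by rewrite orbT.
have E1 : 1 <= expR (kap * T).
  by apply: le_trans (expR_ge1Dx _); rewrite lerDl mulr_ge0// ltW.
have : 1 * (W T - c) <= expR (kap * T) * (W T - c).
  by rewrite ler_wpM2r// subr_ge0 ltW.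
by rewrite mul1r orbF; move: h; lra.
Qed.

(** Solutions are only required to be continuous on the closed half-line;
    freezing them at negative times reduces them to curves continuous on the
    whole line. *)
Lemma within_max0_continuous (x : R -> V) : {within `[0, +oo[, continuous x} ->
  continuous (fun t : R => x (Num.max t 0)).
Proof.
move=> /subspace_continuousP cx t.
have t0 : `[0, +oo[%classic (Num.max t 0).
  by rewrite /= in_itv /= andbT le_max lexx orbT.
apply/cvgrPdist_le => e e0.
have /cvgrPdist_le /(_ _ e0) h := cx _ t0.
have h2 : \forall s \near t, `[0, +oo[%classic (Num.max s 0) ->
    `|x (Num.max t 0) - x (Num.max s 0)| <= e by exact: (@continuous_max0 R t _ h).
apply: filterS h2 => s; apply.
by rewrite /= in_itv /= andbT le_max lexx orbT.
Qed.

Variables (f : R -> V -> V) (fav : V -> V) (xe : V) (P : 'M[R]_N) (r0 al mu : R).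
Hypothesis favL : forall i, lip_on_balls (fun x => fav x i 0).
Hypothesis fosc : forall i, oscillating (fun tau x => f tau x i 0 - fav x i 0).
Hypothesis Psym : P^T = P.
Hypotheses (al0 : 0 < al) (mu0 : 0 < mu) (r00 : 0 < r0).
Hypothesis Ppos : forall e, al * `|e| ^+ 2 <= dotv e (P *m e).
Hypothesis Pdec : forall e, `|e| <= r0 ->
  dotv e (P *m fav (xe + e)) <= - mu * `|e| ^+ 2.

Lemma field_split i : (fun tau x => f tau x i 0) =
  (fun tau x => fav x i 0 + (f tau x i 0 - fav x i 0)).
Proof. by apply/funext => t; apply/funext => x; rewrite addrC subrK. Qed.

Lemma field_bounded r : exists M, 0 <= M /\ forall tau x, `|x| <= r -> `|f tau x| <= M.
Proof.
have h i : exists M, 0 <= M /\ forall tau x, `|x| <= r -> `|f tau x i 0| <= M.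
  have [B1 [B10 h1]] := lip_bounded r (@favL i).
  have [B2 [B20 h2]] := oscillating_bounded r (@fosc i).
  exists (B1 + B2); split; first exact: addr_ge0.
  move=> tau x xr; have := congr1 (fun g => g tau x) (field_split i) => /= ->.
  by apply: le_trans (ler_normD _ _) (lerD _ _); [exact: h1|exact: h2].
have [M hM] := choice h.
have S0 : 0 <= \sum_i M i by apply: sumr_ge0 => i _; exact: (hM i).1.
exists (\sum_i M i); split=> // tau x xr.
apply: norm_le_coord => // i j; rewrite ord1.
apply: le_trans ((hM i).2 _ _ xr) _.
by rewrite (bigD1 i)//= lerDl sumr_ge0// => l _; exact: (hM l).1.
Qed.

Lemma field_lip r : exists L, 0 <= L /\ forall tau x y, `|x| <= r -> `|y| <= r ->
  `|f tau x - f tau y| <= L * `|x - y|.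
Proof.
have h i : exists L, 0 <= L /\ forall tau x y, `|x| <= r -> `|y| <= r ->
    `|f tau x i 0 - f tau y i 0| <= L * `|x - y|.
  have [B1 [B10 h1]] := @favL i r.
  have [B2 [B20 h2]] := oscillating_lip r (@fosc i).
  exists (B1 + B2); split; first exact: addr_ge0.
  move=> tau x y xr yr; have := congr1 (fun g => g tau) (field_split i) => /= E.
  rewrite (congr1 (fun g => g x) E) (congr1 (fun g => g y) E) /= opprD addrACA mulrDl.
  by apply: le_trans (ler_normD _ _) (lerD _ _); [exact: h1|exact: h2].
have [L hL] := choice h.
have S0 : 0 <= \sum_i L i by apply: sumr_ge0 => i _; exact: (hL i).1.
exists (\sum_i L i); split=> // tau x y xr yr.
apply: norm_le_coord => [|i j]; first exact: mulr_ge0.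
rewrite ord1 !mxE; apply: le_trans ((hL i).2 _ _ _ xr yr) _.
by rewrite ler_wpM2r// (bigD1 i)//= lerDl sumr_ge0// => l _; exact: (hL l).1.
Qed.

Lemma field_continuous x : continuous (f^~ x).
Proof.
apply/continuous_coord => i j; rewrite ord1.
have -> : (fun t => f t x i 0) = fun t => fav x i 0 + (f t x i 0 - fav x i 0).
  by apply/funext => t; rewrite addrC subrK.
move=> t; apply: cvgD; first exact: cvg_cst.
exact: (@oscillating_continuous _ _ _ x (@fosc i) t).
Qed.

Lemma lyap_tame i : tame (fun x => (P *m (x - xe)) i 0).
Proof.
have -> : (fun x : V => (P *m (x - xe)) i 0) =
    fun x => \sum_(l < N) P i l * (x l 0 + - xe l 0).
  by apply/funext => x; rewrite mxE; apply: eq_bigr => l _; rewrite !mxE.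
apply: tame_sum => l; apply: tame_mul; first exact: tame_cst.
by apply: tame_add; [exact: tame_coord|exact: tame_cst].
Qed.

Lemma lyap_oscillating : oscillating (fun tau x =>
  dotv (x - xe) (P *m (f tau x - fav x))).
Proof.
have -> : (fun tau x => dotv (x - xe) (P *m (f tau x - fav x))) =
    fun tau x => \sum_i (P *m (x - xe)) i 0 * (f tau x i 0 - fav x i 0).
  apply/funext => tau; apply/funext => x.
  by rewrite dotv_mulmx Psym dotvE; apply: eq_bigr => i _; rewrite !mxE.
by apply: oscillating_sum => i; apply: oscillating_mul; [exact: lyap_tame|exact: fosc].
Qed.

(** Along a trajectory the quadratic form E grows at rate at most
    - 2 mu |e|^2 plus an oscillating term.  With U the almost-primitive of that
    term from oscillating_primitive, W = E - 2 U satisfies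
    W' <= - kap (W - c) with c = O(1/w), so E stays of the order of its initial
    value plus O(1/w).  The equation is only assumed inside the ball of radius
    r, so that the lemma applies to the truncated field too. *)
Lemma trapped_near_equilibrium (r : R) : 0 < r -> r <= r0 -> exists rho ws : R,
  [/\ 0 < rho, rho <= r, 0 < ws & forall w, ws <= w -> forall x : R -> V,
    continuous x -> `|x 0 - xe| < rho ->
    (forall t : R, 0 < t -> `|x t - xe| <= r -> is_derive t 1 x (f (w * t) (x t))) ->
    forall t, 0 <= t -> `|x t - xe| < r].
Proof.
move=> rpos rr0.
have [be [be_al be_gt0 hbe]] : exists be, [/\ al < 2 * be, 0 < be &
    forall e, dotv e (P *m e) <= be * `|e| ^+ 2].
  have [be [be0 hbe]] := form_bound P; exists (be + al); split.
  - by move: be0 al0; lra.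
  - exact: addr_gt0.
  - move=> e; apply: le_trans (ler_norm _) _; apply: le_trans (hbe _ _) _.
    by rewrite -expr2 ler_wpM2r ?sqr_ge0// lerDl ltW.
have [M [M0 hM]] := field_bounded (`|xe| + r).
have [C [C0 hC]] := oscillating_primitive (`|xe| + r) M lyap_oscillating.
(* W' <= - kap W + O(1/w), as E <= be |e|^2. *)
pose kap := 2 * mu / be.
have kap0 : 0 < kap by rewrite divr_gt0 ?mulr_gt0.
pose Q := 2 * C + 2 * C / kap + 4 * C.
have Q0 : 0 <= Q by rewrite !addr_ge0 ?divr_ge0 ?mulr_ge0// ltW.
have eta0 : 0 < al * r ^+ 2 / 2 by rewrite divr_gt0 ?mulr_gt0 ?exprn_gt0.
have q0 : 0 < al / (2 * be) by rewrite divr_gt0 ?mulr_gt0.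
have q1 : al / (2 * be) < 1.
  by rewrite ltr_pdivrMr ?mulr_gt0// mul1r.
(* The initial value of E and the total of the O(1/w) terms, Q / w, are each
   at most half of al r^2, which bounds E from below at distance r. *)
exists (r * (al / (2 * be))), (Q / (al * r ^+ 2 / 2) + 1); split.
- by rewrite mulr_gt0.
- by rewrite ler_piMr// ltW.
- by rewrite ltr_wpDl// divr_ge0// ltW.
move=> w hw x cx x0 dx t t0; rewrite ltNge; apply/negP => rt.
have w0 : 0 < w by apply: lt_le_trans hw; rewrite ltr_wpDl// divr_ge0// ltW.
have Qw : Q / w < al * r ^+ 2 / 2.
  rewrite ltr_pdivrMr// mulrC -ltr_pdivrMr//.
  by apply: lt_le_trans hw; rewrite ltrDl.
have cphi : continuous (fun t => `|x t - xe|).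
  move=> s; apply: (@continuous_comp _ _ _ (fun s => x s - xe) Num.norm).
    by apply: cvgB; [exact: cx|exact: cvg_cst].
  exact: norm_continuous.
have x0r : `|x 0 - xe| < r by apply: lt_le_trans x0 _; rewrite ler_piMr// ltW.
have [T [T0 xT hT]] := first_exit cphi x0r t0 rt.
have inr s : 0 <= s <= T -> `|x s - xe| <= r.
  move=> /andP [s0 sT]; move: sT; rewrite le_eqVlt => /orP [/eqP ->|sT].
    by rewrite xT.
  by apply/ltW/hT; rewrite s0.
have inR s : 0 <= s <= T -> `|x s| <= `|xe| + r.
  move=> /inr h; rewrite -(subrK xe (x s)) addrC.
  by apply: le_trans (ler_normD _ _) _; rewrite lerD2l.
have dxT s : 0 < s < T -> is_derive s 1 x (f (w * s) (x s)).
  by move=> /andP [s0 sT]; apply: dx => //; apply: inr; rewrite !ltW.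
have dxM (s : R) : 0 < s < T -> exists v, `|v| <= M /\ is_derive s 1 x v.
  move=> sT; exists (f (w * s) (x s)); split; last exact: dxT.
  by apply/hM/inR; case/andP: sT => s0 sT; rewrite !ltW.
have [U [dU [cU bU hU]]] := hC w w0 x T cx inR dxM.
pose e t := x t - xe.
pose E t := dotv (e t) (P *m e t).
pose W t := E t - 2 * U t.
have cE : continuous E.
  have lE : lip_on_balls (fun y : V => \sum_i (y i 0 + - xe i 0) * (P *m (y - xe)) i 0).
    apply: lip_sum => i; apply: lip_mul; last exact: tame_lip (lyap_tame i).
    by apply: lip_add; [exact: lip_coord|exact: lip_cst].
  have -> : E = (fun y : V => \sum_i (y i 0 + - xe i 0) * (P *m (y - xe)) i 0) \o x.
    apply/funext => s; rewrite /E /= dotvE; apply: eq_bigr => i _.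
    by rewrite !mxE.
  exact: lip_continuous.
have cW : continuous W.
  move=> s; apply: cvgB; first exact: cE.
  by apply: cvgM; [exact: cvg_cst|exact: cU].
have dE s : 0 < s < T -> is_derive s 1 E (2 * dotv (e s) (P *m f (w * s) (x s))).
  move=> sT; have de : is_derive s 1 e (f (w * s) (x s)).
    by rewrite -[f _ _]subr0; have := dxT s sT => ?; exact: is_deriveB.
  have := is_derive_dotv de (is_derive_mulmx P de); congr is_derive.
  by rewrite mulr_natl mulr2n; congr (_ + _); rewrite dotv_mulmx Psym dotvC.
have dW s : 0 < s < T -> is_derive s 1 W
    (2 * dotv (e s) (P *m f (w * s) (x s)) - 2 * dU s).
  move=> sT; have h1 := dE s sT; have [h2 _] := hU s sT.
  apply: is_deriveB; exact: is_deriveZ.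
have Cw0 : 0 <= C / w by rewrite divr_ge0// ltW.
have WT : W T <= Num.max (W 0) ((2 * C + 2 * C / kap) / w).
  apply: (gronwall_decay kap0 (ltW T0) cW dW) => s sT.
  have sT' : 0 <= s <= T by case/andP: sT => s0 sT; rewrite !ltW.
  have [_] := hU s sT; have := bU s sT'.
  have -> : dotv (e s) (P *m f (w * s) (x s)) = dotv (e s) (P *m fav (x s)) +
      dotv (e s) (P *m (f (w * s) (x s) - fav (x s))).
    by rewrite -dotvDr -mulmxDr [_ + (_ - _)]addrC subrK.
  rewrite -/(e s).
  have : dotv (e s) (P *m fav (x s)) <= - mu * `|e s| ^+ 2.
    rewrite -[X in fav X](subrK xe) [X in fav X]addrC.
    by apply: Pdec; apply: le_trans (inr _ sT') rr0.
  rewrite /W; set A := dotv _ _; set B := dotv _ (P *m (_ - _)) => hA.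
  rewrite !ler_norml => /andP [u1 u2] /andP [v1 v2].
  have hEk : kap * E s <= 2 * mu * `|e s| ^+ 2.
    have -> : 2 * mu * `|e s| ^+ 2 = kap * (be * `|e s| ^+ 2).
      by rewrite /kap; field; rewrite gt_eqF.
    by rewrite ler_pM2l//; exact: hbe.
  have -> : - kap * (E s - 2 * U s - (2 * C + 2 * C / kap) / w) =
      - (kap * E s) + 2 * (kap * (U s + C / w)) + 2 * (C / w).
    by field; rewrite !gt_eqF.
  have : 0 <= kap * (U s + C / w) by apply: mulr_ge0; [exact: ltW|lra].
  lra.
have ET : al * r ^+ 2 <= E T by rewrite -xT; exact: Ppos.
have E0 : E 0 <= al * r ^+ 2 / 2.
  apply: le_trans (hbe _) _.
  have h : `|x 0 - xe| ^+ 2 <= r ^+ 2 * (al / (2 * be)).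
    apply: (@le_trans _ _ ((r * (al / (2 * be))) ^+ 2)).
      by rewrite ler_sqr ?nnegrE ?normr_ge0// ltW// mulr_gt0.
    by rewrite exprMn ler_wpM2l ?sqr_ge0// expr2 ler_piMr// ltW.
  apply: (@le_trans _ _ (be * (r ^+ 2 * (al / (2 * be))))).
    by rewrite ler_pM2l.
  by rewrite le_eqVlt; apply/orP; left; apply/eqP; field; rewrite gt_eqF.
have UT : `|U T| <= C / w by apply: bU; rewrite lexx ltW.
have U0 : `|U 0| <= C / w by apply: bU; rewrite lexx ltW.
move: UT U0 Qw; rewrite !ler_norml /Q => /andP [? ?] /andP [? ?].
have -> : (2 * C + 2 * C / kap + 4 * C) / w =
  2 * (C / w) + 2 * C / kap / w + 4 * (C / w) by field; rewrite !gt_eqF.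
have ck : 0 <= 2 * C / kap / w by rewrite !divr_ge0 ?mulr_ge0// ltW.
move: WT; rewrite le_max /W => /orP [|]; first by lra.
have -> : (2 * C + 2 * C / kap) / w = 2 * (C / w) + 2 * C / kap / w.
  by field; rewrite !gt_eqF.
lra.
Qed.

(** Truncating coordinatewise is a retraction on a ball of the max norm that
    does not increase distances; composing with it makes a field bounded and
    globally Lipschitz without changing it in the ball. *)
Definition clamp (r : R) (x : V) : V :=
  \col_i Num.max (xe i 0 - r) (Num.min (xe i 0 + r) (x i 0)).

Lemma clamp_id r x : `|x - xe| <= r -> clamp r x = x.
Proof.
move=> h; apply/matrixP => i j; rewrite ord1 mxE.
have := le_trans (coord_le_norm (x - xe) i 0) h; rewrite !mxE ler_norml => /andP [? ?].
by rewrite (min_idPr _) ?(max_idPr _)//; lra.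
Qed.

Lemma clamp_in r x : 0 <= r -> `|clamp r x - xe| <= r.
Proof.
move=> r1; apply: norm_le_coord => // i j; rewrite ord1 !mxE.
rewrite ler_distl; apply/andP; split; first by rewrite le_max lexx.
by rewrite ge_max ge_min lexx /= andbT; lra.
Qed.

Lemma max_lip (a u v : R) : `|Num.max a u - Num.max a v| <= `|u - v|.
Proof.
by case: (leP a u) => ?; case: (leP a v) => ?; rewrite ?subrr// ?normr_ge0//;
  rewrite ler_norml; apply/andP; split; have := ler_norm (u - v);
  have := ler_norm (v - u); rewrite (distrC v u); lra.
Qed.

Lemma min_lip (a u v : R) : `|Num.min a u - Num.min a v| <= `|u - v|.
Proof.
by case: (leP a u) => ?; case: (leP a v) => ?; rewrite ?subrr// ?normr_ge0//;
  rewrite ler_norml; apply/andP; split; have := ler_norm (u - v);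
  have := ler_norm (v - u); rewrite (distrC v u); lra.
Qed.

Lemma clamp_lip r x y : 0 <= r -> `|clamp r x - clamp r y| <= `|x - y|.
Proof.
move=> r1; apply: norm_le_coord => // i j; rewrite ord1 !mxE.
apply: le_trans (max_lip _ _ _) _; apply: le_trans (min_lip _ _ _) _.
by have := coord_le_norm (x - y) i 0; rewrite !mxE.
Qed.

Lemma clamp_bounded r x : 0 <= r -> `|clamp r x| <= `|xe| + r.
Proof.
move=> r1; rewrite -(subrK xe (clamp r x)) addrC.
by apply: le_trans (ler_normD _ _) _; rewrite lerD2l clamp_in.
Qed.

(** For existence, the truncated field has a global solution; trapped in the
    ball, it never meets the truncation. *)
Theorem practical_stability (eps : R) : 0 < eps -> exists rho ws : R,
  [/\ 0 < rho, 0 < ws & forall w, ws <= w -> forall x0, `|x0 - xe| < rho ->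
  (exists x : R -> V, [/\ x 0 = x0, continuous x &
    forall t : R, 0 < t -> is_derive t 1 x (f (w * t) (x t))]) /\
  forall x : R -> V, x 0 = x0 -> {within `[0, +oo[, continuous x} ->
    (forall t : R, 0 < t -> is_derive t 1 x (f (w * t) (x t))) ->
    forall t, 0 <= t -> `|x t - xe| < eps].
Proof.
move=> eps0; pose r := Num.min eps r0.
have r_gt0 : 0 < r by rewrite lt_min eps0.
have r_le : r <= r0 by rewrite ge_min lexx orbT.
have [rho [ws [rho0 rho_r ws0 trap]]] := trapped_near_equilibrium r_gt0 r_le.
exists rho, ws; split=> // w hw x0 hx0; split.
  have [L [L0 hL]] := field_lip (`|xe| + r).
  have [M [M0 hM]] := field_bounded (`|xe| + r).
  have cr z : `|clamp r z| <= `|xe| + r by apply: clamp_bounded; exact: ltW.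
  have [x [xx0 cx dx]] : exists x : R -> V, [/\ x 0 = x0, continuous x &
      forall t : R, 0 < t -> is_derive t 1 x (f (w * t) (clamp r (x t)))].
    have L1 : 0 < L + 1 by rewrite ltr_wpDl.
    apply: (@picard _ _ (fun t z => f (w * t) (clamp r z)) _ _ L1 M0).
    - move=> z t.
      apply: (@continuous_comp _ _ _ (fun t => w * t) (fun s => f s (clamp r z))).
        by apply: cvgM; [exact: cvg_cst|exact: cvg_id].
      exact: field_continuous.
    - move=> t y z; apply: le_trans (hL _ _ _ (cr y) (cr z)) _.
      by apply: ler_pM => //; [rewrite lerDl|apply: clamp_lip; exact: ltW].
    - by move=> t z; apply: hM; exact: cr.
  have inr : forall t, 0 <= t -> `|x t - xe| < r.
    apply: (trap w hw x cx); first by rewrite xx0.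
    by move=> t t0 /clamp_id xt; have := dx t t0; rewrite xt.
  exists x; split=> // t t0; have := dx t t0.
  by rewrite clamp_id// ltW// inr// ltW.
move=> x xx0 cx dx t t0.
pose y t := x (Num.max t 0).
have yx s : 0 <= s -> y s = x s by move=> s0; rewrite /y (max_idPl s0).
rewrite -yx//; apply: lt_le_trans (_ : r <= eps); last by rewrite ge_min lexx.
apply: (trap w hw y _ _ _ t t0).
- move=> s; apply: within_max0_continuous; exact: cx.
- by rewrite yx// xx0.
- move=> s s0 _; rewrite yx ?ltW//.
  have pos : \forall u \near s, 0 <= u.
    apply: (filterS _ (cvgr_gt s (@cvg_id _ (nbhs s)) 0 s0)).
    by move=> u /= /ltW.
  apply: near_eq_is_derive (dx s s0).
  by near=> u; rewrite yx//; near: u; exact: pos.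
Unshelve. all: by end_near. Qed.

End Trapping.

(** * Quadratic forms and the smoothed maximum *)

Section Coercivity.
Variable R : realType.

(** The minimum of the form over the compact unit sphere. *)
Lemma posdef_coercive n (H : 'M[R]_n) : posdef H -> exists al, 0 < al /\
  forall v, al * `|v| ^+ 2 <= dotv v (H *m v).
Proof.
move=> Hpos; have [[v0 v0N0]|allz] := pselect (exists v : 'cV[R]_n, v != 0); last first.
  exists 1; split=> // v; have [->|vN0] := eqVneq v 0; last by case: allz; exists v.
  by rewrite normr0 expr0n mulr0 dotv0l.
pose f (u : 'rV[R]_n) := dotv u^T (H *m u^T).
pose S := [set u : 'rV[R]_n | `|u| = 1].
have trn (u : 'cV[R]_n) : `|u^T| = `|u|.
  apply/eqP; rewrite eq_le; apply/andP; split; apply: norm_le_coord => // i j.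
    by rewrite mxE; exact: coord_le_norm.
  by have := coord_le_norm u^T j i; rewrite mxE.
have cf : continuous f.
  have -> : f = fun u : 'rV[R]_n => \sum_(i < n) (u 0 i * \sum_(j < n) (H i j * u 0 j)).
    apply/funext => u; rewrite /f dotvE; apply: eq_bigr => i _; rewrite !mxE.
    by congr (_ * _); apply: eq_bigr => j _; rewrite mxE.
  have cs i : continuous (fun u : 'rV[R]_n => \sum_(j < n) (H i j * u 0 j)).
    move=> u; apply: (@cvg_big R _ +%R 0 xpredT (@add_continuous R) _ (nbhs u)) => j _.
    by apply: cvgM; [exact: cvg_cst|exact: coord_continuous].
  move=> u; apply: (@cvg_big R _ +%R 0 xpredT (@add_continuous R) _ (nbhs u)) => i _.
  apply: cvgM.
    exact: coord_continuous.
  exact: cs.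
have [c cS cmin] : exists2 c, c \in S & forall t, t \in S -> f c <= f t.
  apply: EVT_min_rV.
  - exists (`|v0|^-1 *: v0^T); rewrite /S /= normrZ trn normrV ?normr_id ?mulVf ?normr_eq0//.
    by rewrite unitfE normr_eq0.
  - apply: bounded_closed_compact.
      exists 1; split; first exact: real1.
      by move=> M M1 u /= ->; exact: ltW.
    have -> : S = Num.norm @^-1` [set 1] by apply/seteqP; split.
    apply: closed_comp; first by move=> u _; exact: norm_continuous.
    exact: closed_eq.
  - exact: continuous_subspaceT.
have c1 : `|c| = 1 by move: cS; rewrite inE.
exists (f c); split.
  apply: Hpos; apply/eqP => cT0; have := trn c^T; rewrite trmxK c1 cT0 normr0.
  by move=> /eqP; rewrite oner_eq0.
move=> v; have [->|vN0] := eqVneq v 0; first by rewrite normr0 expr0n mulr0 dotv0l.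
have vn : `|v| != 0 by rewrite normr_eq0.
have : f c <= f (`|v|^-1 *: v^T).
  apply: cmin; rewrite inE /S /= normrZ trn normrV ?unitfE// normr_id mulVf//.
rewrite /f linearZ /= trmxK -scalemxAr dotvZl dotvZr => h.
have -> : dotv v (H *m v) = `|v|^-1 * (`|v|^-1 * dotv v (H *m v)) * `|v| ^+ 2.
  by field.
by rewrite ler_wpM2r// sqr_ge0.
Qed.

Lemma posdef_unit n (H : 'M[R]_n) : posdef H -> H \in unitmx.
Proof.
move=> Hpos; rewrite -unitmx_tr -row_free_unit -kermx_eq0; apply/eqP/row_matrixP => i.
rewrite row0; apply/eqP/negPn/negP => rN0.
have : (row i (kermx H^T))^T != 0 by rewrite -(inj_eq trmx_inj) trmxK trmx0.
move=> /Hpos; rewrite -[H in H *m _]trmxK -trmx_mul -row_mul mulmx_ker row0 trmx0 dotv0r.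
by rewrite ltxx.
Qed.

Lemma form_matrix N (B : 'cV[R]_N -> 'cV[R]_N -> R) :
  (forall x a y z, B x (a *: y + z) = a * B x y + B x z) ->
  (forall x y, B x y = B y x) ->
  exists P : 'M[R]_N, P^T = P /\ forall x y, dotv x (P *m y) = B x y.
Proof.
move=> Blin Bsym.
have B0 x : B x 0 = 0.
  by have := Blin x 1 0 0; rewrite scaler0 addr0 mul1r => /eqP; rewrite addrC -subr_eq subrr eq_sym => /eqP.
have Bsum x (y : 'cV[R]_N) : B x y = \sum_j y j 0 * B x (delta_mx j 0).
  rewrite {1}(matrix_sum_delta y).
  have E : forall s : seq 'I_N, B x (\sum_(i <- s) \sum_(j < 1) y i j *: delta_mx i j) =
    \sum_(i <- s) y i 0 * B x (delta_mx i 0).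
    elim=> [|i s IH]; first by rewrite !big_nil.
    by rewrite !big_cons big_ord1 Blin IH.
  exact: E.
exists (\matrix_(i, j) B (delta_mx i 0) (delta_mx j 0)); split.
  by apply/matrixP => i j; rewrite !mxE.
move=> x y; rewrite Bsym Bsum dotvE; apply: eq_bigr => i _; congr (_ * _).
by rewrite mxE Bsym Bsum; apply: eq_bigr => j _; rewrite mxE mulrC.
Qed.

(** With s x = sqrt (x^2 + delta), the remainder is
    (s x s x0 - (x x0 + delta)) / (2 s x0), and
    (s x s x0)^2 - (x x0 + delta)^2 = delta (x - x0)^2 bounds its numerator by
    (x - x0)^2.  The slope (1 + x0 / s x0) / 2 lies strictly between 0
    and 1, which is what makes the linearized loop stable. *)
Lemma maxd_taylor (delta x0 : R) : 0 < delta -> exists p C, [/\ 0 < p, p < 1, 0 <= C &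
  forall x, `|maxd delta x - maxd delta x0 - p * (x - x0)| <= C * (x - x0) ^+ 2].
Proof.
move=> d0; pose s x := Num.sqrt (x ^+ 2 + delta).
have s2 x : s x ^+ 2 = x ^+ 2 + delta by rewrite sqr_sqrtr// addr_ge0 ?sqr_ge0 ?ltW.
have spos x : 0 < s x by rewrite sqrtr_gt0 ltr_wpDl ?sqr_ge0.
have sx x : `|x| < s x.
  rewrite -ltr_sqr ?nnegrE ?normr_ge0 ?(ltW (spos _))// s2 -normrX ger0_norm ?sqr_ge0//.
  by rewrite ltrDl.
have := sx x0; rewrite ltr_norml => /andP [h1 h2].
have S0 := spos x0.
exists (2^-1 * (1 + x0 / s x0)), (2^-1 / s x0); split.
- rewrite mulr_gt0// -(@ltr_pM2r _ (s x0))// mul0r mulrDl mul1r divfK ?gt_eqF//.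
  by lra.
- rewrite -(@ltr_pM2r _ (s x0))// mul1r -mulrA mulrDl mul1r divfK ?gt_eqF//.
  by lra.
- by rewrite divr_ge0// ltW.
move=> x; rewrite /maxd -/(s x) -/(s x0).
have Sx := spos x.
have -> : 2^-1 * (x + s x) - 2^-1 * (x0 + s x0) - 2^-1 * (1 + x0 / s x0) * (x - x0) =
   2^-1 / s x0 * (s x * s x0 - (x * x0 + delta)).
  have : delta = s x0 ^+ 2 - x0 ^+ 2 by have := s2 x0; lra.
  by move=> ->; field; rewrite gt_eqF.
rewrite normrM (ger0_norm (_ : 0 <= 2^-1 / s x0)); last by rewrite divr_ge0// ltW.
apply: ler_wpM2l; first by rewrite divr_ge0// ltW.
have D0 : 0 < s x * s x0 + (x * x0 + delta).
  have : `|x * x0| < s x * s x0 by rewrite normrM; apply: ltr_pM => //; exact: sx.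
  by rewrite ltr_norml => /andP [? _]; lra.
have E : (s x * s x0 - (x * x0 + delta)) * (s x * s x0 + (x * x0 + delta)) =
   delta * (x - x0) ^+ 2.
  have -> : (s x * s x0 - (x * x0 + delta)) * (s x * s x0 + (x * x0 + delta)) =
    s x ^+ 2 * s x0 ^+ 2 - (x * x0 + delta) ^+ 2 by ring.
  by rewrite !s2; ring.
have F0 : 0 <= s x * s x0 - (x * x0 + delta).
  by rewrite -(pmulr_lge0 _ D0) E mulr_ge0 ?sqr_ge0 ?ltW.
rewrite ger0_norm// -(ler_pM2r D0) E mulrC ler_wpM2l ?sqr_ge0//.
have h : x * x0 <= s x * s x0.
  by apply: le_trans (ler_norm _) _; rewrite normrM; apply: ler_pM => //; exact/ltW/sx.
have h' : - (s x * s x0) <= x * x0.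
  by rewrite lerNl; apply: le_trans (ler_norm _) _; rewrite normrN normrM; apply: ler_pM => //; exact/ltW/sx.
lra.
Qed.

(** Complete the square. *)
Lemma young (u v a b c : R) : 0 < a -> c ^+ 2 <= 4 * a * b ->
  c * u * v <= a * u ^+ 2 + b * v ^+ 2.
Proof.
move=> a0 h; rewrite -subr_ge0 -(pmulr_rge0 _ (_ : 0 < 4 * a)) ?mulr_gt0//.
have -> : 4 * a * (a * u ^+ 2 + b * v ^+ 2 - c * u * v) =
  (2 * a * u - c * v) ^+ 2 + (4 * a * b - c ^+ 2) * v ^+ 2 by ring.
by rewrite addr_ge0 ?sqr_ge0// mulr_ge0 ?sqr_ge0// subr_ge0.
Qed.
End Coercivity.

(** * Weights for a cascade of quadratic terms *)

Section LyapunovScalars.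
Variable R : realType.

Lemma exists_large (y z : R) : 0 < y -> exists x, 0 < x /\ z <= x * y.
Proof.
move=> y0; exists (`|z| / y + 1); split; first by rewrite ltr_wpDl// divr_ge0// ltW.
rewrite mulrDl divfK ?gt_eqF// mul1r; apply: le_trans (ler_norm z) _.
by rewrite lerDl ltW.
Qed.

Lemma exists_small (y z : R) : 0 <= y -> 0 < z -> exists x, 0 < x /\
  forall x', 0 < x' -> x' <= x -> x' * y <= z.
Proof.
move=> y0 z0; exists (z / (y + 1)); split; first by rewrite divr_gt0// ltr_wpDl.
move=> x' x'0 h; apply: (@le_trans _ _ (z / (y + 1) * (y + 1))); last first.
  by rewrite divfK// gt_eqF// ltr_wpDl.
by apply: ler_pM => //; [exact: ltW|rewrite lerDl].
Qed.

(** Here a, U, z1, z2, z3, s, g stand for the norms of the errors in theta, in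
    its derivative, in the three filters of the cost and of the constraint, in
    gamma and in the estimate of h1.  Each weight is chosen after those that it
    has to dominate or be dominated by: ep small for the cross term between a
    and U, ep2 small against ep because the filters are driven by a, then L1
    and L2 large because s and g drive a and U, and g drives s.  The
    bound on the cross term makes the form positive definite. *)
Lemma lyap_weights (wf m m2 C : R) : 0 < wf -> 0 < m -> 0 < m2 -> 0 < C ->
  exists ep ep2 L1 L2 mu, [/\ 0 < ep, 0 < ep2, 0 < L1, 0 < L2 & 0 < mu] /\
  [/\ ep <= wf / 2, ep <= 1,
   forall a U, 2 * ep * C * a * U <= 2^-1 * U ^+ 2 + m2 / 2 * a ^+ 2 &
   forall a U z1 z2 z3 s g,
   - (wf / 2) * U ^+ 2 - ep * m * a ^+ 2 + ep * C * a * U + C * (a + U) * (g + s)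
   + ep2 * ((- wf * z1 ^+ 2 + C * a * z1) + (- wf * z2 ^+ 2 + C * a * z2)
            + (- wf * z3 ^+ 2 + C * a * z3))
   + L1 * (- wf * s ^+ 2 + C * s * g) - L2 * wf * g ^+ 2
   <= - mu * (a ^+ 2 + z1 ^+ 2 + z2 ^+ 2 + z3 ^+ 2 + s ^+ 2 + g ^+ 2)].
Proof.
move=> wf0 m0 m20 C0; have C20 : 0 < C ^+ 2 by rewrite exprn_gt0.
have [e1 [e10 he1]] := @exists_small (C ^+ 2) (wf * m / 4) (ltW C20) ltac:(by rewrite divr_gt0// mulr_gt0).
have [e2 [e20 he2]] := @exists_small (C ^+ 2) (m2 / 4) (ltW C20) ltac:(by rewrite divr_gt0).
(* The bounds on ep C^2 serve the two uses of the cross term. *)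
have [ep [ep0 [ep_wf [ep1 [epC epm2]]]]] : exists ep, 0 < ep /\ ep <= wf / 2 /\ ep <= 1 /\
    ep * C ^+ 2 <= wf * m / 4 /\ ep * C ^+ 2 <= m2 / 4.
  exists (Num.min (Num.min (wf / 2) 1) (Num.min e1 e2)).
  have p0 : 0 < Num.min (Num.min (wf / 2) 1) (Num.min e1 e2).
    by rewrite !lt_min e10 e20 ltr01 divr_gt0.
  split=> //; split; first by rewrite !ge_min lexx.
  split; first by rewrite !ge_min lexx orbT.
  split; [apply: he1 => //|apply: he2 => //]; by rewrite !ge_min lexx !orbT.
have em0 : 0 < ep * m by rewrite mulr_gt0.
have [e3 [e30 he3]] := @exists_small (C ^+ 2) (wf * (ep * m) / 6) (ltW C20) ltac:(by rewrite divr_gt0// mulr_gt0).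
have {}he3 := he3 e3 e30 (lexx _).
have [K1 [K10 hK1]] := @exists_large (ep * m / 2) (C ^+ 2) ltac:(by rewrite divr_gt0).
have [K2 [K20 hK2]] := @exists_large (wf / 4) (C ^+ 2) ltac:(by rewrite divr_gt0).
have [L1 [L10 hL1]] := @exists_large (wf / 2) ((K1 + K2) + 1) ltac:(by rewrite divr_gt0).
have [M [M0 hM]] := @exists_large (2 * wf) (C ^+ 2) ltac:(by rewrite mulr_gt0).
have [L2 [L20 hL2]] := @exists_large wf ((K1 + K2) + L1 * M + 1) wf0.
pose mu := Num.min (Num.min (ep * m / 4) (e3 * wf / 2)) 1.
have mu0 : 0 < mu by rewrite !lt_min ltr01 !divr_gt0 ?mulr_gt0.
have mu1 : mu <= ep * m / 4 by rewrite !ge_min lexx.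
have mu2 : mu <= e3 * wf / 2 by rewrite !ge_min lexx orbT.
have mu3 : mu <= 1 by rewrite !ge_min lexx orbT.
exists ep, e3, L1, L2, mu; split=> //; split=> //.
  move=> a U; have : 2 * ep * C * U * a <= 2^-1 * U ^+ 2 + m2 / 2 * a ^+ 2.
    apply: young; first by rewrite invr_gt0.
    have -> : (2 * ep * C) ^+ 2 = 4 * ep * (ep * C ^+ 2) by ring.
    have : ep * (ep * C ^+ 2) <= 1 * (m2 / 4).
      by apply: ler_pM => //; [exact: ltW|rewrite mulr_ge0// ltW].
    lra.
  lra.
move=> a U z1 z2 z3 s g.
have y1 : (ep * C) * U * a <= wf / 4 * U ^+ 2 + (ep * m / 4) * a ^+ 2.
  apply: young; first by rewrite divr_gt0.
  have -> : (ep * C) ^+ 2 = ep * (ep * C ^+ 2) by ring.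
  have : ep * (ep * C ^+ 2) <= ep * (wf * m / 4) by rewrite ler_pM2l.
  lra.
have y2 z : (e3 * C) * z * a <= e3 * wf / 2 * z ^+ 2 + (ep * m / 12) * a ^+ 2.
  apply: young; first by rewrite divr_gt0 ?mulr_gt0.
  have -> : (e3 * C) ^+ 2 = e3 * (e3 * C ^+ 2) by ring.
  have : e3 * (e3 * C ^+ 2) <= e3 * (wf * (ep * m) / 6) by rewrite ler_pM2l.
  lra.
have y3 z : C * a * z <= ep * m / 8 * a ^+ 2 + K1 * z ^+ 2.
  by apply: young; [rewrite divr_gt0|move: hK1; lra].
have y4 z : C * U * z <= wf / 16 * U ^+ 2 + K2 * z ^+ 2.
  by apply: young; [rewrite divr_gt0|move: hK2; lra].
have y5 : (L1 * C) * s * g <= L1 * wf / 2 * s ^+ 2 + L1 * M * g ^+ 2.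
  apply: young; first by rewrite divr_gt0 ?mulr_gt0.
  have : L1 ^+ 2 * C ^+ 2 <= L1 ^+ 2 * (M * (2 * wf)) by rewrite ler_pM2l ?exprn_gt0.
  have -> : (L1 * C) ^+ 2 = L1 ^+ 2 * C ^+ 2 by ring.
  have -> : 4 * (L1 * wf / 2) * (L1 * M) = L1 ^+ 2 * (M * (2 * wf)) by field.
  by [].
have b1 : mu * a ^+ 2 <= ep * m / 4 * a ^+ 2 by rewrite ler_wpM2r ?sqr_ge0.
have b2 z : mu * z ^+ 2 <= e3 * wf / 2 * z ^+ 2 by rewrite ler_wpM2r ?sqr_ge0.
have b3 z : mu * z ^+ 2 <= z ^+ 2 by rewrite -[leRHS]mul1r ler_wpM2r ?sqr_ge0.
have b4 : ((K1 + K2) + 1) * s ^+ 2 <= L1 * (wf / 2) * s ^+ 2 by rewrite ler_wpM2r ?sqr_ge0.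
have b5 : ((K1 + K2) + L1 * M + 1) * g ^+ 2 <= L2 * wf * g ^+ 2 by rewrite ler_wpM2r ?sqr_ge0.
have b6 : 0 <= wf * U ^+ 2 by rewrite mulr_ge0 ?sqr_ge0// ltW.
have := y2 z1; have := y2 z2; have := y2 z3; have := y3 s; have := y3 g.
have := y4 s; have := y4 g; have := b2 z1; have := b2 z2; have := b2 z3.
have := b3 s; have := b3 g; move: y1 y5 b1 b4 b5 b6.
clear; lra.
Qed.
End LyapunovScalars.

(** * A Lyapunov form for the averaged error dynamics *)

Section LyapunovForm.
Variables (R : realType) (n : nat) (H : 'M[R]_n) (h1 : 'cV[R]_n).
Variables (k c wf p ge : R).

(** Here p is the slope of the smoothed maximum at the equilibrium and ge the
    equilibrium value of gamma, so that ge times the square of h1 is a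
    projector P; the inverse of I - p P is I + kap P. *)
Definition kap := p / (1 - p).

(** The bilinear form of the inverse of I - p P. *)
Definition form_u (u v : 'cV[R]_n) :=
  dotv u v + kap * ge * (dotv h1 u * dotv h1 v).

(** The bilinear form of N = k H + c kap P. *)
Definition form_th (u v : 'cV[R]_n) :=
  k * dotv u (H *m v) + c * kap * ge * (dotv h1 u * dotv h1 v).

(** The linearized derivative of theta, as a function of the errors of the
    filtered gradient of the cost and of the filtered constraint. *)
Definition drift (G : 'cV[R]_n) (eta : R) : 'cV[R]_n :=
  - (k *: G) + (ge * p * (k * dotv h1 G - c * eta)) *: h1.

Definition lyap_form (ep ep2 L1 L2 : R) (x y : state R n) : R :=
  let: State th G J g eta gam := x in
  let: State th' G' J' g' eta' gam' := y in
  let u := drift G eta in let u' := drift G' eta' in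
  form_u u u' + wf * form_th th th' + ep * (form_u th u' + form_u th' u)
  + ep2 * (dotv G G' + eta * eta' + J * J') + L1 * (gam * gam') + L2 * dotv g g'.

Definition sq_sum (e : state R n) : R :=
  let: State th G J g eta gam := e in
  `|th| ^+ 2 + `|G| ^+ 2 + eta ^+ 2 + J ^+ 2 + gam ^+ 2 + `|g| ^+ 2.

Hypothesis Hsym : H^T = H.
Hypotheses (k0 : 0 < k) (c0 : 0 < c) (wf0 : 0 < wf) (p0 : 0 < p) (p1 : p < 1).
Hypotheses (ge0 : 0 < ge) (geb : ge * dotv h1 h1 = 1).

(** When the filters have settled, the drift is - (I - p P) N th, because
    (I - p P) (k H + c kap P) = k (I - p P) H + p c P.  Applying the inverse of
    I - p P leaves the symmetric matrix N. *)
Lemma drift_filter v th : form_u v (drift (H *m th) (dotv h1 th)) = - form_th v th.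
Proof.
have gN0 : ge != 0 by rewrite gt_eqF.
have gb : dotv h1 h1 = ge^-1 by rewrite -[LHS]mul1r -(mulVf gN0) -mulrA geb mulr1.
rewrite /form_u /form_th /drift !(dotvDr, dotvNr, dotvZr) gb (dotvC v h1) /kap.
by field; rewrite !gt_eqF ?subr_gt0.
Qed.

Lemma driftD G G' eta eta' a : drift (a *: G + G') (a * eta + eta') =
  a *: drift G eta + drift G' eta'.
Proof.
apply/matrixP => i j; rewrite /drift dotvDr dotvZr !mxE; ring.
Qed.

Lemma form_uC u v : form_u u v = form_u v u.
Proof. by rewrite /form_u dotvC (mulrC (dotv h1 u)). Qed.

Lemma form_thC u v : form_th u v = form_th v u.
Proof. by rewrite /form_th dotv_mulmx Hsym dotvC (mulrC (dotv h1 u)). Qed.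

Lemma form_uDr a u v w : form_u w (a *: u + v) = a * form_u w u + form_u w v.
Proof. by rewrite /form_u !(dotvDr, dotvZr); ring. Qed.

Lemma form_thDr a u v w : form_th w (a *: u + v) = a * form_th w u + form_th w v.
Proof. by rewrite /form_th mulmxDr -scalemxAr !(dotvDr, dotvZr); ring. Qed.

Lemma kap_ge0 : 0 <= kap.
Proof. by rewrite divr_ge0 ?subr_ge0 ?ltW. Qed.

Lemma kapge_ge0 : 0 <= kap * ge.
Proof. exact: mulr_ge0 kap_ge0 (ltW ge0). Qed.

Lemma ckapge_ge0 : 0 <= c * kap * ge.
Proof. exact: mulr_ge0 (mulr_ge0 (ltW c0) kap_ge0) (ltW ge0). Qed.

Lemma form_u_ge u : `|u| ^+ 2 <= form_u u u.
Proof.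
apply: le_trans (dotv_ge_normsq u) _.
by rewrite lerDl -expr2; exact: mulr_ge0 kapge_ge0 (sqr_ge0 _).
Qed.

Lemma form_th_ge al u : al * `|u| ^+ 2 <= dotv u (H *m u) ->
  k * al * `|u| ^+ 2 <= form_th u u.
Proof.
move=> h; rewrite -mulrA; apply: (@le_trans _ _ (k * dotv u (H *m u))).
  by rewrite ler_pM2l.
by rewrite lerDl -expr2; exact: mulr_ge0 ckapge_ge0 (sqr_ge0 _).
Qed.

Lemma bilin_bound : exists C, 0 < C /\ forall u v,
  [/\ `|form_u u v| <= C * (`|u| * `|v|), `|form_th u v| <= C * (`|u| * `|v|),
      `|dotv u v| <= C * (`|u| * `|v|) & `|dotv u (H *m v)| <= C * (`|u| * `|v|)].
Proof.
have h1u u : `|dotv h1 u| <= n%:R * `|h1| * `|u|.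
  by apply: le_trans (dotv_bound _ _) _; rewrite mulrA.
have [C2 [C20 hC2]] := form_bound H.
pose D := (n%:R * `|h1|) ^+ 2.
have D0 : 0 <= D by exact: sqr_ge0.
have hD u v : `|dotv h1 u * dotv h1 v| <= D * (`|u| * `|v|).
  rewrite normrM /D expr2 [leRHS](_ : _ = (n%:R * `|h1| * `|u|) * (n%:R * `|h1| * `|v|)).
    by apply: ler_pM.
  by ring.
have n0 : 0 <= n%:R :> R by [].
have kg := kapge_ge0.
have ckg := ckapge_ge0.
pose Cs := n%:R + C2 + kap * ge * D + (k * C2 + c * kap * ge * D).
have q1 : 0 <= kap * ge * D by exact: mulr_ge0.
have q2 : 0 <= c * kap * ge * D by exact: mulr_ge0.
have q3 : 0 < k * C2 by rewrite mulr_gt0.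
exists Cs; split; first by rewrite /Cs; lra.
move=> u v; have uv0 : 0 <= `|u| * `|v| by rewrite mulr_ge0.
have le C : C <= Cs -> C * (`|u| * `|v|) <= Cs * (`|u| * `|v|) by move=> ?; rewrite ler_wpM2r.
split.
- apply: le_trans (le (n%:R + kap * ge * D) _); last by rewrite /Cs; lra.
  apply: le_trans (ler_normD _ _) _; rewrite mulrDl; apply: lerD; first exact: dotv_bound.
  by rewrite normrM (ger0_norm kg) -[leRHS]mulrA ler_wpM2l.
- apply: le_trans (le (k * C2 + c * kap * ge * D) _); last by rewrite /Cs; lra.
  apply: le_trans (ler_normD _ _) _; rewrite mulrDl; apply: lerD.
    by rewrite normrM (gtr0_norm k0) -[leRHS]mulrA ler_pM2l.
  by rewrite normrM (ger0_norm ckg) -[leRHS]mulrA ler_wpM2l.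
- by apply: le_trans (le n%:R _); [exact: dotv_bound|rewrite /Cs; lra].
- by apply: le_trans (le C2 _); [exact: hC2|rewrite /Cs; lra].
Qed.

Lemma lyapC ep ep2 L1 L2 x y : lyap_form ep ep2 L1 L2 x y = lyap_form ep ep2 L1 L2 y x.
Proof.
case: x => th G J g eta gam; case: y => th' G' J' g' eta' gam' /=.
rewrite (form_uC (drift G eta)) (form_thC th) (dotvC G) (dotvC g) (mulrC eta) (mulrC J) (mulrC gam).
by rewrite [form_u th _ + _]addrC.
Qed.

Variables (Ge : 'cV[R]_n) (etae me xae : R) (m : R -> R) (Cm : R).
Hypothesis Cm0 : 0 <= Cm.
Hypothesis xaeE : xae = k * dotv Ge h1 - c * etae.
Hypothesis mT : forall x, `|m x - me - p * (x - xae)| <= Cm * (x - xae) ^+ 2.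
Hypothesis GeE : k *: Ge = (ge * me) *: h1.

(** The averaged field in coordinates centred at the equilibrium. *)
Definition errfield (e : state R n) : state R n :=
  let: State th G J g eta gam := e in
  State
    (- (k *: (Ge + G)) +
       ((ge + gam) * m (k * dotv (Ge + G) (h1 + g) - c * (etae + eta))) *: (h1 + g))
    (- (wf *: G) + wf *: (H *m th))
    (- (wf * J) + wf * (dotv Ge th + 2^-1 * dotv th (H *m th)))
    (- (wf *: g))
    (- (wf * eta) + wf * dotv h1 th)
    (wf * (ge + gam) * (1 - (ge + gam) * dotv (h1 + g) (h1 + g))).

(** The part of the derivative of theta that is not the linear drift. *)
Definition resid (G g : 'cV[R]_n) (eta gam : R) : 'cV[R]_n :=
  - (k *: (Ge + G)) +
       ((ge + gam) * m (k * dotv (Ge + G) (h1 + g) - c * (etae + eta))) *: (h1 + g)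
  - drift G eta.

(** Apart from a quadratic remainder, the difference comes from the errors g of
    the estimate of h1 and gam of gamma, because the linear response to the
    other errors is the drift. *)
Lemma resid_bound : exists C, 0 <= C /\ forall G g eta gam E, E <= 1 ->
  `|G| <= E -> `|g| <= E -> `|eta| <= E -> `|gam| <= E ->
  `|resid G g eta gam| <= C * (`|g| + `|gam| + E ^+ 2).
Proof.
pose n' : R := n%:R.
have n0 : 0 <= n' by exact: ler0n.
pose Cx := k * (n' * `|h1|) + c + k * (n' * (`|Ge| + 1)).
have Cx0 : 0 <= Cx by rewrite /Cx !addr_ge0// ?mulr_ge0// ?ltW.
pose Mm := `|me| + p * Cx + Cm * Cx ^+ 2.
have Mm0 : 0 <= Mm by rewrite /Mm !addr_ge0// ?mulr_ge0// ?sqr_ge0// ltW.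
pose K1 := Mm * (`|h1| + 1); pose K2 := ge * Mm.
pose K3 := ge * (Cm * Cx ^+ 2) * `|h1|.
pose K4 := ge * (p * (k * (n' * (`|Ge| + 1)))) * `|h1|.
have K10 : 0 <= K1 by rewrite mulr_ge0// addr_ge0.
have K20 : 0 <= K2 by rewrite mulr_ge0// ltW.
have K30 : 0 <= K3 by rewrite !mulr_ge0// ?sqr_ge0// ltW.
have K40 : 0 <= K4 by rewrite !mulr_ge0// ?addr_ge0// ltW.
exists (K1 + K2 + K3 + K4); split; first by rewrite !addr_ge0.
move=> G g eta gam E E1 hG hg heta hgam.
have E0 : 0 <= E by apply: le_trans hG.
pose X := k * dotv (Ge + G) (h1 + g) - c * (etae + eta).
pose l0 := k * dotv h1 G - c * eta.
pose l1 := k * dotv (Ge + G) g.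
have XE : X - xae = l0 + l1.
  by rewrite /X /l0 /l1 xaeE !(dotvDl, dotvDr) (dotvC h1 G); ring.
have hl1 : `|l1| <= k * (n' * (`|Ge| + 1)) * `|g|.
  rewrite normrM gtr0_norm// -!mulrA ler_pM2l//; apply: le_trans (dotv_bound _ _) _.
  rewrite ler_wpM2l// ler_wpM2r//; apply: le_trans (ler_normD _ _) _.
  by rewrite lerD2l (le_trans hG).
have hl0 : `|l0| <= (k * (n' * `|h1|) + c) * E.
  apply: le_trans (ler_normB _ _) _; rewrite mulrDl !normrM (gtr0_norm k0) (gtr0_norm c0).
  apply: lerD; last by rewrite ler_pM2l.
  rewrite -!mulrA ler_pM2l//; apply: le_trans (dotv_bound _ _) _.
  by rewrite ler_wpM2l// ler_wpM2l.
have hX : `|X - xae| <= Cx * E.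
  rewrite XE; apply: le_trans (ler_normD _ _) _; rewrite /Cx mulrDl.
  apply: lerD => //; apply: le_trans hl1 _; rewrite ler_wpM2l//.
  by rewrite !mulr_ge0// ?addr_ge0// ltW.
have hX2 : (X - xae) ^+ 2 <= Cx ^+ 2 * E ^+ 2.
  by rewrite -exprMn -[leLHS]ger0_norm ?sqr_ge0// normrX ler_sqr ?nnegrE// mulr_ge0.
have hm : `|m X - me - p * (X - xae)| <= Cm * Cx ^+ 2 * E ^+ 2.
  by apply: le_trans (mT _) _; rewrite -mulrA ler_wpM2l.
have E2 : E ^+ 2 <= 1 by rewrite expr_le1.
have hmX : `|m X| <= Mm.
  have -> : m X = me + p * (X - xae) + (m X - me - p * (X - xae)) by ring.
  apply: le_trans (ler_normD _ _) _; apply: lerD.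
    apply: le_trans (ler_normD _ _) _; rewrite lerD2l normrM (gtr0_norm p0).
    by rewrite ler_pM2l//; apply: le_trans hX _; rewrite ler_piMr.
  by apply: le_trans hm _; rewrite ler_piMr// mulr_ge0// sqr_ge0.
have -> : resid G g eta gam = (gam * m X) *: (h1 + g) + (ge * m X) *: g +
   (ge * (m X - me - p * (X - xae))) *: h1 + (ge * (p * l1)) *: h1.
  rewrite XE /resid -/X /drift -/l0 scalerDr GeE.
  by apply/matrixP => i j; rewrite !mxE; ring.
have t1 : `|(gam * m X) *: (h1 + g)| <= K1 * `|gam|.
  rewrite normrZ normrM -mulrA mulrC ler_wpM2r//; apply: ler_pM => //.
  by apply: le_trans (ler_normD _ _) _; rewrite lerD2l (le_trans hg).
have t2 : `|(ge * m X) *: g| <= K2 * `|g|.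
  by rewrite normrZ normrM (gtr0_norm ge0) ler_wpM2r// ler_pM2l.
have t3 : `|(ge * (m X - me - p * (X - xae))) *: h1| <= K3 * E ^+ 2.
  rewrite normrZ normrM (gtr0_norm ge0) /K3 [leRHS]mulrAC ler_wpM2r//.
  by rewrite -[leRHS]mulrA ler_pM2l.
have t4 : `|(ge * (p * l1)) *: h1| <= K4 * `|g|.
  rewrite normrZ (normrM ge) (normrM p) (gtr0_norm ge0) (gtr0_norm p0) /K4 [leRHS]mulrAC ler_wpM2r//.
  by rewrite -[leRHS]mulrA ler_pM2l// -[leRHS]mulrA ler_pM2l.
apply: le_trans (ler_normD _ _) _.
apply: (@le_trans _ _ (K1 * `|gam| + K2 * `|g| + K3 * E ^+ 2 + K4 * `|g|)).
  apply: lerD => //; apply: le_trans (ler_normD _ _) _; apply: lerD => //.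
  by apply: le_trans (ler_normD _ _) _; apply: lerD.
have EE : 0 <= E ^+ 2 by exact: sqr_ge0.
have := mulr_ge0 K10 (normr_ge0 g); have := mulr_ge0 K10 EE.
have := mulr_ge0 K20 (normr_ge0 gam); have := mulr_ge0 K20 EE.
have := mulr_ge0 K30 (normr_ge0 gam); have := mulr_ge0 K30 (normr_ge0 g).
have := mulr_ge0 K40 (normr_ge0 gam); have := mulr_ge0 K40 EE.
lra.
Qed.

(** By geb the linear part of the equation of gam is
    - wf gam - 2 wf ge^2 h1.g: a stable filter driven by g. *)
Lemma gain_bound : exists C, 0 <= C /\ forall g gam E, E <= 1 ->
  `|g| <= E -> `|gam| <= E ->
  gam * (wf * (ge + gam) * (1 - (ge + gam) * dotv (h1 + g) (h1 + g))) <=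
  - wf * gam ^+ 2 + C * (`|gam| * `|g|) + C * E ^+ 3.
Proof.
have gN0 : ge != 0 by rewrite gt_eqF.
have gb : dotv h1 h1 = ge^-1 by rewrite -[LHS]mul1r -(mulVf gN0) -mulrA geb mulr1.
have n0 : 0 <= n%:R :> R by exact: ler0n.
pose C1 := wf * ge^-1; pose C2 := wf * ((ge + 1) ^+ 2 * (n%:R * (2 * `|h1| + 1))).
have C10 : 0 <= C1 by rewrite mulr_ge0 ?invr_ge0// ltW.
have C20 : 0 <= C2.
  apply: mulr_ge0; first exact: ltW.
  by rewrite mulr_ge0 ?sqr_ge0// mulr_ge0// addr_ge0// mulr_ge0.
exists (C1 + C2); split; first exact: addr_ge0.
move=> g gam E E1 hg hgam; have E0 : 0 <= E by apply: le_trans hg.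
pose Y := 2 * dotv h1 g + dotv g g.
have hY : `|Y| <= n%:R * (2 * `|h1| + 1) * `|g|.
  apply: le_trans (ler_normD _ _) _.
  have d1 := dotv_bound h1 g; have d2 := dotv_bound g g.
  have d3 : n%:R * (`|g| * `|g|) <= n%:R * (1 * `|g|).
    by rewrite ler_wpM2l// ler_wpM2r// (le_trans hg).
  by rewrite normrM normr_nat; move: d1 d2 d3; lra.
have -> : gam * (wf * (ge + gam) * (1 - (ge + gam) * dotv (h1 + g) (h1 + g))) =
   - wf * gam ^+ 2 + (- (wf * ge^-1 * gam ^+ 3) - wf * (gam * ((ge + gam) ^+ 2 * Y))).
  by rewrite !(dotvDl, dotvDr) (dotvC g h1) gb /Y; field.
rewrite -addrA lerD2l.
have E3 : `|gam| ^+ 3 <= E ^+ 3 by rewrite lerXn2r ?nnegrE.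
have t1 : - (wf * ge^-1 * gam ^+ 3) <= C1 * E ^+ 3.
  apply: le_trans (ler_norm _) _; rewrite normrN normrM (ger0_norm C10) normrX.
  by rewrite ler_wpM2l.
have t2 : - (wf * (gam * ((ge + gam) ^+ 2 * Y))) <= C2 * (`|gam| * `|g|).
  apply: le_trans (ler_norm _) _; rewrite normrN normrM (gtr0_norm wf0) /C2 -[leRHS]mulrA ler_pM2l//.
  rewrite normrM [leRHS](_ : _ = `|gam| * ((ge + 1) ^+ 2 * (n%:R * (2 * `|h1| + 1) * `|g|))); last by ring.
  rewrite ler_wpM2l// normrM normrX; apply: ler_pM => //.
  rewrite ler_sqr ?nnegrE ?normr_ge0 ?(addr_ge0 (ltW ge0) ler01)//.
  apply: le_trans (ler_normD _ _) _; rewrite (gtr0_norm ge0) lerD2l.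
  exact: le_trans hgam E1.
have p1' : 0 <= C1 * (`|gam| * `|g|) by rewrite mulr_ge0// mulr_ge0.
have p2' : 0 <= C2 * E ^+ 3 by rewrite mulr_ge0// exprn_ge0.
move: t1 t2 p1' p2'; lra.
Qed.

Lemma drift_bound : exists C, 0 <= C /\ forall G eta E,
  `|G| <= E -> `|eta| <= E -> `|drift G eta| <= C * E.
Proof.
exists (k + ge * p * (k * (n%:R * `|h1|) + c) * `|h1|); split.
  rewrite addr_ge0 ?(ltW k0)// mulr_ge0// mulr_ge0//.
    by rewrite mulr_ge0// ltW.
  by rewrite addr_ge0 ?(ltW c0)// mulr_ge0 ?(ltW k0).
move=> G eta E hG heta; have E0 : 0 <= E by apply: le_trans hG.
apply: le_trans (ler_normD _ _) _; rewrite mulrDl normrN !normrZ (gtr0_norm k0).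
apply: lerD; first by rewrite ler_pM2l.
rewrite [leRHS]mulrAC ler_wpM2r// (gtr0_norm ge0) (gtr0_norm p0) -[leRHS]mulrA.
rewrite ler_pM2l ?mulr_gt0//; apply: le_trans (ler_normB _ _) _.
rewrite mulrDl !normrM (gtr0_norm k0) (gtr0_norm c0); apply: lerD; last by rewrite ler_pM2l.
rewrite -mulrA ler_pM2l//; apply: le_trans (dotv_bound _ _) _.
by rewrite -mulrA ler_wpM2l// ler_wpM2l.
Qed.

Variable al : R.
Hypothesis al0 : 0 < al.
Hypothesis Hal : forall v, al * `|v| ^+ 2 <= dotv v (H *m v).

Definition in_box (e : state R n) (E : R) :=
  let: State th G J g eta gam := e in
  [/\ `|th| <= E, `|G| <= E, `|J| <= E & [/\ `|g| <= E, `|eta| <= E & `|gam| <= E]].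

Lemma le_abs (x y : R) : `|x| <= y -> x <= y /\ - x <= y.
Proof. by rewrite ler_norml => /andP [? ?]; split=> //; rewrite lerNl. Qed.

Lemma filter_G Cb (G th : 'cV[R]_n) :
  `|dotv G (H *m th)| <= Cb * (`|G| * `|th|) ->
  dotv G (- (wf *: G) + wf *: (H *m th)) <=
  - wf * `|G| ^+ 2 + wf * Cb * (`|th| * `|G|).
Proof.
move=> /le_abs [h _]; have h2 := dotv_ge_normsq G; rewrite dotvDr dotvNr !dotvZr.
have h3 : wf * `|G| ^+ 2 <= wf * dotv G G by rewrite ler_pM2l.
have h4 : wf * dotv G (H *m th) <= wf * (Cb * (`|G| * `|th|)) by rewrite ler_pM2l.
move: h3 h4; lra.
Qed.

Lemma filter_eta (th : 'cV[R]_n) (eta : R) :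
  eta * (- (wf * eta) + wf * dotv h1 th) <=
  - wf * `|eta| ^+ 2 + wf * (n%:R * `|h1|) * (`|th| * `|eta|).
Proof.
rewrite real_normK ?num_real//.
have h : eta * dotv h1 th <= `|eta| * (n%:R * (`|h1| * `|th|)).
  by apply: le_trans (ler_norm _) _; rewrite normrM ler_wpM2l// dotv_bound.
have h4 : wf * (eta * dotv h1 th) <= wf * (`|eta| * (n%:R * (`|h1| * `|th|))).
  by rewrite ler_pM2l.
move: h4; lra.
Qed.

Lemma filter_J Cb (th : 'cV[R]_n) (J : R) : `|th| <= 1 ->
  `|dotv th (H *m th)| <= Cb * (`|th| * `|th|) ->
  J * (- (wf * J) + wf * (dotv Ge th + 2^-1 * dotv th (H *m th))) <=
  - wf * `|J| ^+ 2 + wf * (n%:R * `|Ge| + Cb) * (`|th| * `|J|).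
Proof.
move=> th1 hth; rewrite real_normK ?num_real//.
have h : `|dotv Ge th + 2^-1 * dotv th (H *m th)| <= (n%:R * `|Ge| + Cb) * `|th|.
  apply: le_trans (ler_normD _ _) _; rewrite mulrDl -mulrA.
  apply: lerD; first exact: dotv_bound.
  have th0 : 0 <= Cb * (`|th| * `|th|) by apply: le_trans hth.
  have h5 : Cb * (`|th| * `|th|) <= Cb * `|th|.
    have [->|thN0] := eqVneq `|th| 0; first by rewrite !mulr0.
    have tt : 0 < `|th| * `|th| by rewrite mulr_gt0 ?lt_neqAle ?normr_ge0 ?andbT 1?eq_sym.
    have Cb0 : 0 <= Cb by rewrite -(pmulr_lge0 _ tt).
    by rewrite ler_wpM2l// ler_piMl.
  have h6 : 0 <= 2^-1 * (Cb * (`|th| * `|th|)) by rewrite mulr_ge0 ?invr_ge0.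
  rewrite normrM ger0_norm ?invr_ge0//; move: hth h5 h6; lra.
have h3 : J * (dotv Ge th + 2^-1 * dotv th (H *m th)) <= `|J| * ((n%:R * `|Ge| + Cb) * `|th|).
  by apply: le_trans (ler_norm _) _; rewrite normrM ler_wpM2l.
have h4 : wf * (J * (dotv Ge th + 2^-1 * dotv th (H *m th))) <=
    wf * (`|J| * ((n%:R * `|Ge| + Cb) * `|th|)) by rewrite ler_pM2l.
move: h4; lra.
Qed.

(** In the derivative of the form, the terms in u and theta combine by
    drift_filter: the products of theta and u under form_th cancel, leaving
    - wf form_u u u, and the cross term of weight ep contributes
    - ep wf form_th th th.  All other terms are products of errors that
    lyap_weights absorbs, or cubic. *)
Theorem lyap_decay : exists ep ep2 L1 L2 a0 mu C, [/\ 0 < a0, 0 < mu, 0 <= C,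
  forall e, a0 * sq_sum e <= lyap_form ep ep2 L1 L2 e e &
  forall e E, E <= 1 -> in_box e E ->
    lyap_form ep ep2 L1 L2 e (errfield e) <= - mu * sq_sum e + C * E ^+ 3].
Proof.
have [Cb [Cb0 hCb]] := bilin_bound; have [Cr [Cr0 hCr]] := resid_bound.
have [Cg [Cg0 hCg]] := gain_bound; have [Cd [Cd0 hCd]] := drift_bound.
have n0 : 0 <= n%:R :> R by exact: ler0n.
pose C := wf * Cb + wf * Cb * Cr + Cb * Cr + wf * (n%:R * `|h1|) +
  wf * (n%:R * `|Ge| + Cb) + Cg + Cb.
have i1 : 0 < wf * Cb by rewrite mulr_gt0.
have i2 : 0 <= wf * Cb * Cr by rewrite mulr_ge0// ltW.
have i3 : 0 <= Cb * Cr by rewrite mulr_ge0// ltW.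
have i4 : 0 <= wf * (n%:R * `|h1|) by rewrite mulr_ge0 ?(ltW wf0)// mulr_ge0.
have i5 : 0 <= wf * (n%:R * `|Ge| + Cb).
  by rewrite mulr_ge0 ?(ltW wf0)// addr_ge0 ?(ltW Cb0)// mulr_ge0.
have C0 : 0 < C by rewrite /C; lra.
have lx1 : wf * Cb * Cr <= C by rewrite /C; lra.
have lx2 : Cb * Cr <= C by rewrite /C; lra.
have lx3 : wf * Cb <= C by rewrite /C; lra.
have lx5 : wf * (n%:R * `|h1|) <= C by rewrite /C; lra.
have lx6 : wf * (n%:R * `|Ge| + Cb) <= C by rewrite /C; lra.
have lx7 : Cg <= C by rewrite /C; lra.
have lCb : Cb <= C by rewrite /C; lra.
clearbody C.
have m20 : 0 < wf * (k * al) by rewrite !mulr_gt0.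
have [ep [ep2 [L1 [L2 [mu [[ep0 ep20 L10 L20 mu0] [epwf ep1 hpos hdec]]]]]]] :=
  lyap_weights wf0 m20 m20 C0.
pose a0 := Num.min (Num.min (wf * (k * al) / 2) ep2) (Num.min L1 L2).
have a00 : 0 < a0 by rewrite !lt_min ep20 L10 L20 divr_gt0.
have a1 : a0 <= wf * (k * al) / 2 by rewrite !ge_min lexx.
have a2 : a0 <= ep2 by rewrite !ge_min lexx orbT.
have a3 : a0 <= L1 by rewrite !ge_min lexx !orbT.
have a4 : a0 <= L2 by rewrite !ge_min lexx !orbT.
exists ep, ep2, L1, L2, a0, mu, (wf * Cb * Cr + Cb * Cr * Cd + L1 * Cg); split=> //.
- by rewrite !addr_ge0// mulr_ge0// ltW.
- case=> th G J g eta gam /=; set u := drift G eta.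
  have q1 := form_u_ge u; have q2 := form_th_ge (Hal th).
  have [q3 _ _ _] := hCb th u.
  have {}q3 : - (ep * form_u th u) <= ep * C * `|th| * `|u|.
    have [_ h] := le_abs q3; rewrite -mulrN -!mulrA ler_pM2l//; apply: le_trans h _.
    by rewrite ler_wpM2r// mulr_ge0.
  have q4 := hpos `|th| `|u|.
  have q5 := dotv_ge_normsq G; have q6 := dotv_ge_normsq g.
  have q7 : wf * (k * al * `|th| ^+ 2) <= wf * form_th th th by rewrite ler_pM2l.
  have q8 : a0 * `|th| ^+ 2 <= wf * (k * al) / 2 * `|th| ^+ 2 by rewrite ler_wpM2r ?sqr_ge0.
  have q9 : a0 * (`|G| ^+ 2 + eta ^+ 2 + J ^+ 2) <= ep2 * (dotv G G + eta ^+ 2 + J ^+ 2).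
    by apply: ler_pM => //; rewrite ?addr_ge0 ?sqr_ge0 ?(ltW a00)// !lerD2r.
  have q10 : a0 * gam ^+ 2 <= L1 * gam ^+ 2 by rewrite ler_wpM2r ?sqr_ge0.
  have q11 : a0 * `|g| ^+ 2 <= L2 * dotv g g by apply: ler_pM => //; rewrite ?sqr_ge0 ?(ltW a00).
  have q12 : 0 <= `|u| ^+ 2 by exact: sqr_ge0.
  move: q1 q3 q4 q7 q8 q9 q10 q11 q12; rewrite -!expr2; lra.
case=> th G J g eta gam E E1 /= [hth hG hJ [hg heta hgam]].
have E0 : 0 <= E by apply: le_trans hG.
have := hCr G g eta gam E E1 hG hg heta hgam.
have -> : - (k *: (Ge + G)) +
       ((ge + gam) * m (k * dotv (Ge + G) (h1 + g) - c * (etae + eta))) *: (h1 + g) =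
  1 *: drift G eta + resid G g eta gam by rewrite scale1r /resid [RHS]addrC subrK.
set rho := resid _ _ _ _ => hrho.
have := hCd G eta E hG heta; set u := drift G eta => hu.
(* The derivative of the drift is - wf drift, plus wf times the drift of the
   settled filters. *)
have -> : drift (- (wf *: G) + wf *: (H *m th)) (- (wf * eta) + wf * dotv h1 th) =
  (- wf) *: u + (wf *: drift (H *m th) (dotv h1 th) + 0).
  rewrite -scaleNr -mulNr driftD; congr (_ + _).
  rewrite -{1}[wf *: (H *m th)]addr0 -{1}[wf * dotv h1 th]addr0 driftD; congr (_ + _).
  by rewrite /drift scaler0 dotv0r !mulr0 subrr mulr0 scale0r oppr0 addr0.
rewrite addr0.
have fu v : form_u v (- wf *: u + wf *: drift (H *m th) (dotv h1 th)) =
   - wf * form_u v u - wf * form_th v th.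
  rewrite form_uDr -[wf *: _]addr0 form_uDr drift_filter.
  by rewrite /form_u !dotv0r !mulr0; ring.
rewrite !fu form_thDr (form_uC (1 *: u + rho)) form_uDr (form_thC u th).
set a := `|th|; set U := `|u|.
have an0 : 0 <= a by exact: normr_ge0.
have Un0 : 0 <= U by exact: normr_ge0.
have rho_s : wf * form_th th rho <= wf * Cb * Cr * (a * (`|g| + `|gam|)) + wf * Cb * Cr * E ^+ 3.
  have [_ h _ _] := hCb th rho; have [{}h _] := le_abs h.
  rewrite -[X in _ <= X + _]mulrA -[X in _ <= _ + X]mulrA -mulrDr.
  rewrite -!mulrA ler_pM2l//; apply: le_trans h _; rewrite ler_pM2l// -mulrDr.
  apply: (@le_trans _ _ (a * (Cr * (`|g| + `|gam| + E ^+ 2)))); first by rewrite ler_wpM2l.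
  rewrite mulrCA ler_wpM2l// mulrDr lerD2l exprS ler_wpM2r// sqr_ge0//.
have rho_u : ep * form_u u rho <= Cb * Cr * (U * (`|g| + `|gam|)) + Cb * Cr * Cd * E ^+ 3.
  have [h _ _ _] := hCb u rho; have [{}h _] := le_abs h.
  have X0 : 0 <= Cb * (U * `|rho|) by rewrite mulr_ge0 ?(ltW Cb0)// mulr_ge0.
  apply: (@le_trans _ _ (1 * (Cb * (U * `|rho|)))).
    apply: (@le_trans _ _ (ep * (Cb * (U * `|rho|)))); first by rewrite ler_pM2l.
    by rewrite ler_wpM2r.
  rewrite mul1r -!mulrA -mulrDr ler_pM2l//.
  apply: (@le_trans _ _ (U * (Cr * (`|g| + `|gam| + E ^+ 2)))); first by rewrite ler_wpM2l.
  by rewrite mulrCA -mulrDr ler_wpM2l// mulrDr lerD2l [E ^+ 3]exprS mulrA ler_wpM2r ?sqr_ge0.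
have cross : - (ep * (wf * form_u th u)) <= ep * (wf * Cb) * (a * U).
  have [hq _ _ _] := hCb th u; have [_ hq'] := le_abs hq.
  by rewrite -mulrN -mulrN -!mulrA ler_pM2l// ler_pM2l.
have [_ _ _ hG'] := hCb G th; have tG := filter_G hG'.
have teta := filter_eta th eta.
have [_ _ _ hth'] := hCb th th; have tJ := filter_J J (le_trans hth E1) hth'.
rewrite -/a in tG teta tJ.
clear hG' hth'.
have tgam := hCg g gam E E1 hg hgam.
clear hCg hCr hCd hCb hpos a1 a2 a3 a4 a00 hG hJ hg heta hgam hrho hu hth E1 m20 mu0.

have tg : L2 * wf * `|g| ^+ 2 <= L2 * wf * dotv g g by rewrite ler_pM2l ?mulr_gt0// dotv_ge_normsq.
have tu : (wf - ep) * form_u u u >= wf / 2 * U ^+ 2.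
  have uu0 : 0 <= form_u u u by apply: le_trans (form_u_ge u); exact: sqr_ge0.
  apply: (@le_trans _ _ (wf / 2 * form_u u u)).
    by rewrite ler_wpM2l ?form_u_ge// divr_ge0// ltW.
  by rewrite ler_wpM2r//; move: epwf; lra.
have tth : ep * (wf * (k * al)) * a ^+ 2 <= ep * (wf * form_th th th).
  by rewrite -!mulrA ler_pM2l// ler_pM2l// mulrA; exact: form_th_ge.
have Cle D x : 0 <= D -> 0 <= x -> D <= C -> D * x <= C * x by move=> ? ? ?; rewrite ler_wpM2r.
have ag0 : 0 <= a * (`|g| + `|gam|) by rewrite mulr_ge0// addr_ge0.
have Ug0 : 0 <= U * (`|g| + `|gam|) by rewrite mulr_ge0// addr_ge0.
have x1 := Cle (wf * Cb * Cr) _ i2 ag0 lx1.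
have x2 := Cle (Cb * Cr) _ i3 Ug0 lx2.
have aU0 : 0 <= a * U by rewrite mulr_ge0.
have x3 := Cle (wf * Cb) _ (ltW i1) aU0 lx3.
have x3' : ep * (wf * Cb * (a * U)) <= ep * (C * (a * U)) by rewrite ler_pM2l.
have aG0 : 0 <= a * `|G| by rewrite mulr_ge0.
have x4 := Cle (wf * Cb) _ (ltW i1) aG0 lx3.
have ae0 : 0 <= a * `|eta| by rewrite mulr_ge0.
have x5 := Cle (wf * (n%:R * `|h1|)) _ i4 ae0 lx5.
have aJ0 : 0 <= a * `|J| by rewrite mulr_ge0.
have x6 := Cle (wf * (n%:R * `|Ge| + Cb)) _ i5 aJ0 lx6.
have sg0 : 0 <= `|gam| * `|g| by rewrite mulr_ge0.
have x7 := Cle Cg _ Cg0 sg0 lx7.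
have hfin := hdec a U `|G| `|eta| `|J| `|gam| `|g|.
clear hdec Cle lx1 lx2 lx3 lx5 lx6 lx7 lCb i1 i2 i3 i4 i5 ag0 Ug0 aU0 aG0 ae0 aJ0 sg0 an0 Un0 E0 C0 n0 ep0 ep1 epwf.
have y1 : ep2 * (dotv G (- (wf *: G) + wf *: (H *m th)) + eta * (- (wf * eta) + wf * dotv h1 th)
   + J * (- (wf * J) + wf * (dotv Ge th + 2^-1 * dotv th (H *m th)))) <=
   ep2 * ((- wf * `|G| ^+ 2 + C * a * `|G|) + (- wf * `|eta| ^+ 2 + C * a * `|eta|)
            + (- wf * `|J| ^+ 2 + C * a * `|J|)).
  rewrite ler_pM2l//; move: tG teta tJ x4 x5 x6; lra.
have y2 : L1 * (gam * (wf * (ge + gam) * (1 - (ge + gam) * dotv (h1 + g) (h1 + g)))) <=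
   L1 * (- wf * `|gam| ^+ 2 + C * `|gam| * `|g|) + L1 * Cg * E ^+ 3.
  rewrite -[X in _ <= _ + X]mulrA -mulrDr ler_pM2l// real_normK ?num_real//; move: tgam x7; lra.
rewrite !real_normK ?num_real// in y1 y2 hfin *.
clear tG teta tJ tgam x3 x4 x5 x6 x7.
rewrite dotvNr dotvZr.
move: rho_s rho_u cross tg tu tth x1 x2 x3' y1 y2 hfin.
lra.
Qed.

End LyapunovForm.

(** * States as column vectors *)

Section Stack.
Variables (R : realType) (n : nat).
Notation V := 'cV[R]_(n + (n + (1 + (n + (1 + 1))))).

Definition unstack (v : V) : state R n :=
  State (usubmx v) (usubmx (dsubmx v)) (usubmx (dsubmx (dsubmx v)) 0 0)
    (usubmx (dsubmx (dsubmx (dsubmx v))))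
    (usubmx (dsubmx (dsubmx (dsubmx (dsubmx v)))) 0 0)
    (dsubmx (dsubmx (dsubmx (dsubmx (dsubmx v)))) 0 0).

Lemma unstackK v : stack (unstack v) = v.
Proof. by rewrite /stack /= -!mx11_scalar !vsubmxK. Qed.

Lemma stackK x : unstack (stack x) = x.
Proof.
case: x => th G J g eta gam; rewrite /unstack /stack /=.
by rewrite !(col_mxKu, col_mxKd) !mxE !eqxx !mulr1n.
Qed.

Lemma unstack_lin a (y z : V) : unstack (a *: y + z) =
  State (a *: st_theta (unstack y) + st_theta (unstack z))
    (a *: st_GJ (unstack y) + st_GJ (unstack z))
    (a * st_etaJ (unstack y) + st_etaJ (unstack z))
    (a *: st_Gh (unstack y) + st_Gh (unstack z))
    (a * st_etah (unstack y) + st_etah (unstack z))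
    (a * st_gamma (unstack y) + st_gamma (unstack z)).
Proof. by rewrite /unstack /= !linearP /= !mxE. Qed.

(** Coordinates of a stacked state are entries of its components: a property of
    all coordinates is checked block by block. *)
Lemma stack_ind (Q : (state R n -> R) -> Prop) :
  (forall i, Q (fun x => st_theta x i 0)) -> (forall i, Q (fun x => st_GJ x i 0)) ->
  Q (fun x => st_etaJ x) -> (forall i, Q (fun x => st_Gh x i 0)) ->
  Q (fun x => st_etah x) -> Q (fun x => st_gamma x) ->
  forall i, Q (fun x => stack x i 0).
Proof.
move=> h1 h2 h3 h4 h5 h6 i.
have fe (f g : state R n -> R) : f =1 g -> Q f -> Q g by move=> /funext ->.
rewrite /stack.
case: (split_ordP i) => {}i ->; first by apply: fe (h1 i) => x; rewrite col_mxEu.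
case: (split_ordP i) => {}i ->; first by apply: fe (h2 i) => x; rewrite col_mxEd col_mxEu.
case: (split_ordP i) => {}i ->.
  by apply: fe h3 => x; rewrite !col_mxEd col_mxEu mxE ord1 eqxx mulr1n.
case: (split_ordP i) => {}i ->; first by apply: fe (h4 i) => x; rewrite !col_mxEd col_mxEu.
case: (split_ordP i) => {}i ->.
  by apply: fe h5 => x; rewrite !col_mxEd col_mxEu mxE ord1 eqxx mulr1n.
by apply: fe h6 => x; rewrite !col_mxEd mxE ord1 eqxx mulr1n.
Qed.

Lemma tame_unstack :
  [/\ forall i, tame (fun v : V => st_theta (unstack v) i 0),
      forall i, tame (fun v : V => st_GJ (unstack v) i 0),
      tame (fun v : V => st_etaJ (unstack v)) &
  [/\ forall i, tame (fun v : V => st_Gh (unstack v) i 0),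
      tame (fun v : V => st_etah (unstack v)) &
      tame (fun v : V => st_gamma (unstack v))]].
Proof.
have e (f : V -> R) j : (forall v, f v = v j 0) -> tame f.
  by move=> /funext ->; exact: tame_coord.
split; last split; try move=> i; apply: e => v; rewrite /= !mxE; reflexivity.
Qed.

Lemma tame_dotv (u w : V -> 'cV[R]_n) :
  (forall i, tame (fun v => u v i 0)) -> (forall i, tame (fun v => w v i 0)) ->
  tame (fun v => dotv (u v) (w v)).
Proof.
move=> hu hw; have -> : (fun v => dotv (u v) (w v)) = fun v => \sum_i u v i 0 * w v i 0.
  by apply/funext => v; rewrite dotvE.
by apply: tame_sum => i; exact: tame_mul.
Qed.

Lemma tame_mulmx (A : 'M[R]_n) (u : V -> 'cV[R]_n) i :
  (forall i, tame (fun v => u v i 0)) -> tame (fun v => (A *m u v) i 0).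
Proof.
move=> hu; have -> : (fun v => (A *m u v) i 0) = fun v => \sum_j A i j * u v j 0.
  by apply/funext => v; rewrite mxE.
by apply: tame_sum => j; apply: tame_mul => //; exact: tame_cst.
Qed.

Lemma enorm_sq (u : 'cV[R]_n) : enorm u ^+ 2 = dotv u u.
Proof. by rewrite sqr_sqrtr//; apply: le_trans (dotv_ge_normsq u); exact: sqr_ge0. Qed.

End Stack.

(** * Products of sines *)

Section Trigonometry.
Variable R : realType.

Lemma zero_mean_add (f g : R -> R) : zero_mean f -> zero_mean g ->
  zero_mean (fun t => f t + g t).
Proof.
move=> [cf [Bf hf] [F [BF hF]]] [cg [Bg hg] [G [BG hG]]]; split.
- by move=> t; apply: cvgD; [exact: cf|exact: cg].
- by exists (Bf + Bg) => t; apply: le_trans (ler_normD _ _) (lerD _ _).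
- exists (fun t => F t + G t), (BF + BG) => t.
  have [dF bF] := hF t; have [dG bG] := hG t; split; first exact: (is_deriveD dF dG).
  by apply: le_trans (ler_normD _ _) (lerD _ _).
Qed.

Lemma zero_mean_scale c (f : R -> R) : zero_mean f -> zero_mean (fun t => c * f t).
Proof.
move=> [cf [Bf hf] [F [BF hF]]]; split.
- by move=> t; apply: cvgM; [exact: cvg_cst|exact: cf].
- by exists (`|c| * Bf) => t; rewrite normrM ler_wpM2l.
- exists (fun t => c * F t), (`|c| * BF) => t.
  have [dF bF] := hF t; split; first exact: (is_deriveZ c dF).
  by rewrite normrM ler_wpM2l.
Qed.

Lemma norm_sin_le1 (x : R) : `|sin x| <= 1.
Proof. by rewrite ler_norml sin_geN1 sin_le1. Qed.

Lemma norm_cos_le1 (x : R) : `|cos x| <= 1.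
Proof. by rewrite ler_norml cos_geN1 cos_le1. Qed.

Lemma zero_mean_sin nu : zero_mean (fun t : R => sin (nu * t)).
Proof.
have [->|nu0] := eqVneq nu 0.
  have -> : (fun t : R => sin (0 * t)) = fun=> 0 by apply/funext => t; rewrite mul0r sin0.
  exact: zero_mean0.
have ds (t : R) := is_derive1_comp (is_derive_sin (nu * t)) (is_derive_mull nu t).
have dc (t : R) := is_derive1_comp (is_derive_cos (nu * t)) (is_derive_mull nu t).
split.
- by move=> t; exact: (derive_continuous (ds t)).
- by exists 1 => t; exact: norm_sin_le1.
- exists (fun t => - nu^-1 * cos (nu * t)), `|nu^-1| => t; split.
    have := is_deriveZ (- nu^-1) (dc t); congr is_derive.
    by rewrite /GRing.scale /= mulrC -mulrA mulrN mulfV// mulrN1 opprK.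
  by rewrite normrM normrN ler_piMr ?norm_cos_le1.
Qed.

Lemma zero_mean_cos nu : nu != 0 -> zero_mean (fun t : R => cos (nu * t)).
Proof.
move=> nu0.
have ds (t : R) := is_derive1_comp (is_derive_sin (nu * t)) (is_derive_mull nu t).
have dc (t : R) := is_derive1_comp (is_derive_cos (nu * t)) (is_derive_mull nu t).
split.
- by move=> t; exact: (derive_continuous (dc t)).
- by exists 1 => t; exact: norm_cos_le1.
- exists (fun t => nu^-1 * sin (nu * t)), `|nu^-1| => t; split.
    have := is_deriveZ (nu^-1) (ds t); congr is_derive.
    by rewrite /GRing.scale /= mulrCA mulVf ?mulr1.
  by rewrite normrM ler_piMr ?norm_sin_le1.
Qed.

Lemma zero_mean_ext (f g : R -> R) : f =1 g -> zero_mean f -> zero_mean g.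
Proof. by move=> /funext ->. Qed.

(** The product is a difference of cosines at the frequencies A - B and A + B,
    which do not vanish. *)
Lemma zero_mean_sin2 (A B : R) : 0 < A -> 0 < B -> A != B ->
  zero_mean (fun t => sin (A * t) * sin (B * t)).
Proof.
move=> A0 B0 AB.
apply: (zero_mean_ext _ (zero_mean_add
  (zero_mean_scale 2^-1 (@zero_mean_cos (A - B) _))
  (zero_mean_scale (- 2^-1) (@zero_mean_cos (A + B) _)))).
- by move=> t; rewrite mulrBl mulrDl cosB cosD; field.
- by rewrite subr_eq0.
- by rewrite gt_eqF// addr_gt0.
Qed.

Lemma zero_mean_sinsq (A : R) : 0 < A ->
  zero_mean (fun t => sin (A * t) * sin (A * t) - 2^-1).
Proof.
move=> A0.
apply: (zero_mean_ext _ (zero_mean_scale (- 2^-1) (@zero_mean_cos (A + A) _))).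
- move=> t; rewrite mulrDl cosD.
  have := cos2Dsin2 (A * t) => h.
  have -> : cos (A * t) * cos (A * t) = 1 - sin (A * t) ^+ 2 by rewrite -h; ring.
  by field.
- by rewrite gt_eqF// addr_gt0.
Qed.

(** A product of three sines is a combination of sines, and a sine has mean
    zero at every frequency, zero included. *)
Lemma zero_mean_sin3 (A B C : R) :
  zero_mean (fun t => sin (A * t) * sin (B * t) * sin (C * t)).
Proof.
apply: (zero_mean_ext _ (zero_mean_add (zero_mean_add
  (zero_mean_scale 4^-1 (zero_mean_sin (A + B - C)))
  (zero_mean_scale 4^-1 (zero_mean_sin (A - B + C)))) (zero_mean_add
  (zero_mean_scale 4^-1 (zero_mean_sin (- A + B + C)))
  (zero_mean_scale (- 4^-1) (zero_mean_sin (A + B + C)))))).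
by move=> t; rewrite !mulrDl !mulNr !(sinD, cosD, sinN, cosN); field.
Qed.

(** The square root part is 1-Lipschitz: multiply the difference of the roots by
    their sum, which exceeds |x| + |y|. *)
Lemma maxd_lip (delta x y : R) : 0 < delta -> `|maxd delta x - maxd delta y| <= `|x - y|.
Proof.
move=> d0; rewrite /maxd -mulrBr opprD addrACA normrM ger0_norm ?invr_ge0//.
have sq z : `|z| < Num.sqrt (z ^+ 2 + delta).
  rewrite -ltr_sqr ?nnegrE ?sqrtr_ge0// sqr_sqrtr ?addr_ge0 ?sqr_ge0// 1?ltW//.
  by rewrite -normrX ger0_norm ?sqr_ge0// ltrDl.
set X := Num.sqrt _; set Y := Num.sqrt _.
have XE : X ^+ 2 = x ^+ 2 + delta by rewrite sqr_sqrtr// addr_ge0 ?sqr_ge0// ltW.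
have YE : Y ^+ 2 = y ^+ 2 + delta by rewrite sqr_sqrtr// addr_ge0 ?sqr_ge0// ltW.
have xX : `|x| < X := sq x; have yY : `|y| < Y := sq y.
have XY0 : 0 < X + Y.
  by rewrite addr_gt0//; [apply: le_lt_trans xX|apply: le_lt_trans yY].
have h : `|X - Y| <= `|x - y|.
  rewrite -(ler_pM2r XY0) -{1}(gtr0_norm XY0) -normrM.
  have -> : (X - Y) * (X + Y) = (x - y) * (x + y).
    have -> : (X - Y) * (X + Y) = X ^+ 2 - Y ^+ 2 by ring.
    by rewrite XE YE; ring.
  rewrite normrM ler_wpM2l//; apply: le_trans (ler_normD _ _) _.
  by rewrite lerD// ltW.
have := ler_normD (x - y) (X - Y); move: h; lra.
Qed.
End Trigonometry.

(** * The averaged algorithm *)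

Section Averaging.
Variables (R : realType) (n : nat) (H : 'M[R]_n) (Jstar : R) (thstar : 'cV[R]_n).
Variables (h0 : R) (h1 : 'cV[R]_n) (wf k c a delta : R) (om : 'I_n -> R).
Hypothesis Hsym : H^T = H.
Hypotheses (a0 : 0 < a) (delta0 : 0 < delta).
Hypothesis om_pos : forall i, 0 < om i.
Hypothesis om_inj : forall i j, i != j -> om i != om j.
Notation V := 'cV[R]_(n + (n + (1 + (n + (1 + 1))))).
Notation J := (objective H Jstar thstar).
Notation h := (constraint h0 h1 thstar).

(** Products of two distinct sines and of three sines average to 0, squares of
    sines to 1/2: the demodulated cost becomes its gradient, the cost picks up
    a^2 Tr(H) / 4, and the demodulated constraint becomes h1. *)
Definition avg_field (x : state R n) : state R n :=
  let: State th GJ etaJ Gh etah gam := x in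
  State
    (- (k *: GJ) + (gam * maxd delta (k * dotv GJ Gh - c * etah)) *: Gh)
    (- (wf *: GJ) + wf *: (H *m (th - thstar)))
    (- (wf * etaJ) + wf * (J th + a ^+ 2 / 4 * \tr H))
    (- (wf *: Gh) + wf *: h1)
    (- (wf * etah) + wf * h th)
    (wf * gam * (1 - gam * enorm Gh ^+ 2)).

(** The field as a function of the phase tau = w t, so that its frequencies do
    not depend on w. *)
Definition fast_field (tau : R) (v : V) : V :=
  stack (asfes_field J h wf k c a delta om tau (unstack v)).

Definition slow_field (v : V) : V := stack (avg_field (unstack v)).

Lemma slow_lip i : lip_on_balls (fun v => slow_field v i 0).
Proof.
have [sth sG sJ [sg seta sgam]] := tame_unstack R n.
have sub_th l : tame (fun v : V => (st_theta (unstack v) - thstar) l 0).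
  have -> : (fun v : V => (st_theta (unstack v) - thstar) l 0) =
      fun v => st_theta (unstack v) l 0 + - thstar l 0.
    by apply/funext => v; rewrite !mxE.
  by apply: tame_add => //; exact: tame_cst.
rewrite /slow_field.
apply: (stack_ind (Q := fun pr => lip_on_balls (fun v => pr (avg_field (unstack v))))) => {i}.
- move=> i.
  have -> : (fun v : V => st_theta (avg_field (unstack v)) i 0) = fun v =>
    - k * st_GJ (unstack v) i 0 + (st_gamma (unstack v) *
      maxd delta (k * dotv (st_GJ (unstack v)) (st_Gh (unstack v)) + - c * st_etah (unstack v)))
      * st_Gh (unstack v) i 0.
    by apply/funext => v; rewrite /= !mxE mulNr mulNr.
  apply: lip_add; first by apply: lip_mul; [exact: lip_cst|exact: tame_lip].
  apply: lip_mul; last exact: tame_lip.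
  apply: lip_mul; first exact: tame_lip.
  have sm : tame (fun v : V => k * dotv (st_GJ (unstack v)) (st_Gh (unstack v)) +
      - c * st_etah (unstack v)).
    apply: tame_add; apply: tame_mul => //; try exact: tame_cst.
    exact: tame_dotv.
  move=> r; have [L [L0 hL]] := tame_lip sm r; exists L; split=> // x y xr yr.
  by apply: le_trans (maxd_lip _ _ delta0) (hL x y xr yr).
- move=> i.
  have -> : (fun v : V => st_GJ (avg_field (unstack v)) i 0) = fun v =>
    - wf * st_GJ (unstack v) i 0 + wf * (H *m (st_theta (unstack v) - thstar)) i 0.
    by apply/funext => v; rewrite /= !mxE mulNr.
  apply: tame_lip; apply: tame_add; apply: tame_mul => //; try exact: tame_cst.
  exact: tame_mulmx.
- have -> : (fun v : V => st_etaJ (avg_field (unstack v))) = fun v =>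
    - wf * st_etaJ (unstack v) + wf * (Jstar + 2^-1 * dotv (st_theta (unstack v) - thstar)
        (H *m (st_theta (unstack v) - thstar)) + a ^+ 2 / 4 * \tr H).
    by apply/funext => v; rewrite /= mulNr.
  apply: tame_lip; apply: tame_add; apply: tame_mul => //; try exact: tame_cst.
  apply: tame_add; last exact: tame_cst.
  apply: tame_add; first exact: tame_cst.
  apply: tame_mul; first exact: tame_cst.
  by apply: tame_dotv => // l; exact: tame_mulmx.
- move=> i.
  have -> : (fun v : V => st_Gh (avg_field (unstack v)) i 0) = fun v =>
    - wf * st_Gh (unstack v) i 0 + wf * h1 i 0.
    by apply/funext => v; rewrite /= !mxE mulNr.
  apply: tame_lip; apply: tame_add; last exact: tame_cst.
  by apply: tame_mul => //; exact: tame_cst.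
- have -> : (fun v : V => st_etah (avg_field (unstack v))) = fun v =>
    - wf * st_etah (unstack v) + wf * (h0 + dotv h1 (st_theta (unstack v) - thstar)).
    by apply/funext => v; rewrite /= mulNr.
  apply: tame_lip; apply: tame_add; apply: tame_mul => //; try exact: tame_cst.
  apply: tame_add; first exact: tame_cst.
  by apply: tame_dotv => // l; exact: tame_cst.
- have -> : (fun v : V => st_gamma (avg_field (unstack v))) = fun v =>
    wf * st_gamma (unstack v) * (1 + -1 * (st_gamma (unstack v) *
       dotv (st_Gh (unstack v)) (st_Gh (unstack v)))).
    by apply/funext => v; rewrite /= enorm_sq mulN1r.
  apply: tame_lip; apply: tame_mul.
    by apply: tame_mul => //; exact: tame_cst.
  apply: tame_add; first exact: tame_cst.
  apply: tame_mul; first exact: tame_cst.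
  by apply: tame_mul => //; exact: tame_dotv.
Qed.

Notation sg i tau := (sin (om i * tau)).

Lemma dither_dotv tau (w : 'cV[R]_n) :
  dotv (dither a om tau) w = a * \sum_j sg j tau * w j 0.
Proof. by rewrite dotvE mulr_sumr; apply: eq_bigr => j _; rewrite mxE mulrA. Qed.

Lemma dither_form tau : dotv (dither a om tau) (H *m dither a om tau) =
  a ^+ 2 * \sum_j \sum_l sg j tau * sg l tau * H j l.
Proof.
rewrite dither_dotv expr2 -mulrA; congr (_ * _); rewrite mulr_sumr.
apply: eq_bigr => j _; rewrite !mxE !mulr_sumr; apply: eq_bigr => l _.
by rewrite mxE; ring.
Qed.

Lemma objective_dither tau th : J (th + dither a om tau) =
  J th + a * (\sum_j sg j tau * (H *m (th - thstar)) j 0)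
  + a ^+ 2 / 2 * \sum_j \sum_l sg j tau * sg l tau * H j l.
Proof.
rewrite /objective (addrAC th); move: (th - thstar) => e.
rewrite mulmxDr !(dotvDl, dotvDr).
rewrite [dotv e (H *m dither _ _ _)]dotv_mulmx Hsym [dotv (H *m e) _]dotvC.
rewrite dither_form dither_dotv.
by field.
Qed.

Lemma constraint_dither tau th : h (th + dither a om tau) =
  h th + a * \sum_j sg j tau * h1 j 0.
Proof.
rewrite /constraint (addrAC th); move: (th - thstar) => e; rewrite dotvDr [dotv h1 (dither _ _ _)]dotvC dither_dotv.
by rewrite addrA.
Qed.

Definition kron (i j : 'I_n) : R := (i == j)%:R.

Lemma zero_mean_pair i j : zero_mean (fun tau => sg i tau * sg j tau - 2^-1 * kron i j).
Proof.
rewrite /kron; have [->|ij] := eqVneq i j.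
  by apply: (zero_mean_ext _ (zero_mean_sinsq (om_pos j))) => t; rewrite mulr1.
apply: (zero_mean_ext _ (zero_mean_sin2 (om_pos i) (om_pos j) (om_inj ij))) => t.
by rewrite mulr0 subr0.
Qed.

Lemma sum_kron i (w : 'I_n -> R) : \sum_j kron i j * w j = w i.
Proof.
rewrite (bigD1 i)//= big1 ?addr0 ?/kron ?eqxx ?mul1r// => j ji.
by rewrite /kron eq_sym (negbTE ji) mul0r.
Qed.

Lemma sum_kron_tr (A : 'M[R]_n) : \sum_j \sum_l kron j l * A j l = \tr A.
Proof. by rewrite /mxtrace; apply: eq_bigr => j _; rewrite sum_kron. Qed.

(** Expanding the quadratic cost at the dithered point gives sines of degree at
    most two, hence three after demodulation.  Subtracting the means turns the
    coefficient of each product into a zero-mean function. *)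
Lemma fast_sub_slow_oscillating i : oscillating (fun tau v => fast_field tau v i 0 - slow_field v i 0).
Proof.
have [sth sG sJ [sg' seta sgam]] := tame_unstack R n.
have sub_th l : tame (fun v : V => (st_theta (unstack v) - thstar) l 0).
  have -> : (fun v : V => (st_theta (unstack v) - thstar) l 0) =
      fun v => st_theta (unstack v) l 0 + - thstar l 0.
    by apply/funext => v; rewrite !mxE.
  by apply: tame_add => //; exact: tame_cst.
have sw l : tame (fun v : V => (H *m (st_theta (unstack v) - thstar)) l 0) by exact: tame_mulmx.
have sJ0 : tame (fun v : V => J (st_theta (unstack v))).
  apply: tame_add; first exact: tame_cst.
  by apply: tame_mul; [exact: tame_cst|exact: tame_dotv].
have sh0 : tame (fun v : V => h (st_theta (unstack v))).
  apply: tame_add; first exact: tame_cst.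
  by apply: tame_dotv => // l; exact: tame_cst.
have cst_mul x (g : V -> R) : tame g -> tame (fun v => x * g v).
  by move=> hg; apply: tame_mul => //; exact: tame_cst.
have sub_mul (f g : V -> R) : tame f -> tame g -> tame (fun v => f v + -1 * g v).
  by move=> hf hg; apply: tame_add => //; exact: cst_mul.
have ext (e1 e2 : R -> V -> R) : (forall t v, e1 t v = e2 t v) -> oscillating e1 -> oscillating e2.
  by move=> E; have -> : e1 = e2 by apply/funext => t; apply/funext => v.
have aN0 : a != 0 by rewrite gt_eqF.
rewrite /fast_field /slow_field.
apply: (stack_ind (Q := fun pr => oscillating (fun tau v =>
  pr (asfes_field J h wf k c a delta om tau (unstack v)) - pr (avg_field (unstack v))))) => {i}.
- by move=> i; apply: (ext _ _ _ (oscillating0 R _)) => t v /=; rewrite subrr.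
- move=> i.
  apply: (ext (fun t v =>
      sg i t * (wf * (2 / a) * (J (st_theta (unstack v)) + -1 * st_etaJ (unstack v))) +
      (\sum_j (sg i t * sg j t - 2^-1 * kron i j) *
         (2 * wf * (H *m (st_theta (unstack v) - thstar)) j 0) +
       \sum_j \sum_l sg i t * sg j t * sg l t * (wf * a * H j l)))); last first.
    apply: osc_add; last apply: osc_add.
    + apply: osc_term; first exact: zero_mean_sin.
      by apply: cst_mul; exact: sub_mul.
    + apply: oscillating_sum => j; apply: osc_term; first exact: zero_mean_pair.
      exact: cst_mul.
    + apply: oscillating_sum => j; apply: oscillating_sum => l; apply: osc_term.
        exact: zero_mean_sin3.
      exact: tame_cst.
  move=> t v; rewrite /= objective_dither.
  set w := H *m _; set J0 := J _; set eJ := _ 0 0; set G := usubmx (dsubmx v).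
  clearbody w J0 eJ G; rewrite !mxE.
  have -> : \sum_j (sg i t * sg j t - 2^-1 * kron i j) * (2 * wf * w j 0) =
      2 * wf * sg i t * (\sum_j sg j t * w j 0) - wf * w i 0.
    transitivity (\sum_j (2 * wf * sg i t * (sg j t * w j 0) - wf * (kron i j * w j 0))).
      by apply: eq_bigr => j _; field.
    by rewrite sumrB -!mulr_sumr sum_kron.
  have -> : \sum_j \sum_l sg i t * sg j t * sg l t * (wf * a * H j l) =
      wf * a * sg i t * \sum_j \sum_l sg j t * sg l t * H j l.
    rewrite mulr_sumr; apply: eq_bigr => j _; rewrite mulr_sumr; apply: eq_bigr => l _.
    by ring.
  by field.
- apply: (ext (fun t v =>
      \sum_j sg j t * (wf * a * (H *m (st_theta (unstack v) - thstar)) j 0) +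
      \sum_j \sum_l (sg j t * sg l t - 2^-1 * kron j l) * (wf * a ^+ 2 / 2 * H j l))); last first.
    apply: osc_add.
    + apply: oscillating_sum => j; apply: osc_term; first exact: zero_mean_sin.
      exact: cst_mul.
    + apply: oscillating_sum => j; apply: oscillating_sum => l; apply: osc_term.
        exact: zero_mean_pair.
      exact: tame_cst.
  move=> t v; rewrite /= objective_dither; set w := H *m _.
  have -> : \sum_j sg j t * (wf * a * w j 0) = wf * a * \sum_j sg j t * w j 0.
    by rewrite mulr_sumr; apply: eq_bigr => j _; rewrite mulrCA.
  have -> : \sum_j \sum_l (sg j t * sg l t - 2^-1 * kron j l) * (wf * a ^+ 2 / 2 * H j l) =
     wf * a ^+ 2 / 2 * (\sum_j \sum_l sg j t * sg l t * H j l) - wf * a ^+ 2 / 4 * \tr H.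
    rewrite -sum_kron_tr !mulr_sumr -sumrB; apply: eq_bigr => j _.
    rewrite !mulr_sumr -sumrB; apply: eq_bigr => l _; by field.
  by field.
- move=> i.
  apply: (ext (fun t v =>
      sg i t * (wf * (2 / a) * (h (st_theta (unstack v)) + -1 * st_etah (unstack v))) +
      \sum_j (sg i t * sg j t - 2^-1 * kron i j) * (2 * wf * h1 j 0))); last first.
    apply: osc_add.
    + apply: osc_term; first exact: zero_mean_sin.
      by apply: cst_mul; exact: sub_mul.
    + apply: oscillating_sum => j; apply: osc_term; first exact: zero_mean_pair.
      exact: tame_cst.
  move=> t v; rewrite /= constraint_dither.
  set h2 := h _; set eh := _ 0 0; set G := usubmx _.
  clearbody h2 eh G; rewrite !mxE.
  have -> : \sum_j (sg i t * sg j t - 2^-1 * kron i j) * (2 * wf * h1 j 0) =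
      2 * wf * sg i t * (\sum_j sg j t * h1 j 0) - wf * h1 i 0.
    transitivity (\sum_j (2 * wf * sg i t * (sg j t * h1 j 0) - wf * (kron i j * h1 j 0))).
      by apply: eq_bigr => j _; field.
    by rewrite sumrB -!mulr_sumr sum_kron.
  by field.
- apply: (ext (fun t v => \sum_j sg j t * (wf * a * h1 j 0))); last first.
    apply: oscillating_sum => j; apply: osc_term; first exact: zero_mean_sin.
    exact: tame_cst.
  move=> t v; rewrite /= constraint_dither.
  have -> : \sum_j sg j t * (wf * a * h1 j 0) = wf * a * \sum_j sg j t * h1 j 0.
    by rewrite mulr_sumr; apply: eq_bigr => j _; rewrite mulrCA.
  by ring.
- by apply: (ext _ _ _ (oscillating0 R _)) => t v /=; rewrite subrr.
Qed.

End Averaging.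

(** * The equilibrium *)

Section LocalStability.
Variables (R : realType) (n : nat) (H : 'M[R]_n) (Jstar : R) (thstar : 'cV[R]_n).
Variables (h0 : R) (h1 : 'cV[R]_n) (wf k c a delta : R) (om : 'I_n -> R).
Hypothesis Hsym : H^T = H.
Hypothesis Hpos : posdef H.
Hypothesis h1N0 : h1 != 0.
Hypotheses (wf0 : 0 < wf) (k0 : 0 < k) (c0 : 0 < c) (a0 : 0 < a) (delta0 : 0 < delta).
Hypothesis om_pos : forall i, 0 < om i.
Hypothesis om_inj : forall i j, i != j -> om i != om j.
Notation V := 'cV[R]_(n + (n + (1 + (n + (1 + 1))))).
Notation J := (objective H Jstar thstar).
Notation h := (constraint h0 h1 thstar).
Notation Hi := (invmx H).

Lemma stack_congr (th th' G G' g g' : 'cV[R]_n) (eJ eJ' eh eh' gam gam' : R) :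
  th = th' -> G = G' -> eJ = eJ' -> g = g' -> eh = eh' -> gam = gam' ->
  stack (State th G eJ g eh gam) = stack (State th' G' eJ' g' eh' gam').
Proof. by move=> -> -> -> -> -> ->. Qed.

Definition qh := dotv h1 (Hi *m h1).
Definition bh := dotv h1 h1.
Definition dh := c / (k * bh) * qh.
Definition root_s := Num.sqrt (h0 ^+ 2 + delta * dh / c ^+ 2).
Definition GJe := ((- h0 + root_s) / (2 * qh)) *: h1.
Definition thetae := Hi *m GJe.
Definition etahe := (h0 + root_s) / 2.
Definition etaJe := Jstar + a ^+ 2 / 4 * \tr H + (- h0 + root_s) ^+ 2 / (8 * qh).

Lemma H_unit : H \in unitmx. Proof. exact: posdef_unit. Qed.

Lemma bh_gt0 : 0 < bh.
Proof. by apply: lt_le_trans (dotv_ge_normsq h1); rewrite exprn_gt0// normr_gt0. Qed.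

Lemma qh_gt0 : 0 < qh.
Proof.
have zN0 : Hi *m h1 != 0.
  apply/eqP => z0; move: h1N0; rewrite -[h1](mulKVmx H_unit) z0 mulmx0 eqxx.
  by [].
have := Hpos zN0; rewrite (mulKVmx H_unit) dotvC.
by rewrite /qh.
Qed.

Lemma dh_gt0 : 0 < dh.
Proof. by rewrite mulr_gt0 ?qh_gt0// divr_gt0// mulr_gt0// bh_gt0. Qed.

Lemma root_s2 : root_s ^+ 2 = h0 ^+ 2 + delta * dh / c ^+ 2.
Proof.
by rewrite sqr_sqrtr// addr_ge0 ?sqr_ge0// divr_ge0 ?sqr_ge0// mulr_ge0 ?(ltW delta0) ?(ltW dh_gt0).
Qed.

Lemma root_s_gt : `|h0| < root_s.
Proof.
rewrite -ltr_sqr ?nnegrE ?sqrtr_ge0// root_s2 -normrX ger0_norm ?sqr_ge0// ltrDl.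
by rewrite divr_gt0 ?exprn_gt0// mulr_gt0// dh_gt0.
Qed.

Lemma thetae_H : H *m thetae = GJe.
Proof. by rewrite /thetae mulKVmx// H_unit. Qed.

Lemma dotv_thetae_GJe : dotv thetae GJe = (- h0 + root_s) ^+ 2 / (4 * qh).
Proof.
rewrite /thetae /GJe -scalemxAr dotvZl dotvZr dotvC -/qh.
by field; rewrite gt_eqF// qh_gt0.
Qed.

Lemma constraint_thetae : h0 + dotv h1 thetae = etahe.
Proof.
rewrite /thetae /GJe -scalemxAr dotvZr -/qh /etahe.
by field; rewrite gt_eqF// qh_gt0.
Qed.

Definition me := k * bh * (- h0 + root_s) / (2 * qh).
Definition xae := k * dotv GJe h1 - c * etahe.

(** The positive root m of m (m - x) = delta / 4 is the smoothed maximum of x.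
    Here me (me - xae) = me c etahe is a multiple of root_s^2 - h0^2, and dh is
    the factor for which it equals delta / 4. *)
Lemma maxd_xae : maxd delta xae = me.
Proof.
have q0 := qh_gt0; have b0 := bh_gt0.
have := root_s_gt; rewrite ltr_norml => /andP [s1 s2].
have mx : me - xae = c * etahe.
  by rewrite /me /xae /GJe dotvZl -/bh; field; rewrite gt_eqF.
have m0 : 0 < me by rewrite divr_gt0 ?mulr_gt0//; lra.
have e0 : 0 < etahe by rewrite divr_gt0//; lra.
have key : xae ^+ 2 + delta = (2 * me - xae) ^+ 2.
  have -> : (2 * me - xae) ^+ 2 = xae ^+ 2 + 4 * (me * (me - xae)) by ring.
  congr (_ + _); rewrite mx /me /etahe.
  have -> : 4 * (k * bh * (- h0 + root_s) / (2 * qh) * (c * ((h0 + root_s) / 2))) =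
    k * bh * c / qh * (root_s ^+ 2 - h0 ^+ 2) by field; rewrite gt_eqF.
  rewrite root_s2 /dh; field.
  by rewrite !gt_eqF.
rewrite /maxd key sqrtr_sqr ger0_norm; first by field.
have := mulr_gt0 c0 e0; rewrite -mx; lra.
Qed.

Lemma GJe_balance : k *: GJe = (bh^-1 * me) *: h1.
Proof.
rewrite /GJe scalerA; congr (_ *: _); rewrite /me.
by field; rewrite !gt_eqF ?bh_gt0 ?qh_gt0.
Qed.

Definition eq_state : state R n := State (thstar + thetae) GJe etaJe h1 etahe bh^-1.

(** The constants cancel by the equilibrium equations thetae_H,
    dotv_thetae_GJe and constraint_thetae. *)
Lemma slow_errfield (e : V) : slow_field H Jstar thstar h0 h1 wf k c a delta (stack eq_state + e) =
  stack (errfield H h1 k c wf bh^-1 GJe etahe (maxd delta) (unstack e)).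
Proof.
have gN0 : bh^-1 != 0 by rewrite invr_eq0 gt_eqF// bh_gt0.
rewrite /slow_field -[stack eq_state]scale1r unstack_lin stackK /eq_state.
case: (unstack e) => th G eJ g eh gam /=; rewrite !scale1r !mul1r.
have -> : thstar + thetae + th - thstar = thetae + th by rewrite -(addrA thstar) [LHS]addrC addKr.
apply: stack_congr.
- by [].
- by rewrite mulmxDr thetae_H !scalerDr opprD addrACA addNr add0r.
- rewrite /objective.
  have -> : thstar + thetae + th - thstar = thetae + th by rewrite -(addrA thstar) [LHS]addrC addKr.
  rewrite mulmxDr thetae_H !(dotvDl, dotvDr) [dotv thetae (H *m th)]dotv_mulmx Hsym thetae_H.
  rewrite dotv_thetae_GJe (dotvC th GJe) /etaJe.
  by field; rewrite gt_eqF// qh_gt0.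
- by rewrite scalerDr opprD addrAC addNr add0r.
- rewrite /constraint.
  have -> : thstar + thetae + th - thstar = thetae + th by rewrite -(addrA thstar) [LHS]addrC addKr.
  by rewrite dotvDr addrA constraint_thetae; ring.
- by rewrite enorm_sq.
Qed.

Lemma coordsq_le_norm (u : 'cV[R]_n) i : u i 0 ^+ 2 <= `|u| ^+ 2.
Proof. by rewrite -[leLHS]real_normK ?num_real// ler_sqr ?nnegrE// coord_le_norm. Qed.

Lemma norm_le_sq_sum (e : V) : `|e| ^+ 2 <= sq_sum (unstack e).
Proof.
have s0 : 0 <= sq_sum (unstack e) by rewrite /= !addr_ge0// sqr_ge0.
rewrite -[sq_sum _]sqr_sqrtr// ler_sqr ?nnegrE ?sqrtr_ge0//.
apply: norm_le_coord; first exact: sqrtr_ge0.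
move=> i j; rewrite ord1 -ler_sqr ?nnegrE ?sqrtr_ge0// sqr_sqrtr// real_normK ?num_real//.
have := @stack_ind _ _ (fun pr => pr (unstack e) ^+ 2 <= sq_sum (unstack e)) _ _ _ _ _ _ i.
rewrite unstackK; apply.
all: case: (unstack e) => th G eJ g eh gam /=.
all: have := sqr_ge0 `|th|; have := sqr_ge0 `|G|; have := sqr_ge0 `|g|.
all: have := sqr_ge0 eJ; have := sqr_ge0 eh; have := sqr_ge0 gam.
all: try lra.
- by move=> ? ? ? ? ? ? l; have := coordsq_le_norm th l; lra.
- by move=> ? ? ? ? ? ? l; have := coordsq_le_norm G l; lra.
- by move=> ? ? ? ? ? ? l; have := coordsq_le_norm g l; lra.
Qed.

Lemma unstack_in_box (e : V) : in_box (unstack e) `|e|.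
Proof.
rewrite /unstack /=; split; last split.
all: try (rewrite !mxE; exact: coord_le_norm).
all: by apply: norm_le_coord => // i j; rewrite !mxE; exact: coord_le_norm.
Qed.

(** The Lyapunov form decreases up to a cubic term, which the quadratic decay
    absorbs in the ball of radius r0. *)
Theorem local_stability (eps : R) : 0 < eps -> exists rho ws : R,
  [/\ 0 < rho, 0 < ws & forall w, ws <= w -> forall x0 : V, `|x0 - stack eq_state| < rho ->
  let F := fun t => fast_field H Jstar thstar h0 h1 wf k c a delta om (w * t) in
  (exists x : R -> V, [/\ x 0 = x0, continuous x &
    forall t : R, 0 < t -> is_derive t 1 x (F t (x t))]) /\
  forall x : R -> V, x 0 = x0 -> {within `[0, +oo[, continuous x} ->
    (forall t : R, 0 < t -> is_derive t 1 x (F t (x t))) ->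
    forall t, 0 <= t -> `|x t - stack eq_state| < eps].
Proof.
have [al [al0 Hal]] := posdef_coercive Hpos.
have [p [Cm [p0 p1 Cm0 mT]]] := maxd_taylor xae delta0.
have g0 : 0 < bh^-1 by rewrite invr_gt0 bh_gt0.
have gb : bh^-1 * dotv h1 h1 = 1 by rewrite mulVf// gt_eqF// bh_gt0.
have := GJe_balance; rewrite -maxd_xae => bal.
have [ep [ep2 [L1 [L2 [al' [mu [C [al'0 mu0 C0 Vpos Vdec]]]]]]]] :=
  lyap_decay Hsym k0 c0 wf0 p0 p1 g0 gb Cm0 (erefl xae) mT bal al0 Hal.
have [P [Psym PE]] : exists P : 'M[R]__, P^T = P /\ forall x y : V, dotv x (P *m y) =
    lyap_form H h1 k c wf p bh^-1 ep ep2 L1 L2 (unstack x) (unstack y).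
  apply: form_matrix => [x b y z|x y]; last exact: lyapC.
  rewrite unstack_lin; case: (unstack x) => th G eJ g eh gam.
  case: (unstack y) => th1 G1 eJ1 g1 eh1 gam1; case: (unstack z) => th2 G2 eJ2 g2 eh2 gam2 /=.
  rewrite driftD !form_uDr form_thDr (form_uC _ _ _ (b *: th1 + th2)) form_uDr.
  rewrite (form_uC _ _ _ th1) (form_uC _ _ _ th2).
  by rewrite !(dotvDr, dotvZr); ring.
(* In this ball the cubic term is at most half of the quadratic one. *)
pose r0 := Num.min 1 (mu / (2 * (C + 1))).
have C1 : 0 < C + 1 by rewrite ltr_wpDl.
have r00 : 0 < r0 by rewrite lt_min ltr01 divr_gt0// mulr_gt0.
apply: (@practical_stability _ _ _ (slow_field H Jstar thstar h0 h1 wf k c a delta)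
  (stack eq_state) P r0 al' (mu / 2)) => //.
- by move=> i; exact: slow_lip.
- by move=> i; exact: fast_sub_slow_oscillating.
- by rewrite divr_gt0.
- move=> e; rewrite PE; apply: le_trans (Vpos _).
  by rewrite ler_wpM2l ?(ltW al'0)//; exact: norm_le_sq_sum.
- move=> e er; have e1 := norm_le_sq_sum e; have e2 := unstack_in_box e.
  have er1 : `|e| <= 1 by apply: le_trans er _; rewrite ge_min lexx.
  have er2 : `|e| * (2 * (C + 1)) <= mu.
    by rewrite -ler_pdivlMr ?mulr_gt0//; apply: le_trans er _; rewrite ge_min lexx orbT.
  rewrite slow_errfield PE stackK; apply: le_trans (Vdec _ _ er1 e2) _.
  have h1' : mu * `|e| ^+ 2 <= mu * sq_sum (unstack e) by rewrite ler_pM2l.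
  have h2' : `|e| * (2 * (C + 1)) * `|e| ^+ 2 <= mu * `|e| ^+ 2.
    by rewrite ler_wpM2r// sqr_ge0.
  have h3' : 0 <= `|e| ^+ 3 by rewrite exprn_ge0.
  move: h1' h2' h3'; rewrite [_ ^+ 3]exprS; lra.
Qed.

End LocalStability.

(** * The constrained minimum and the cost near the equilibrium *)

Section Final.
Variable R : realType.

(** A bound valid at all nonnegative times passes to the upper limit at infinity;
    in particular the upper limit is finite. *)
Lemma limf_esup_near (g : R -> R) (l B : R) :
  (forall t, 0 <= t -> `|g t - l| <= B) ->
  (`| limf_esup (fun t => (g t)%:E) (pinfty_nbhs R) - l%:E | <= B%:E)%E.
Proof.
move=> hg.
set L := limf_esup _ _.
have up : (L <= (l + B)%:E)%E.
  rewrite /L limf_esupE.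
  apply: (@le_trans _ _ (ereal_sup ((fun t => (g t)%:E) @` [set t | 0 < t]))).
    apply: ereal_inf_lbound; exists [set t | 0 < t] => //.
    by exists 0; split=> //; exact: real0.
  apply: ge_ereal_sup => _ [t /= t0 <-]; rewrite lee_fin.
  by have := hg t (ltW t0); rewrite ler_norml => /andP [_]; rewrite lerBlDl.
have lo : ((l - B)%:E <= L)%E.
  rewrite /L limf_esupE; apply: le_ereal_inf_tmp => _ [A [M [_ MA]] <-].
  pose t := Num.max M 0 + 1.
  have At : A t by apply: MA; rewrite /t ltr_pwDr// le_max lexx.
  apply: (@le_trans _ _ (g t)%:E).
    have t0 : 0 <= t by rewrite /t addr_ge0// le_max lexx orbT.
    rewrite lee_fin; have := hg t t0; rewrite ler_norml => /andP [h _].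
    by move: h; rewrite lerBrDl.
  by apply: ereal_sup_ubound; exists t.
case: L up lo => [x| |]; rewrite ?lee_fin ?leye_eq ?leeNy_eq// => h1 h2.
by rewrite ler_norml; apply/andP; split; lra.
Qed.

(** The minimizer moves from the unconstrained one along H^-1 h1, by the least
    amount that restores h >= 0.  Expanding the nonnegative form of H at the
    difference between an arbitrary point and the minimizer gives the lower
    bound. *)
Lemma is_minimum_halfspace n (H : 'M[R]_n) (Jstar h0 : R) (thstar h1 : 'cV[R]_n) :
  H^T = H -> posdef H -> h1 != 0 ->
  is_minimum (objective H Jstar thstar) (safe_set (constraint h0 h1 thstar))
    (Jstar + Num.max 0 (- h0) ^+ 2 / (2 * qh H h1)).
Proof.
move=> Hsym Hpos h1N0; have q0 := qh_gt0 Hpos h1N0; have Hu := H_unit Hpos.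
set t := Num.max 0 (- h0); set q := qh H h1 in q0 *.
have t0 : 0 <= t by rewrite le_max lexx.
have th0 : - h0 <= t by rewrite le_max lexx orbT.
have Hh u : H *m (invmx H *m u) = u by rewrite mulKVmx.
split.
  exists (thstar + (t / q) *: (invmx H *m h1)); rewrite /safe_set /constraint /objective /=.
    rewrite addrAC subrr add0r dotvZr -/(qh H h1) -/q divfK ?gt_eqF//; lra.
  rewrite addrAC subrr add0r -scalemxAr Hh dotvZl dotvZr dotvC -/(qh H h1) -/q.
  by field; rewrite gt_eqF.
move=> _ [th hth <-]; rewrite /objective lerD2l; move: hth.
rewrite /safe_set /constraint /=; move: (th - thstar) => e he.
have : 0 <= dotv (e - (t / q) *: (invmx H *m h1)) (H *m (e - (t / q) *: (invmx H *m h1))).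
  have [->|/Hpos /ltW//] := eqVneq (e - (t / q) *: (invmx H *m h1)) 0.
  by rewrite mulmx0 dotv0r.
rewrite mulmxBr -scalemxAr Hh !(dotvDl, dotvDr, dotvNl, dotvNr, dotvZl, dotvZr).
rewrite [dotv (invmx H *m h1) (H *m e)]dotv_mulmx Hsym Hh.
rewrite (dotvC e h1) [dotv (invmx H *m h1) h1]dotvC -/(qh H h1) -/q.
have -> : t / q * (t / q * q) = t ^+ 2 / q by field; rewrite gt_eqF.
have tt : t / q * t <= t / q * dotv h1 e.
  have [->|tN0] := eqVneq t 0; first by rewrite !mul0r.
  rewrite ler_wpM2l ?divr_ge0 ?(ltW q0)//.
  have : t = - h0 by move: tN0; rewrite /t; case: (leP 0 (- h0)) => //; rewrite eqxx.
  lra.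
have e1 : t / q * t = t ^+ 2 / q by rewrite expr2 mulrAC.
have -> : t ^+ 2 / (2 * q) = 2^-1 * (t ^+ 2 / q) by field; rewrite gt_eqF.
move: tt; rewrite e1 => tt h; rewrite ler_pM2l ?invr_gt0//; move: h tt; lra.
Qed.

(** The difference is the product of s - |h0| with a factor of size at most
    3 (s + |h0|), and (s - |h0|) (s + |h0|) = D. *)
Lemma equilibrium_gap (h0 s D : R) : `|h0| <= s -> s ^+ 2 = h0 ^+ 2 + D ->
  `|(- h0 + s) ^+ 2 - 4 * Num.max 0 (- h0) ^+ 2| <= 3 * D.
Proof.
move=> hs s2.
have sm : (s - `|h0|) * (s + `|h0|) = D.
  have -> : (s - `|h0|) * (s + `|h0|) = s ^+ 2 - `|h0| ^+ 2 by ring.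
  by rewrite s2 real_normK ?num_real//; ring.
have sp : 0 <= s - `|h0| by rewrite subr_ge0.
case: (leP 0 (- h0)) => hh.
  have e0 : `|h0| = - h0 by rewrite ler0_norm// -oppr_ge0.
  rewrite e0 in sm sp.
  have -> : (- h0 + s) ^+ 2 - 4 * (- h0) ^+ 2 = (s - - h0) * (s + 3 * - h0) by ring.
  rewrite ger0_norm; last by rewrite mulr_ge0//; lra.
  have -> : 3 * D = (s - - h0) * (3 * (s + - h0)) by rewrite -sm; ring.
  by rewrite ler_wpM2l//; lra.
have e0 : `|h0| = h0 by rewrite gtr0_norm// -oppr_lt0.
rewrite e0 in sm sp.
rewrite expr0n mulr0 subr0 ger0_norm ?sqr_ge0//.
have -> : (- h0 + s) ^+ 2 = (s - h0) * (s - h0) by ring.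
have sh : 0 <= s + h0 by move: sp hh; lra.
have D0 : 0 <= D by rewrite -sm mulr_ge0.
apply: (@le_trans _ _ ((s - h0) * (s + h0))); last by rewrite sm; lra.
by rewrite ler_wpM2l//; lra.
Qed.

Lemma equilibrium_size (h0 s D : R) : 0 <= s -> s ^+ 2 = h0 ^+ 2 + D ->
  `|- h0 + s| <= `|h0| + (1 + h0 ^+ 2 + D).
Proof.
move=> s0 s2; apply: le_trans (ler_normD _ _) _; rewrite normrN lerD2l ger0_norm//.
by have := sqr_ge0 (s - 1); have := sqr_ge0 s; rewrite sqrrB1 s2; move: s0; lra.
Qed.

(** The cost at the equilibrium is Jstar + (s - h0)^2 / (8 q), with s the
    regularized |h0|, so equilibrium_gap bounds its distance to the minimum by
    a multiple of delta; moving by 2 a changes the cost by O(a), since a and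
    the position of the equilibrium are bounded. *)
Lemma cost_near_equilibrium n (H : 'M[R]_n) (Jstar h0 k c : R) (thstar h1 : 'cV[R]_n) :
  H^T = H -> posdef H -> h1 != 0 -> 0 < k -> 0 < c ->
  forall a0 delta0 : R, 0 < a0 -> 0 < delta0 -> exists K, 0 < K /\
  forall a delta : R, 0 < a <= a0 -> 0 < delta <= delta0 -> forall th,
    `|th - (thstar + thetae H h0 h1 k c delta)| <= 2 * a ->
  `|objective H Jstar thstar th - (Jstar + Num.max 0 (- h0) ^+ 2 / (2 * qh H h1))|
   <= K * (a + delta).
Proof.
move=> Hsym Hpos h1N0 k0 c0 a0 delta0 a00 delta00.
have q0 := qh_gt0 Hpos h1N0; have d0 := dh_gt0 Hpos h1N0 k0 c0.
have [C [C0 hC]] := form_bound H.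
have [D [D0 DE]] : exists D, 0 < D /\ D = dh H h1 k c / c ^+ 2.
  by exists (dh H h1 k c / c ^+ 2); rewrite divr_gt0 ?exprn_gt0.
have qV0 : 0 <= (2 * qh H h1)^-1 by rewrite invr_ge0 mulr_ge0// ltW.
have qV8 : 0 <= (8 * qh H h1)^-1 by rewrite invr_ge0 mulr_ge0// ltW.
have [S [S0 SE]] : exists S, 0 <= S /\ S = `|h0| + (1 + h0 ^+ 2 + delta0 * D).
  exists (`|h0| + (1 + h0 ^+ 2 + delta0 * D)); split=> //.
  by rewrite !addr_ge0 ?sqr_ge0// mulr_ge0 ?(ltW D0)// ltW.
have [T [T0 TE]] : exists T, 0 <= T /\ T = S / (2 * qh H h1) * `|invmx H *m h1|.
  exists (S / (2 * qh H h1) * `|invmx H *m h1|); split=> //.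
  by rewrite mulr_ge0// mulr_ge0.
have [X [X0 XE]] : exists X, 0 <= X /\ X = 2 * C * T.
  by exists (2 * C * T); rewrite mulr_ge0// mulr_ge0// ltW.
have [Y [Y0 YE]] : exists Y, 0 <= Y /\ Y = 2 * C * a0.
  by exists (2 * C * a0); rewrite mulr_ge0 ?(ltW a00)// mulr_ge0// ltW.
have [Z [Z0 ZE]] : exists Z, 0 <= Z /\ Z = 3 * D / (8 * qh H h1).
  by exists (3 * D / (8 * qh H h1)); rewrite mulr_ge0// mulr_ge0// ltW.
exists (X + Y + Z + 1); split; first by rewrite ltr_wpDl// !addr_ge0.
move=> a delta /andP [a_gt0 aa0] /andP [delta_gt0 dd0] th.
set te := thetae H h0 h1 k c delta => hu.
have [u uE] : exists u, u = th - (thstar + te) by eexists.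
have thE : th - thstar = te + u by rewrite uE opprD [th + (_ - _)]addrA [RHS]addrC subrK.
rewrite -uE in hu; clear uE.
have s2 := root_s2 h0 Hpos h1N0 k0 c0 delta_gt0.
have sgt := root_s_gt h0 Hpos h1N0 k0 c0 delta_gt0.
have s2' : root_s H h0 h1 k c delta ^+ 2 = h0 ^+ 2 + delta * D.
  by rewrite s2 DE mulrA.
have gap := equilibrium_gap (ltW sgt) s2'.
have size := equilibrium_size (sqrtr_ge0 _) s2'.
have teT : `|te| <= T.
  rewrite /te /thetae /GJe -scalemxAr normrZ TE ler_wpM2r// normrM (ger0_norm qV0).
  rewrite ler_wpM2r//; apply: le_trans size _.
  by rewrite SE !lerD2l ler_pM2r.
have hH : H *m te = GJe H h0 h1 k c delta by exact: thetae_H.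
rewrite /objective thE mulmxDr !(dotvDl, dotvDr) hH dotv_thetae_GJe//.
have -> : dotv u (GJe H h0 h1 k c delta) = dotv te (H *m u).
  by rewrite [RHS]dotv_mulmx Hsym hH dotvC.
have b1 : `|dotv te (H *m u)| <= X * a.
  apply: le_trans (hC _ _) _.
  have h : `|te| * `|u| <= T * (2 * a) by apply: ler_pM.
  have -> : X * a = C * (T * (2 * a)) by rewrite XE; ring.
  by rewrite ler_pM2l.
have b2 : `|2^-1 * dotv u (H *m u)| <= Y * a.
  rewrite normrM (ger0_norm (_ : 0 <= 2^-1)) ?invr_ge0//.
  have h : `|u| * `|u| <= 2 * a * (2 * a) by apply: ler_pM.
  have h' : 2 * a * (2 * a) <= 4 * (a0 * a).
    have : a * a <= a0 * a by rewrite ler_pM2r.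
    lra.
  have -> : Y * a = 2^-1 * (C * (4 * (a0 * a))) by rewrite YE; field.
  rewrite ler_pM2l ?invr_gt0//; apply: le_trans (hC _ _) _.
  by rewrite ler_pM2l//; apply: le_trans h h'.
have b3 : `|(- h0 + root_s H h0 h1 k c delta) ^+ 2 / (8 * qh H h1) -
    Num.max 0 (- h0) ^+ 2 / (2 * qh H h1)| <= Z * delta.
  have -> : (- h0 + root_s H h0 h1 k c delta) ^+ 2 / (8 * qh H h1) -
      Num.max 0 (- h0) ^+ 2 / (2 * qh H h1) =
     ((- h0 + root_s H h0 h1 k c delta) ^+ 2 - 4 * Num.max 0 (- h0) ^+ 2) / (8 * qh H h1).
    by field; rewrite gt_eqF.
  rewrite normrM (ger0_norm qV8) (_ : Z * delta = 3 * (delta * D) / (8 * qh H h1)).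
    by rewrite ler_wpM2r.
  by rewrite ZE; ring.
have -> : Jstar + 2^-1 * ((- h0 + root_s H h0 h1 k c delta) ^+ 2 / (4 * qh H h1) +
      dotv te (H *m u) + (dotv te (H *m u) + dotv u (H *m u))) -
      (Jstar + Num.max 0 (- h0) ^+ 2 / (2 * qh H h1)) =
   ((- h0 + root_s H h0 h1 k c delta) ^+ 2 / (8 * qh H h1) -
    Num.max 0 (- h0) ^+ 2 / (2 * qh H h1)) +
   (dotv te (H *m u) + 2^-1 * dotv u (H *m u)).
  by field; rewrite gt_eqF.
apply: le_trans (ler_normD _ _) _.
apply: (@le_trans _ _ (Z * delta + (X * a + Y * a))).
  by apply: lerD => //; apply: le_trans (ler_normD _ _) (lerD _ _).
have z2 : 0 <= X * delta by rewrite mulr_ge0// ltW.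
have z3 : 0 <= Y * delta by rewrite mulr_ge0// ltW.
have z4 : 0 <= Z * a by rewrite mulr_ge0// ltW.
move: z2 z3 z4 a_gt0 delta_gt0; lra.
Qed.

End Final.

Theorem theorem1 (R : realType) (n : nat)
    (H : 'M[R]_n) (Jstar : R) (thstar : 'cV[R]_n) (h0 : R) (h1 : 'cV[R]_n)
    (wf k c : R) (om' : 'I_n -> R)
    (Hsym : H^T = H) (Hpos : posdef H) (h1_neq0 : h1 != 0)
    (wf_gt0 : 0 < wf) (k_gt0 : 0 < k) (c_gt0 : 0 < c)
    (om'_adm : admissible_freq om') :
  let J := objective H Jstar thstar in
  let h := constraint h0 h1 thstar in
  exists Js : R, is_minimum J (safe_set h) Js /\
  forall a0 delta0 : R, 0 < a0 -> 0 < delta0 ->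
  exists K : R, 0 < K /\
  forall a delta : R, 0 < a <= a0 -> 0 < delta <= delta0 ->
  exists rho ws : R, [/\ 0 < rho, 0 < ws &
  forall x0 : state R n,
    enorm (stack (recenter thstar x0)
           - stack (equilibrium H Jstar h0 h1 k c a delta)) < rho ->
  forall w : R, ws <= w ->
    let om := fun i => w * om' i in
    let F := asfes_field J h wf k c a delta om in
    (exists x : R -> state R n, is_solution F x /\ x 0 = x0) /\
    (forall x : R -> state R n, is_solution F x -> x 0 = x0 ->
      (`| limf_esup (fun t : R => (J (st_theta (x t) + dither a om t))%:E)
                    (pinfty_nbhs R) - Js%:E |
       <= (K * (1 / w + a + delta))%:E)%E)].
Proof.
move=> J h; exists (Jstar + Num.max 0 (- h0) ^+ 2 / (2 * qh H h1)).
split; first exact: is_minimum_halfspace.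
move=> a0 delta0 a00 delta00.
have [K [K0 cost]] := cost_near_equilibrium Jstar h0 thstar Hsym Hpos h1_neq0 k_gt0 c_gt0 a00 delta00.
exists K; split=> // a delta ha hdelta.
have /andP [a_gt0 aa0] := ha; have /andP [delta_gt0 dd0] := hdelta.
case: om'_adm => om_pos _ om_inj _.
have [rho [ws [rho0 ws0 stab]]] := @local_stability R n H Jstar thstar h0 h1 wf k c a delta om'
  Hsym Hpos h1_neq0 wf_gt0 k_gt0 c_gt0 a_gt0 delta_gt0 om_pos om_inj a a_gt0.
exists rho, ws; split=> // x0 hx0 w ww om F.
have w0 : 0 < w by apply: lt_le_trans ww.
pose xe := eq_state H Jstar thstar h0 h1 k c a delta.
have xeE : equilibrium H Jstar h0 h1 k c a delta = recenter thstar xe.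
  rewrite /equilibrium /xe /eq_state /recenter /root_s /GJe /thetae /etaJe /etahe /GJe /root_s /dh /bh /qh.
  by rewrite !enorm_sq (addrC thstar) addrK div1r.
have rec x y : stack (recenter thstar x) - stack (recenter thstar y) = stack x - stack y.
  case: x => th G eJ g eh gam; case: y => th' G' eJ' g' eh' gam'.
  by rewrite /stack /= !opp_col_mx !add_col_mx opprD addrACA opprK addNr addr0.
have x0d : `|stack x0 - stack xe| < rho.
  apply: le_lt_trans hx0; rewrite xeE rec.
  by rewrite -ler_sqr ?nnegrE ?sqrtr_ge0// enorm_sq dotv_ge_normsq.
have FE t v : fast_field H Jstar thstar h0 h1 wf k c a delta om' (w * t) v =
    stack (F t (unstack v)).
  rewrite /fast_field /F; congr stack.
  have dE : dither a om' (w * t) = dither a om t.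
    by apply/matrixP => i j; rewrite !mxE /om mulrA (mulrC (om' i)).
  have mE : demod a om' (w * t) = demod a om t.
    by apply/matrixP => i j; rewrite !mxE /om mulrA (mulrC (om' i)).
  by case: (unstack v) => *; rewrite /asfes_field dE mE.
have [[y [y0 cy dy]] sol] := stab w ww (stack x0) x0d.
split.
  exists (fun t => unstack (y t)); split; last by rewrite y0 stackK.
  have E : @stack R n \o (fun t => unstack (y t)) = y.
    by apply/funext => t /=; rewrite unstackK.
  split; first by rewrite E; apply: continuous_subspaceT; exact: cy.
  by move=> t t0; rewrite E -FE; exact: dy.
move=> x [cx dx] xx0; apply: limf_esup_near => t t0.
have : `|stack (x t) - stack xe| < a.
  have dx' (s : R) : 0 < s -> is_derive s 1 (@stack R n \o x)
      (fast_field H Jstar thstar h0 h1 wf k c a delta om' (w * s) ((@stack R n \o x) s)).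
    move=> s0; rewrite FE; have -> : unstack ((@stack R n \o x) s) = x s by exact: stackK.
    exact: dx.
  exact: (sol (@stack R n \o x) (congr1 (@stack R n) xx0) cx dx' t t0).
move=> /ltW hxt.
have hth : `|st_theta (x t) - (thstar + thetae H h0 h1 k c delta)| <= a.
  apply: le_trans hxt; apply: norm_le_coord => // i j; rewrite ord1.
  have -> : (st_theta (x t) - (thstar + thetae H h0 h1 k c delta)) i 0 =
      (stack (x t) - stack xe) (lshift _ i) 0.
    by case: (x t) => *; rewrite /xe /eq_state /stack opp_col_mx add_col_mx col_mxEu.
  exact: coord_le_norm.
have hu : `|st_theta (x t) + dither a om t - (thstar + thetae H h0 h1 k c delta)| <= 2 * a.
  rewrite addrAC; apply: le_trans (ler_normD _ _) _; rewrite mulr_natl mulr2n lerD//.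
  apply: norm_le_coord => [|i j]; first exact: ltW.
  rewrite mxE normrM (gtr0_norm a_gt0) ler_piMr ?(ltW a_gt0)//; exact: norm_sin_le1.
apply: le_trans (cost a delta ha hdelta _ hu) _.
by rewrite ler_pM2l// -addrA lerDr divr_ge0// ltW.
Qed.
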